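(* Let $L>0$ and $T>0$ be fixed, and let $Z$ be the (mild) solution of the linear stochastic equation $$\partial_t Z=\mathcal{L}_1 Z+\dot\xi \ \text{ on } [0,T]\times\mathbb{T}^2,\qquad Z(0)=0,$$ where $\mathcal{L}_1=-(1+\partial_x^2)^2+\partial_y^2+1$ and $\dot\xi$ is real-valued space-time white noise on $\mathbb{T}^2=\mathbb{R}^2/(2L\mathbb{Z})^2$. Let $p\ge 1$, $s\in[0,\tfrac18)$ and $\alpha\in(0,\tfrac18-s)$. Then $Z$ has a modification in $C^{\alpha}([0,T];\mathcal{W}^{s,p}(\mathbb{T}^2))$. Moreover, there exists a positive constant $M_{p,T,L}$ such that $$\mathbb{E}\Big(\sup_{t\in[0,T]}\|Z(t)\|_{L^p(\mathbb{T}^2)}\Big)\le M_{p,T,L}.$$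
   Context: Torus: $\mathbb{T}^2=\mathbb{R}^2/(2L\mathbb{Z})^2$, identified with $[-L,L)^2$; functions on $\mathbb{T}^2$ are functions on $\mathbb{R}^2$ that are $2L$-periodic in each variable. $L^p(\mathbb{T}^2)$ is taken with respect to the normalized Lebesgue measure $d\nu_2=\frac{1}{(2L)^2}\,dx\,dy$. Operators: for $\varepsilon\in\{0,1\}$, $\mathcal{L}_\varepsilon=-(1+\partial_x^2)^2+\partial_y^2+\varepsilon^2$. With $e_{k,l}(x,y)=\frac{1}{2L}e^{-i\pi(kx+ly)/L}$, $k,l\in\mathbb{Z}$, one has $\mathcal{L}_\varepsilon e_{k,l}=\lambda_{k,l,\varepsilon}e_{k,l}$, where $\lambda_{k,l,\varepsilon}=-\big\{(1-(\tfrac{\pi}{L})^2k^2)^2+(\tfrac{\pi}{L})^2l^2-\varepsilon^2\big\}$. Function spaces: for $s\in\mathbb{R}$ and $1\le p<\infty$, $\mathcal{W}^{s,p}(\mathbb{T}^2)$ is the space of periodic distributions $f$ with $\|f\|_{\mathcal{W}^{s,p}}:=\|(1-\mathcal{L}_0)^{s/2}f\|_{L^p(\mathbb{T}^2)}<\infty$, where $(1-\mathcal{L}_0)^{s/2}$ is the Fourier multiplier acting on $e_{k,l}$ by $(1-\lambda_{k,l,0})^{s/2}$. For a Banach space $B$, $C^\alpha([0,T];B)$ is the set of $B$-valued functions $f$ on $[0,T]$ with $\sup_{t\ne r}\|f(t)-f(r)\|_B/|t-r|^\alpha<\infty$. Noise: on a probability space $(\Omega,\mathcal{F},\mathbb{P})$,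 $\xi(t,x,y)=\sum_{k,l\in\mathbb{Z}}\beta_{k,l}(t)e_{k,l}(x,y)$ is an $L^2(\mathbb{T}^2)$-cylindrical Wiener process, where $\{\beta_{k,l}\}$ are Brownian motions with $\mathbb{E}|\beta_{k,l}(t)|^2=t$, independent except for the constraint $\beta_{-k,-l}=\overline{\beta_{k,l}}$ (so $\beta_{0,0}$ is real, the other $\beta_{k,l}$ are complex with independent real and imaginary parts of equal variance, and $\xi$ is real-valued). Mild solution: $Z(t)=\int_0^t e^{(t-r)\mathcal{L}_1}d\xi(r)=\sum_{k,l\in\mathbb{Z}}\Big(\int_0^t e^{(t-r)\lambda_{k,l,1}}d\beta_{k,l}(r)\Big)e_{k,l}$. In the last estimate of the claim, $Z$ denotes its continuous modification. *)

(* Defs.v *)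
From HB Require Import structures.
From mathcomp Require Import all_boot all_order all_algebra.
From mathcomp Require Import all_classical all_reals all_analysis.
From mathcomp Require Import complex.

Set Implicit Arguments.
Unset Strict Implicit.
Unset Printing Implicit Defensive.

Import Order.TTheory GRing.Theory Num.Theory.
Import numFieldNormedType.Exports.

Local Open Scope classical_set_scope.
Local Open Scope ring_scope.

Definition cmod {R : realType} (z : R[i]) : R := ComplexField.Normc.normc z.

Definition cmeasurable {d : measure_display} {R : realType}
    {X : measurableType d} (f : X -> R[i]) : Prop :=
  measurable_fun setT (fun x => complex.Re (f x)) /\
  measurable_fun setT (fun x => complex.Im (f x)).

Definition cintegral {d : measure_display} {R : realType}
    {X : measurableType d} (mu : {measure set X -> \bar R})
    (f : X -> R[i]) : R[i] :=
  Complex (Rintegral mu setT (fun x => complex.Re (f x)))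
          (Rintegral mu setT (fun x => complex.Im (f x))).

(* A function on the torus is a 2L-periodic function on R^2; it is integrated
   over the fundamental domain [-L,L)^2. *)
Notation plane R := (measurableTypeR R * measurableTypeR R)%type.
Section Torus.
Context {R : realType}.
Implicit Types (L p s : R) (f g : R * R -> R[i]).

Definition periodic L f : Prop :=
  forall x y, f (x + 2 * L, y) = f (x, y) /\ f (x, y + 2 * L) = f (x, y).

Definition cell L : set (plane R) := `[- L, L[%classic `*` `[- L, L[%classic.

Lemma measurable_cell L : measurable (cell L).
Proof. by apply: measurableX; exact: measurable_itv. Qed.

Definition dxdy L : {measure set (plane R) -> \bar R} :=
  mrestr (@lebesgue_measure R \x @lebesgue_measure R)%E (@measurable_cell L).

Definition nu2 L : {measure set (plane R) -> \bar R} :=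
  mscale (NngNum (sqr_ge0 (2 * L)^-1)) (dxdy L).

Definition Lp_norm L p f : \bar R :=
  Lnorm (nu2 L) p%:E (fun z => (cmod (f z))%:E).

Definition Lp_fun L p f : Prop :=
  [/\ periodic L f, cmeasurable (f : plane R -> R[i]) & (Lp_norm L p f < +oo)%E].

Definition ebasis L (k l : int) : R * R -> R[i] := fun z =>
  let theta := pi * (k%:~R * z.1 + l%:~R * z.2) / L in
  Complex ((2 * L)^-1 * cos theta) (- ((2 * L)^-1 * sin theta)).

Definition lambda L (eps : R) (k l : int) : R :=
  - ((1 - (pi / L) ^+ 2 * k%:~R ^+ 2) ^+ 2 + (pi / L) ^+ 2 * l%:~R ^+ 2
     - eps ^+ 2).

(* [w] lists the variables of differentiation: [true] for x, [false] for y. *)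
Definition pderiv (w : seq bool) (h : R * R -> R) : R * R -> R :=
  foldr (fun (b : bool) (g : R * R -> R) (z : R * R) =>
           'D_(if b then (1, 0) else (0, 1) : R * R) g z) h w.

Definition smooth (h : R * R -> R) : Prop :=
  forall (w : seq bool) (z : R * R), differentiable (pderiv w h) z.

Definition test_fun L (phi : R * R -> R[i]) : Prop :=
  [/\ periodic L phi, smooth (fun z => complex.Re (phi z))
    & smooth (fun z => complex.Im (phi z))].

(* A periodic distribution is a functional on all functions of which only the
   values at test functions matter. *)
Definition functional : Type := (R * R -> R[i]) -> R[i].

Definition periodic_distribution L (u : functional) : Prop :=
  (forall (a b : R[i]) phi psi, test_fun L phi -> test_fun L psi ->
     u (fun z => a * phi z + b * psi z) = a * u phi + b * u psi) /\
  exists (N : nat) (C : R), forall phi (A : R), test_fun L phi ->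
    (forall w z, (size w <= N)%N ->
       `|pderiv w (fun z' => complex.Re (phi z')) z| <= A /\
       `|pderiv w (fun z' => complex.Im (phi z')) z| <= A) ->
    cmod (u phi) <= C * A.

(* Embedding of integrable functions into distributions. *)
Definition distr_of L f : functional :=
  fun phi => cintegral (dxdy L) (fun z => f z * phi z).

(* Coefficient on [ebasis L k l], whose conjugate is [ebasis L (- k) (- l)]. *)
Definition fcoef L (u : functional) (k l : int) : R[i] :=
  u (ebasis L (- k) (- l)).

(* The function [g] represents (1 - L_0)^(s/2) u. *)
Definition represents_bessel L s (u : functional) g : Prop :=
  forall k l : int, fcoef L (distr_of L g) k l =
    Complex ((1 - lambda L 0 k l) `^ (s / 2)) 0 * fcoef L u k l.

(* The set below contains at most one value, since a function in L^p is
   determined up to a null set by its Fourier coefficients; the norm is +oo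
   when (1 - L_0)^(s/2) u is not a function in L^p. *)
Definition W_norm L s p (u : functional) : \bar R :=
  ereal_inf [set Lp_norm L p g |
    g in [set g | Lp_fun L p g /\ represents_bessel L s u g]].

Definition W L s p : set functional :=
  [set u | periodic_distribution L u /\ (W_norm L s p u < +oo)%E].

(* C^alpha([0,T]; W^{s,p}) *)
Definition holder_W L T alpha s p (gamma : R -> functional) : Prop :=
  (forall t, 0 <= t <= T -> W L s p (gamma t)) /\
  exists C : R, forall t r, 0 <= t <= T -> 0 <= r <= T -> t != r ->
    (W_norm L s p (fun phi => (gamma t phi - gamma r phi)%R)
       <= (C * `|t - r| `^ alpha)%:E)%E.

(* C([0,T]; L^p) *)
Definition continuous_Lp L T p (gamma : R -> R * R -> R[i]) : Prop :=
  (forall t, 0 <= t <= T -> Lp_fun L p (gamma t)) /\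
  forall t, 0 <= t <= T -> forall e : R, 0 < e ->
    exists2 delta : R, 0 < delta &
      forall r, 0 <= r <= T -> `|r - t| < delta ->
        (Lp_norm L p (fun z => gamma r z - gamma t z)%R < e%:E)%E.

End Torus.

Section Noise.
Context {d : measure_display} {R : realType} {Omega : measurableType d}.
Variable P : probability Omega R.

(* Mutual independence of the systems [G i], for [i] in [D]. *)
Definition independent {I : eqType} (D : set I) (G : I -> set (set Omega)) :
    Prop :=
  forall (r : seq I) (E : I -> set Omega), uniq r ->
    (forall i, i \in r -> D i /\ G i (E i)) ->
    P (\bigcap_(i in [set` r]) E i) = (\prod_(i <- r) P (E i))%E.

Definition sigma_process {J : Type} (D : set J) (X : J -> Omega -> R) :
    set (set Omega) :=
  <<s \bigcup_(j in D) preimage_set_system setT (X j) measurable >>.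

(* Brownian motion on [0,+oo) with variance v t at time t. *)
Definition brownian (v : R) (B : R -> Omega -> R) : Prop :=
  [/\ forall t, 0 <= t -> measurable_fun setT (B t),
      {ae P, forall w, B 0 w = 0},
      forall r t, 0 <= r -> r < t -> forall A : set R, measurable A ->
        P ((fun w => B t w - B r w) @^-1` A) =
        normal_prob 0 (Num.sqrt (v * (t - r))) A,
      forall tau : nat -> R, 0 <= tau 0%N -> nondecreasing_seq tau ->
        independent setT (fun j : nat =>
          sigma_process setT (fun (_ : unit) w =>
            B (tau j.+1) w - B (tau j) w))
    & {ae P, forall w, {within `[0, +oo[%classic,
        continuous (fun t => B t w)}}].

(* One index out of each pair {(k,l), (-k,-l)}. *)
Definition half_lattice (k l : int) : bool :=
  (0 < k) || ((k == 0) && (0 <= l)).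

Definition component (b : bool) (z : R[i]) : R :=
  if b then complex.Re z else complex.Im z.

(* The Brownian motions (beta_{k,l}) driving a real cylindrical Wiener process:
   E|beta_{k,l}(t)|^2 = t, and beta_{-k,-l} = conj beta_{k,l} is the only
   dependence.  The conjugation constraint forces Im beta_{0,0} = 0. *)
Definition cylindrical_wiener (beta : int -> int -> R -> Omega -> R[i]) :
    Prop :=
  [/\ forall k l t w, 0 <= t -> beta (- k) (- l) t w = conjc (beta k l t w),
      brownian 1 (fun t w => complex.Re (beta 0 0 t w)),
      forall k l, (k, l) != (0, 0) -> forall b,
        brownian 2^-1 (fun t w => component b (beta k l t w))
    & independent [set i : int * int * bool | half_lattice i.1.1 i.1.2]
        (fun i => sigma_process [set t : R | 0 <= t]
           (fun t w => component i.2 (beta i.1.1 i.1.2 t w)))].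

(* A triple (a, b, c) of a step function stands for c 1_{(a,b]}. *)
Definition step_fun (h : seq (R * R * R)) : R -> R := fun r =>
  \sum_(j <- h) j.2 * \1_(`]j.1.1, j.1.2]%classic) r.

Definition step_integral (h : seq (R * R * R)) (B : R -> Omega -> R[i]) :
    Omega -> R[i] := fun w =>
  \sum_(j <- h) Complex j.2 0 * (B j.1.2 w - B j.1.1 w).

Definition is_step (t : R) (h : seq (R * R * R)) : Prop :=
  forall j, j \in h -> 0 <= j.1.1 /\ j.1.1 <= j.1.2 /\ j.1.2 <= t.

(* [J] is the Wiener integral of [f] against [B] over [0,t]: the image of [f]
   under the continuous extension of [step_integral] from step functions to
   L^2(0,t). *)
Definition wiener_integral (t : R) (f : R -> R) (B : R -> Omega -> R[i])
    (J : Omega -> R[i]) : Prop :=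
  cmeasurable J /\
  exists h : nat -> seq (R * R * R),
    [/\ forall n, is_step t (h n),
        (\int[lebesgue_measure]_(r in `[0%R, t]%classic)
           ((step_fun (h n) r - f r) ^+ 2)%:E)%E @[n --> \oo] --> 0%E
      & (\int[P]_w (cmod (step_integral (h n) B w - J w) ^+ 2)%:E)%E
          @[n --> \oo] --> 0%E].

(* Joint measurability makes w |-> X w a random variable in each separable
   space of functions on the torus to which its values belong. *)
Definition random_field (L : R) (X : Omega -> R * R -> R[i]) : Prop :=
  cmeasurable (fun wz : Omega * plane R => X wz.1 wz.2) /\
  forall w, periodic L (X w).

Definition int_box (N : nat) : seq int :=
  [seq i%:Z - N%:Z | i <- iota 0 (2 * N).+1].

(* The series over k, l converges in L^2(Omega; L^2(torus)). *)
Definition mild_solution (L T : R) (beta : int -> int -> R -> Omega -> R[i])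
    (Z : R -> Omega -> R * R -> R[i]) : Prop :=
  exists J : int -> int -> R -> Omega -> R[i],
    (forall k l t, 0 <= t <= T ->
       wiener_integral t (fun r => expR ((t - r) * lambda L 1 k l))
         (beta k l) (J k l t)) /\
    forall t, 0 <= t <= T ->
      random_field L (Z t) /\
      (\int[P]_w \int[nu2 L]_z
         (cmod (Z t w z -
            \sum_(k <- int_box N) \sum_(l <- int_box N)
              J k l t w * ebasis L k l z) ^+ 2)%:E)%E @[N --> \oo] --> 0%E.

Definition modification (L T : R) (Z Z' : R -> Omega -> R * R -> R[i]) : Prop :=
  forall t, 0 <= t <= T ->
    [/\ random_field L (Z' t),
        forall w, Lp_fun L 1 (Z' t w)
      & {ae P, forall w, {ae nu2 L, forall z, Z' t w z = Z t w z}}].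

End Noise.

(* Main.v *)
(* Finite linear combinations of the Fourier coefficients of Z are Wiener
   integrals, whose exponential moments are of Gaussian size: the lattice is
   split into two halves on each of which the Brownian motions are independent.
   Hence all even moments are controlled by variances.  The symbol
   nu = 1 - lambda_0 dominates (1 + |k|)^4 and
   (1 + |l|)^2, so that the sum of nu^(-q) is finite for q > 3/4; for
   theta < 1/4 - s the time increments of (1 - L_0)^(s/2) Z therefore have
   variance O(|t - r|^theta), and its Fourier modes outside the box of side 2^n
   have variance O(2^(-n theta)).

   The field is then built by Kolmogorov chaining in L^(2m): at level n both
   the times are restricted to the dyadic grid of mesh T/2^n and the Fourier
   series to the box of side 2^n.  The weighted sum of all the increments (the
   energy) has finite expectation as soon as 2 alpha + 1/m < theta, and it
   bounds the C^alpha([0,T]; L^(2m)) norm of the limit.  Running the construction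
   for s = 0 and for s on the same coefficients gives Z and (1 - L_0)^(s/2) Z,
   since the relation between their Fourier coefficients holds at every level.
   Any continuous modification agrees almost surely with the limit at all dyadic
   times, which bounds its supremum by the energy. *)
Require Import Defs.
From HB Require Import structures.
From mathcomp Require Import all_boot all_order all_algebra.
From mathcomp Require Import all_classical all_reals all_analysis measurable_realfun.
From mathcomp Require Import complex.
From mathcomp Require Import ring lra zify.
Import Order.TTheory GRing.Theory Num.Theory.
Import numFieldNormedType.Exports.
Local Open Scope classical_set_scope.
Local Open Scope ring_scope.

Set Implicit Arguments.
Unset Strict Implicit.
Unset Printing Implicit Defensive.

(** The threshold 1/4 is 1 - 3/4: weighting a mode by [symbol] to the power [s] and extracting
    [|t - r|] to the power [theta] leaves the series of [symbol] to the power [s + theta - 1].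
    Moments of order [2 * m] of increments with variance of order [theta] in time give Hölder
    exponents below [theta / 2], which turns 1/4 into 1/8. No joint Gaussian law is identified; only
    upper bounds for even moments are carried along. An exponential moment at most
    [expR (2 * y ^+ 2 * V)], read at [y ^+ 2 = V^-1], bounds the moment of order [2 * m] by a
    constant times [V ^+ m]. Such a bound tolerates the constant lost in separating the two
    dependent halves of the lattice, and it passes to mean-square limits by Fatou's lemma. Moments
    are taken at a fixed point of the torus and integrated over the torus afterwards: the modes have
    constant modulus, so the bounds are uniform in the point. Before the limit the field is a
    trigonometric polynomial with random coefficients, so that joint measurability, periodicity and
    Fourier coefficients are explicit there. *)

Section Transfer.
Local Open Scope ereal_scope.
Import HBNNSimple.

(** The hypothesis says that [nu] is the image under [phi] of the measure with density [W] with
    respect to [mu]. Laws are the case [W = 1], densities and the restriction to the cell are the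
    case [phi = id], and the induction for independent products needs both at once. *)
Lemma integral_transfer (R : realType) (dX dY : measure_display)
    (X : measurableType dX) (Y : measurableType dY)
    (mu : {measure set X -> \bar R}) (nu : {measure set Y -> \bar R})
    (W : X -> R) (phi : X -> Y) :
  measurable_fun setT W -> (forall x, 0 <= W x)%R -> measurable_fun setT phi ->
  (forall A, measurable A -> \int[mu]_x ((W x)%:E * (\1_(phi @^-1` A) x)%:E) = nu A) ->
  forall f : Y -> \bar R, measurable_fun setT f -> (forall y, 0 <= f y) ->
  \int[mu]_x ((W x)%:E * f (phi x)) = \int[nu]_y f y.
Proof.
move=> /measurable_EFinP mW W0 mphi WE f mf f0.
pose h := nnsfun_approx measurableT mf.
have hcvg y : (h n y)%:E @[n --> \oo] --> f y by exact: cvg_nnsfun_approx.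
have -> : \int[nu]_y f y = limn (fun n => \int[nu]_y (h n y)%:E).
  rewrite -monotone_convergence//.
  - by apply: eq_integral => y _; apply/esym/cvg_lim.
  - by move=> n; apply/measurable_EFinP.
  - by move=> n x _ ; rewrite lee_fin.
  - by move=> x _ a b ab; rewrite lee_fin; exact/lefP/nd_nnsfun_approx.
have mfib n r : measurable_fun setT (fun x => (r * \1_(phi @^-1` (h n @^-1` [set r])) x)%:E : \bar R).
  apply/measurable_EFinP/measurable_funM => //.
  by apply: measurable_indic; rewrite -[X in measurable X]setTI; exact: mphi.
have -> : \int[mu]_x ((W x)%:E * f (phi x)) = limn (fun n => \int[mu]_x ((W x)%:E * (h n (phi x))%:E)).
  rewrite -monotone_convergence//.
  - apply: eq_integral => x _; apply/esym/cvg_lim => //.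
    by apply: cvgeZl => //; exact: hcvg.
  - by move=> n; apply: emeasurable_funM => //; apply/measurable_EFinP; exact: measurableT_comp.
  - by move=> n x _; rewrite mule_ge0// ?lee_fin.
  - by move=> x _ a b ab; apply: lee_wpmul2l; rewrite lee_fin//; exact/lefP/nd_nnsfun_approx.
suff suf n : \int[mu]_x ((W x)%:E * (h n (phi x))%:E) = \int[nu]_y (h n y)%:E.
  by under eq_fun do rewrite suf.
transitivity (\int[mu]_x \sum_(y \in range (h n)) ((W x)%:E *
    (y * \1_(phi @^-1` (h n @^-1` [set y])) x)%:E)).
  apply: eq_integral => x _; rewrite fimfunE -fsumEFin// ge0_mule_fsumr //.
  by move=> y; exact: nnfun_muleindic_ge0.
rewrite ge0_integral_fsum//; last 2 first.
  - by move=> y; exact: emeasurable_funM.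
  - move=> y x _; rewrite mule_ge0 ?lee_fin//.
    exact: (nnfun_muleindic_ge0 (h n) y (phi x)).
transitivity (\int[nu]_y \sum_(r \in range (h n)) (r * \1_(h n @^-1` [set r]) y)%:E); last first.
  by apply: eq_integral => t tE; rewrite fimfunE -fsumEFin.
rewrite ge0_integral_fsum//; last 2 first.
  - by move=> y; apply/measurable_EFinP/measurable_funM.
  - by move=> y x _; exact: nnfun_muleindic_ge0.
apply: eq_fsbigr => r; rewrite inE => -[y _ yr].
have r0 : (0 <= r)%R by rewrite -yr.
under eq_integral do rewrite EFinM muleCA.
have mind : measurable_fun setT (fun x => (\1_(phi @^-1` (h n @^-1` [set r])) x : R)%:E).
  apply/measurable_EFinP/measurable_indic.
  by rewrite -[X in measurable X]setTI; exact: mphi.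
rewrite ge0_integralZl_EFin//; last 2 first.
  - by move=> x _; rewrite mule_ge0// lee_fin.
  - exact: emeasurable_funM.
under [RHS]eq_integral do rewrite EFinM.
rewrite ge0_integralZl_EFin//; last exact/measurable_EFinP/measurable_indic.
by rewrite WE// integral_indic// setIT.
Qed.

End Transfer.

(** * Independence and integrals of products *)

Lemma prod_indic (T : Type) (R : realType) (I : eqType) (r : seq I)
    (E : I -> set T) (x : T) :
  \prod_(i <- r) (\1_(E i) x : R) = \1_(\bigcap_(i in [set` r]) E i) x.
Proof.
elim: r => [|i r IH].
  rewrite big_nil (_ : bigcap _ _ = setT) ?indicT//.
  by apply/seteqP; split => // y _ j; rewrite /= in_nil.
rewrite big_cons IH !indicE -natrM mulnb; congr (_%:R).
rewrite -in_setI; congr (nat_of_bool (x \in _)); apply/seteqP; split => y /=.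
  by move=> [Ei Er] j /=; rewrite in_cons => /predU1P[->//|]; exact: Er.
move=> H; split; first by apply: H; rewrite /= mem_head.
by move=> j jr; apply: H; rewrite /= in_cons jr orbT.
Qed.

Lemma measurable_bigcap_seq d (T : measurableType d) (I : eqType) (r : seq I)
    (E : I -> set T) : (forall i, i \in r -> measurable (E i)) ->
  measurable (\bigcap_(i in [set` r]) E i).
Proof.
elim: r => [|i r IH] mE.
  by rewrite (_ : bigcap _ _ = setT)//; apply/seteqP; split => // y _ j.
rewrite (_ : bigcap _ _ = E i `&` \bigcap_(j in [set` r]) E j).
  apply: measurableI; first by apply: mE; rewrite mem_head.
  by apply: IH => j jr; apply: mE; rewrite in_cons jr orbT.
apply/seteqP; split => [y H|y [Ei Er] j /=].
  split; first by apply: H; rewrite /= mem_head.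
  by move=> j jr; apply: H; rewrite /= in_cons jr orbT.
by rewrite in_cons => /predU1P[->//|]; exact: Er.
Qed.

Section IndependentProduct.
Context {d : measure_display} {R : realType} {Omega : measurableType d}.
Variable P : probability Omega R.

(* Indicators are replaced one at a time by general factors, so that only the
   product rule for events of the given sigma-algebras is used. *)
Lemma integral_prod_independent_indic (I : eqType) (D : set I)
    (G : I -> set (set Omega)) (s t : seq I) (f : I -> Omega -> R)
    (E : I -> set Omega) :
  independent P D G -> (forall i A, D i -> G i A -> measurable A) ->
  uniq (s ++ t) ->
  (forall i, i \in s -> D i /\ forall A, measurable A -> G i (f i @^-1` A)) ->
  (forall i, i \in t -> D i /\ G i (E i)) ->
  (forall i w, 0 <= f i w) ->
  (forall i, i \in s -> (\int[P]_w (f i w)%:E < +oo)%E) ->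
  (\int[P]_w (\prod_(i <- s) f i w * \prod_(i <- t) \1_(E i) w)%:E =
   \prod_(i <- s) \int[P]_w (f i w)%:E * \prod_(i <- t) P (E i))%E.
Proof.
move=> indep Gm; elim: s t E => [|i s IH] t E.
  move=> ut _ tE _ _; rewrite big_nil mul1e.
  under eq_integral do rewrite big_nil mul1r prod_indic.
  rewrite integral_indic//; last first.
    have {}tE i : i \in t -> measurable (E i) by move=> /tE[Di]; exact: Gm.
    exact: measurable_bigcap_seq.
  by rewrite setIT; exact: indep.
rewrite /= mem_cat negb_or -andbA => /and3P[is_ it us_t] sD tE f0 foo.
have sub j : j \in s -> D j /\ forall A, measurable A -> G j (f j @^-1` A).
  by move=> js; apply: sD; rewrite in_cons js orbT.
have mf j : j \in i :: s -> measurable_fun setT (f j).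
  move=> /sD[Dj Gj] _ A mA; rewrite setTI; exact: Gm Dj (Gj _ mA).
have foo' j : j \in s -> (\int[P]_w (f j w)%:E < +oo)%E.
  by move=> js; apply: foo; rewrite in_cons js orbT.
pose W w := \prod_(i <- s) f i w * \prod_(i <- t) \1_(E i) w.
have IHW : (\int[P]_w (W w)%:E =
  \prod_(i <- s) \int[P]_w (f i w)%:E * \prod_(i <- t) P (E i))%E by exact: IH.
have Wfin : (\int[P]_w (W w)%:E)%E \is a fin_num.
  rewrite IHW fin_numM//.
    rewrite big_seq; apply: (big_ind (fun x => x \is a fin_num)) => // [x y|j js]; first exact: fin_numM.
    by rewrite ge0_fin_numE ?foo'//; apply: integral_ge0 => w _; rewrite lee_fin.
  rewrite big_seq; apply: (big_ind (fun x => x \is a fin_num)) => // [x y|j /tE[Dj Gj]]; first exact: fin_numM.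
  by apply: fin_num_measure; exact: Gm Gj.
have W0 w : 0 <= W w.
  by rewrite mulr_ge0// prodr_ge0.
have mW : measurable_fun setT W.
  apply: measurable_funM; last first.
    under eq_fun do rewrite prod_indic.
    apply: measurable_indic; apply: measurable_bigcap_seq => j /tE[Dj].
    exact: Gm.
  (* Measurability of [f j] is known only for the indices of the list, so the product is first
     rewritten with factors that are 0 for all other indices. *)
  rewrite (_ : (fun w => _) = (fun w => \prod_(j <- s) (if j \in i :: s then f j else cst 0) w)).
    apply: measurable_prod => j _; case: ifPn => // js; exact: mf.
  apply/funext => w; rewrite big_seq [RHS]big_seq; apply: eq_bigr => j js.
  by rewrite in_cons js orbT.
have mfi := mf i (mem_head _ _).
have c0 : 0 <= fine (\int[P]_w (W w)%:E)%E.
  by apply: fine_ge0; apply: integral_ge0 => w _; rewrite lee_fin.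
pose c := NngNum c0.
pose fi : {mfun Omega >-> R} :=
  HB.pack (f i) (isMeasurableFun.Build _ _ _ _ _ mfi).
(* The induction hypothesis with one more indicator, that of an event of [f i], says that the image
   under [f i] of [P] weighted by [W] is a multiple of the law of [f i]. *)
have HA (A : set R) : measurable A ->
    (\int[P]_w ((W w)%:E * (\1_(f i @^-1` A) w)%:E) = mscale c (pushforward P fi) A)%E.
  move=> mA.
  change (mscale c (pushforward P fi) A) with
    ((fine (\int[P]_w (W w)%:E))%:E * P (f i @^-1` A))%E; rewrite fineK//.
  rewrite IHW.
  have := IH (i :: t) (fun j => if j == i then f i @^-1` A else E j).
  have PE : (\prod_(j <- t) P (if j == i then f i @^-1` A else E j) = \prod_(j <- t) P (E j))%E.
    apply: eq_big_seq.
    by move=> j jt; have -> : (j == i) = false by apply/eqP => ji; move: it; rewrite -ji jt.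
  rewrite big_cons eqxx PE -muleA [X in _ -> _ = (_ * X)%E]muleC => <-//; first last.
  - move=> j; rewrite in_cons; case: eqP => [-> _|_ /=]; last exact: tE.
    by have [Di Gi] := sD i (mem_head _ _); split => //; exact: Gi.
  - by rewrite -cat1s uniq_catCA cat1s /= mem_cat negb_or is_ it us_t.
  apply: eq_integral => w _; rewrite -EFinM; congr EFin.
  rewrite big_cons eqxx [RHS]mulrCA mulrC; congr (_ * (_ * _)).
  rewrite big_seq [RHS]big_seq; apply: eq_bigr => j jt.
  by have -> : (j == i) = false by apply/eqP => ji; move: it; rewrite -ji jt.
(* The identity on the line is not nonnegative although [f i] is; the absolute value is the
   nonnegative function to which the transfer applies. *)
have mnorm : measurable_fun [set: R] (fun y : R => `|y|%:E) by apply/measurable_EFinP.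
have H := integral_transfer mW W0 mfi (HA mfi) mnorm (fun y => normr_ge0 y).
transitivity (\int[P]_x ((W x)%:E * `|f i x|%:E))%E.
  apply: eq_integral => w _; rewrite ger0_norm// /W big_cons -EFinM.
  by congr EFin; ring.
rewrite H ge0_integral_mscale//.
rewrite ge0_integral_pushforward//.
rewrite big_cons /= fineK// IHW muleC muleA.
congr (_ * _ * _)%E; apply: eq_integral => w _ /=.
by rewrite ger0_norm.
Qed.

Lemma integral_prod_independent (I : eqType) (D : set I)
    (G : I -> set (set Omega)) (s : seq I) (f : I -> Omega -> R) :
  independent P D G -> (forall i A, D i -> G i A -> measurable A) ->
  uniq s ->
  (forall i, i \in s -> D i /\ forall A, measurable A -> G i (f i @^-1` A)) ->
  (forall i w, 0 <= f i w) ->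
  (forall i, i \in s -> (\int[P]_w (f i w)%:E < +oo)%E) ->
  (\int[P]_w (\prod_(i <- s) f i w)%:E = \prod_(i <- s) \int[P]_w (f i w)%:E)%E.
Proof.
move=> indep Gm us sD f0 foo.
have := @integral_prod_independent_indic I D G s [::] f (fun=> set0) indep Gm.
rewrite cats0 big_nil mule1 => <-//.
by apply: eq_integral => w _; rewrite big_nil mulr1.
Qed.

End IndependentProduct.

(** * Series with finite sum and almost everywhere convergent subsequences *)

Lemma cvge0_near_lt (R : realType) (u : nat -> \bar R) (e : R) :
  (u n @[n --> \oo] --> 0)%E -> 0 < e -> \forall n \near \oo, (u n < e%:E)%E.
Proof.
move=> /fine_cvgP[ufin ucvg] e0; near=> n.
rewrite -(@fineK _ (u n)); last by near: n.
by rewrite lte_fin; near: n; exact: (cvgr_lt _ ucvg).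
Unshelve. all: by end_near. Qed.

Lemma nneseries_geometric_le (R : realType) (z : R) : 0 < z -> z < 1 ->
  (\sum_(0 <= k <oo) (z ^+ k)%:E <= ((1 - z)^-1)%:E)%E.
Proof.
move=> z0 z1; apply: lime_le.
  by apply: is_cvg_nneseries => k _ _; rewrite lee_fin exprn_ge0// ltW.
apply: nearW => n; rewrite sumEFin lee_fin.
have := @geometric_le_lim R n 1 z ler01 z0; rewrite gtr0_norm// mul1r.
move=> /(_ z1); rewrite /series /=.
by under eq_bigr do rewrite mul1r.
Qed.

Lemma nneseries_EFin_cvg (R : realType) (u : nat -> R) :
  (\sum_(0 <= k <oo) (u k)%:E < +oo)%E -> (forall k, 0 <= u k) ->
  cvgn (series u).
Proof.
move=> uoo u0.
have cv : cvgn (fun n => \sum_(0 <= k < n) (u k)%:E)%E.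
  by apply: is_cvg_nneseries => k _ _; rewrite lee_fin.
have fin : (\sum_(0 <= k <oo) (u k)%:E)%E \is a fin_num.
  by rewrite ge0_fin_numE//; apply: nneseries_ge0 => k _ _; rewrite lee_fin.
have /fine_cvgP[_ H] : ((\sum_(0 <= k < n) (u k)%:E)%E @[n --> \oo] -->
    (fine (\sum_(0 <= k <oo) (u k)%:E)%E)%:E)%E by rewrite fineK.
apply/cvg_ex; exists (fine (\sum_(0 <= k <oo) (u k)%:E)%E).
suff -> : series u = fine \o (fun n => \sum_(0 <= k < n) (u k)%:E)%E by [].
by apply/funext => n; rewrite /series /= sumEFin.
Qed.

Lemma nneseries_EFin_cvg0 (R : realType) (u : nat -> R) :
  (\sum_(0 <= k <oo) (u k)%:E < +oo)%E -> (forall k, 0 <= u k) ->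
  u n @[n --> \oo] --> (0 : R).
Proof. by move=> uoo u0; apply: cvg_series_cvg_0; exact: nneseries_EFin_cvg. Qed.

(** Along [phi] the integrals are dominated by a geometric series, so the sum of the [g (phi k)] is
    integrable, hence finite almost everywhere, and its terms tend to 0. The condition [k <= phi k]
    preserves whatever holds for all large indices. *)
Lemma ae_cvg_subseq (d : measure_display) (R : realType) (X : measurableType d)
    (mu : {measure set X -> \bar R}) (g : nat -> X -> R) :
  (forall n, measurable_fun setT (g n)) -> (forall n x, 0 <= g n x) ->
  (\int[mu]_x (g n x)%:E @[n --> \oo] --> 0)%E ->
  exists phi : nat -> nat, (forall k, (k <= phi k)%N) /\
    {ae mu, forall x, g (phi k) x @[k --> \oo] --> (0 : R)}.
Proof.
move=> mg g0 gcvg.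
have phiP k : exists n, (k <= n)%N /\ (\int[mu]_x (g n x)%:E <= (2^-1 ^+ k : R)%:E)%E.
  have : \forall n \near \oo, (\int[mu]_x (g n x)%:E < (2^-1 ^+ k : R)%:E)%E.
    by apply: cvge0_near_lt => //; rewrite exprn_gt0.
  case=> N _ NP; exists (maxn k N); rewrite leq_maxl; split => //.
  by apply/ltW/NP; rewrite /= leq_maxr.
pose phi k := projT1 (cid (phiP k)).
have phi1 k : (k <= phi k)%N by rewrite /phi; case: cid => n [].
have phi2 k : (\int[mu]_x (g (phi k) x)%:E <= (2^-1 ^+ k : R)%:E)%E.
  by rewrite /phi; case: cid => n [].
exists phi; split => //.
have mS : measurable_fun setT (fun x => \sum_(0 <= k <oo) (g (phi k) x)%:E)%E.
  apply: ge0_emeasurable_sum => [k x _ _|k _]; first by rewrite lee_fin.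
  exact/measurable_EFinP.
have Soo : (\int[mu]_x (\sum_(0 <= k <oo) (g (phi k) x)%:E) < +oo)%E.
  rewrite integral_nneseries//; last first.
  - by move=> k x _; rewrite lee_fin.
  - by move=> k; exact/measurable_EFinP.
  apply: (@le_lt_trans _ _ (\sum_(0 <= k <oo) (2^-1 ^+ k : R)%:E)%E).
    by apply: lee_nneseries => // k _ _; apply: integral_ge0 => x _; rewrite lee_fin.
  by apply: le_lt_trans (nneseries_geometric_le _ _) _; rewrite ?invr_gt0 ?invf_lt1 ?ltr1n ?ltry.
have : mu.-integrable setT (fun x => \sum_(0 <= k <oo) (g (phi k) x)%:E)%E.
  apply/integrableP; split => //.
  rewrite (eq_integral (fun x => \sum_(0 <= k <oo) (g (phi k) x)%:E)%E)//.
  move=> x _; rewrite gee0_abs//; apply: nneseries_ge0 => k _ _.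
  by rewrite lee_fin.
move=> /(integrable_ae measurableT); apply: filterS => x /(_ I) fin.
have : (\sum_(0 <= k <oo) (g (phi k) x)%:E < +oo)%E by rewrite ltey_eq fin.
move=> /nneseries_EFin_cvg0; apply => k; exact: g0.
Qed.

(** * Exponential moments of a normal variable *)

Section NormalMgf.
Context {d : measure_display} {R : realType} {Omega : measurableType d}.
Variable P : probability Omega R.

Lemma integral_normal_distribution (X : Omega -> R) (sigma : R) :
  measurable_fun setT X ->
  (forall A : set R, measurable A -> P (X @^-1` A) = normal_prob 0 sigma A) ->
  forall f : R -> \bar R, measurable_fun setT f -> (forall x, 0 <= f x)%E ->
  (\int[P]_w f (X w) =
   \int[lebesgue_measure]_x ((normal_pdf 0 sigma x)%:E * f x))%E.
Proof.
move=> mX XP f mf f0.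
have := @integral_transfer R _ _ _ _ lebesgue_measure (normal_prob 0 sigma) (normal_pdf 0 sigma) id.
move=> -> //=; first last.
- move=> A mA; rewrite /normal_prob [RHS]integral_mkcond.
  apply: eq_integral => x _; rewrite patchE indicE.
  by case: ifPn => xA; rewrite ?mule1 ?mule0.
- exact: normal_pdf_ge0.
- exact: measurable_normal_pdf.
have := @integral_transfer R _ _ _ _ P (normal_prob 0 sigma) (cst 1) X.
move=> /(_ _ _ _ _ f) <-//.
- by apply: eq_integral => w _; rewrite mul1e.
- move=> A mA; transitivity (P (X @^-1` A)); last exact: XP.
  under eq_integral do rewrite mul1e.
  rewrite integral_indic ?setIT//.
  by rewrite -[X in measurable X]setTI; exact: mX.
Qed.

(** Completing the square: the centred density times [expR (a * x)] is a multiple of the density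
    with mean [a * sigma ^+ 2], whose integral is 1. *)
Lemma normal_mgf (X : Omega -> R) (sigma a : R) : sigma != 0 ->
  measurable_fun setT X ->
  (forall A : set R, measurable A -> P (X @^-1` A) = normal_prob 0 sigma A) ->
  (\int[P]_w (expR (a * X w))%:E = (expR (a ^+ 2 * sigma ^+ 2 / 2))%:E)%E.
Proof.
move=> s0 mX XP.
rewrite (@integral_normal_distribution _ _ mX XP (fun x => (expR (a * x))%:E)); last 2 first.
- apply/measurable_EFinP; apply: measurableT_comp => //.
- by move=> x; rewrite lee_fin expR_ge0.
under eq_integral.
  move=> x _.
  have -> : ((normal_pdf 0 sigma x)%:E * (expR (a * x))%:E =
    (expR (a ^+ 2 * sigma ^+ 2 / 2))%:E * (normal_pdf (a * sigma ^+ 2) sigma x)%:E)%E.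
    rewrite -!EFinM; congr EFin; rewrite !normal_pdfE// /normal_fun.
    rewrite [RHS]mulrCA -[LHS]mulrA -!expRD; congr (_ * expR _).
    by field.
  over.
rewrite ge0_integralZl_EFin ?expR_ge0//.
- by rewrite integral_normal_pdf mule1.
- by move=> x _; rewrite lee_fin normal_pdf_ge0.
- by apply/measurable_EFinP; exact: measurable_normal_pdf.
Qed.

End NormalMgf.

Section IntegralSetT.
Local Open Scope ereal_scope.
Context {d : measure_display} {X : measurableType d} {R : realType}.
Variable mu : {measure set X -> \bar R}.

Lemma ge0_integralZT (k : R) (f : X -> \bar R) : (0 <= k)%R ->
  measurable_fun setT f -> (forall x, 0 <= f x) ->
  \int[mu]_x (k%:E * f x) = k%:E * \int[mu]_x f x.
Proof. by move=> k0 mf f0; rewrite ge0_integralZl_EFin. Qed.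

Lemma ge0_integralDT (f g : X -> \bar R) :
  measurable_fun setT f -> measurable_fun setT g ->
  (forall x, 0 <= f x) -> (forall x, 0 <= g x) ->
  \int[mu]_x (f x + g x) = \int[mu]_x f x + \int[mu]_x g x.
Proof. by move=> mf mg f0 g0; rewrite ge0_integralD. Qed.

Lemma ge0_le_integralT (f g : X -> \bar R) :
  measurable_fun setT f -> measurable_fun setT g ->
  (forall x, 0 <= f x) -> (forall x, f x <= g x) ->
  \int[mu]_x f x <= \int[mu]_x g x.
Proof. by move=> mf mg f0 fg; apply: ge0_le_integral. Qed.

End IntegralSetT.

(** * Step functions and their integrals *)

Section StepFunctions.
Context {R : realType}.
Implicit Types (h : seq (R * R * R)) (B : R -> R).

Definition rstep h B : R := \sum_(j <- h) j.2 * (B j.1.2 - B j.1.1).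

Definition nonneg_step h := forall j, j \in h -> 0 <= j.1.1 <= j.1.2.

(** The quantifier over all integrators [B] comes last, so one partition and one family of
    coefficients serve both the Brownian path and the integrator [t] to [(r <= t)], for which the
    integral is the value of the step function at [r]. *)
Lemma rstep_refine h : nonneg_step h ->
  exists tau n (C : nat -> R), [/\ nondecreasing_seq tau, 0 <= tau 0%N &
    forall B, rstep h B = \sum_(k < n) C k * (B (tau k.+1) - B (tau k))].
Proof.
move=> h0.
pose s := sort <=%R ([seq j.1.1 | j <- h] ++ [seq j.1.2 | j <- h]).
have ss : sorted <=%R s by apply: sort_sorted; exact: le_total.
(* Constant past the last endpoint, so that [tau] is a nondecreasing sequence indexed by all of
   [nat], as the independence of Brownian increments demands. *)
pose tau k := nth 0 s (minn k (size s).-1).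
have s1 j : j \in h -> j.1.1 \in s.
  by move=> jh; rewrite mem_sort mem_cat; apply/orP; left; exact: (map_f (fun j => j.1.1)).
have s2 j : j \in h -> j.1.2 \in s.
  by move=> jh; rewrite mem_sort mem_cat; apply/orP; right; exact: (map_f (fun j => j.1.2)).
have s0 x : x \in s -> 0 <= x.
  rewrite mem_sort mem_cat => /orP[] /mapP[j /h0/andP[a b] ->] //.
  exact: le_trans b.
have taui x : x \in s -> tau (index x s) = x.
  move=> xs; rewrite /tau (minn_idPl _) ?nth_index//.
  by move: xs; rewrite -index_mem; case: (size s).
(* The difference of the two comparisons is 1 when the [k]-th cell lies between the endpoints of
   [j], and 0 otherwise. *)
exists tau, (size s), (fun k => \sum_(j <- h) j.2 *
  ((k < index j.1.2 s)%N%:R - (k < index j.1.1 s)%N%:R)); split.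
- move=> a b ab; rewrite /tau.
  have [->|sn] := eqVneq (size s) 0%N; first by rewrite !minn0.
  have slt k : (minn k (size s).-1 < size s)%N.
    by rewrite gtn_min prednK ?leqnn ?orbT// lt0n.
  apply: sorted_leq_nth => //; first exact: le_trans.
  - exact: slt.
  - exact: slt.
  - by rewrite leq_min !geq_min ab leqnn /= orbT.
- rewrite /tau min0n; case: s s0 {ss s1 s2 taui tau} => [//|x s] s0 /=.
  by apply: s0; rewrite mem_head.
- move=> B.
  have tel x : x \in s -> B x = B (tau 0%N) +
      \sum_(k < size s) (k < index x s)%N%:R * (B (tau k.+1) - B (tau k)).
    move=> xs; rewrite -{1}(taui x xs).
    rewrite -[LHS](subrKC (B (tau 0%N))); congr (_ + _).
    rewrite -(telescope_sumr (fun k => B (tau k)))// big_mkord.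
    rewrite (big_ord_widen (size s) (fun k => B (tau k.+1) - B (tau k))) ?index_size//.
    rewrite big_mkcond; apply: eq_bigr => k _.
    by case: ifP; rewrite ?mul1r ?mul0r.
  rewrite /rstep (eq_big_seq (fun j => \sum_(k < size s) j.2 * ((k < index j.1.2 s)%N%:R - (k < index j.1.1 s)%N%:R) * (B (tau k.+1) - B (tau k)))).
    rewrite exchange_big; apply: eq_bigr => k _.
    by rewrite mulr_suml.
  move=> j jh; rewrite (tel _ (s1 _ jh)) (tel _ (s2 _ jh)).
  rewrite opprD addrACA subrr add0r -sumrB mulr_sumr; apply: eq_bigr => k _.
  by rewrite -mulrBl mulrA.
Qed.

Lemma indic_oc (a b r : R) : a <= b ->
  \1_(`]a, b]%classic) r = (r <= b)%R%:R - (r <= a)%R%:R :> R.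
Proof.
move=> ab; rewrite indicE mem_setE in_itv /= ltNge.
by case: (leP r a) => ra /=; rewrite ?(le_trans ra ab) ?subrr ?subr0.
Qed.

Lemma step_funE h r : nonneg_step h ->
  step_fun h r = rstep h (fun t => (r <= t)%R%:R).
Proof.
move=> h0; rewrite /step_fun /rstep; apply: eq_big_seq => j /h0/andP[_ ab].
by rewrite indic_oc.
Qed.

Lemma sqr_sum_disjoint n (x : nat -> R) :
  (forall i j, (i < j)%N -> x i * x j = 0) ->
  (\sum_(k < n) x k) ^+ 2 = \sum_(k < n) x k ^+ 2.
Proof.
move=> x0; elim: n => [|n IH]; first by rewrite !big_ord0 expr0n.
rewrite !big_ord_recr /= sqrrD IH mulr_suml.
by rewrite [X in _ + X *+ 2 + _]big1 ?mul0rn ?addr0// => i _; exact: x0.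
Qed.

Definition step_energy h : R := fine (\int[lebesgue_measure]_r ((step_fun h r) ^+ 2)%:E).

(** The integrand is a combination of indicators of disjoint cells, so its square has no cross
    terms. The right-hand side is the variance of the matching combination of independent
    increments: this is the Itô isometry for step functions. *)
Lemma step_refine h : nonneg_step h ->
  exists tau n (C : nat -> R), [/\ nondecreasing_seq tau, 0 <= tau 0%N,
    (\int[lebesgue_measure]_r ((step_fun h r) ^+ 2)%:E =
      (\sum_(k < n) C k ^+ 2 * (tau k.+1 - tau k))%:E)%E &
    forall B, rstep h B = \sum_(k < n) C k * (B (tau k.+1) - B (tau k))].
Proof.
move=> h0; have [tau [n [C [tau_nd tau0 hC]]]] := rstep_refine h0.
exists tau, n, C; split => //.
have tauS k : tau k <= tau k.+1 by exact: tau_nd.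
transitivity (\int[lebesgue_measure]_r
  \sum_(k < n) ((C k ^+ 2)%:E * (\1_(`]tau k, tau k.+1]%classic) r)%:E))%E.
  apply: eq_integral => r _; rewrite step_funE// hC.
  under eq_bigr do rewrite -indic_oc//.
  rewrite (@sqr_sum_disjoint n (fun k => C k * \1_(`]tau k, tau k.+1]%classic) r)).
    rewrite -sumEFin; apply: eq_bigr => k _; rewrite exprMn EFinM; congr (_ * _%:E)%E.
    by rewrite indicE; case: (_ \in _); rewrite ?expr1n ?expr0n.
  move=> i j ij; rewrite mulrACA !indicE !mem_setE !in_itv /=.
  case: (leP r (tau i.+1)) => ri; last by rewrite andbF mul0r mulr0.
  have -> : (tau j < r) = false.
    by apply/negbTE; rewrite -leNgt (le_trans ri)//; exact: tau_nd.
  by rewrite mulr0 mulr0.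
rewrite ge0_integral_sum//; last 2 first.
- by move=> k; apply: emeasurable_funM => //; apply/measurable_EFinP; exact: measurable_indic.
- by move=> k r _; rewrite mule_ge0// lee_fin ?sqr_ge0.
rewrite -sumEFin; apply: eq_bigr => k _.
rewrite ge0_integralZl_EFin ?sqr_ge0//; last first.
  by apply/measurable_EFinP; exact: measurable_indic.
rewrite integral_indic//= setIT lebesgue_measure_itv /= lte_fin EFinM.
case: ltP => // le_tau.
by have /eqP -> : tau k == tau k.+1; rewrite ?eq_le ?tauS// subrr.
Qed.

Lemma step_energyE h : nonneg_step h ->
  (\int[lebesgue_measure]_r ((step_fun h r) ^+ 2)%:E = (step_energy h)%:E)%E.
Proof. by move=> /step_refine[tau [n [C [_ _ H _]]]]; rewrite /step_energy H. Qed.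

End StepFunctions.

(** * Integrals of step functions against Brownian motion *)

Section Brownian.
Context {d : measure_display} {R : realType} {Omega : measurableType d}.
Variable P : probability Omega R.

Lemma sigma_process_measurable {J : Type} (D : set J) (X : J -> Omega -> R) :
  (forall j, D j -> measurable_fun setT (X j)) ->
  forall A, sigma_process D X A -> measurable A.
Proof.
move=> mX A; apply: smallest_sub; first exact: sigma_algebra_measurable.
by move=> _ [j Dj [B mB <-]]; apply: mX.
Qed.

Lemma sigma_process_preimage {J : Type} (D : set J) (X : J -> Omega -> R) j :
  D j -> forall (f : R -> R), measurable_fun setT f ->
  forall A : set R, measurable A -> sigma_process D X ((f \o X j) @^-1` A).
Proof.
move=> Dj f mf A mA; apply: sub_sigma_algebra; exists j => //.
exists (f @^-1` A); last by rewrite setTI comp_preimage.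
by rewrite -[X in measurable X]setTI; exact: mf.
Qed.

Lemma sigma_process_rstep (D : set R) (X : R -> Omega -> R) h (f : R -> R) :
  (forall j, j \in h -> D j.1.1 /\ D j.1.2) -> measurable_fun setT f ->
  forall A : set R, measurable A ->
    sigma_process D X ((fun w => f (rstep h (X^~ w))) @^-1` A).
Proof.
move=> hD mf A mA.
(* [Omega] is given the sigma-algebra generated by the process, for which the stability of
   measurable functions under sums and products yields membership in [sigma_process]. *)
pose T' := g_sigma_algebraType
  (\bigcup_(j in D) preimage_set_system setT (X j) measurable).
have mX t : D t -> measurable_fun (setT : set T') (X t).
  move=> Dt _ B mB; rewrite setTI.
  by have := @sigma_process_preimage _ D X t Dt id (@measurable_id _ _ _) _ mB.
have : measurable_fun (setT : set T') (fun w => f (rstep h (X^~ w))).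
  apply: measurableT_comp => //.
  elim: h hD => [|j h IH] hD.
    rewrite (_ : (fun w => _) = cst 0); first exact: measurable_cst.
    by apply/funext => w; rewrite /rstep big_nil.
  rewrite (_ : (fun w => _) = (fun w => j.2 * (X j.1.2 w - X j.1.1 w) + rstep h (X^~ w))); last first.
    by apply/funext => w; rewrite /rstep big_cons.
  apply: measurable_funD; last by apply: IH => k kh; apply: hD; rewrite in_cons kh orbT.
  have [Da Db] := hD j (mem_head _ _).
  by apply: measurable_funM => //; apply: measurable_funB; exact: mX.
by move=> /(_ measurableT _ mA); rewrite setTI.
Qed.

(** On the refined partition the integral is a combination of independent Gaussian increments: their
    exponential moments multiply and the variances add up to [v * step_energy h]. *)
Lemma brownian_rstep_mgf v (B : R -> Omega -> R) h :
  0 < v -> brownian P v B -> nonneg_step h ->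
  (\int[P]_w (expR (rstep h (B^~ w)))%:E = (expR (v * step_energy h / 2))%:E)%E.
Proof.
move=> v0 [mB B0 Bn Bi _] h0.
have [tau [n [C [tau_nd tau0 hI hC]]]] := step_refine h0.
have tau_ge0 k : 0 <= tau k by apply: (le_trans tau0); exact: tau_nd.
have mD k : measurable_fun setT (fun w => B (tau k.+1) w - B (tau k) w).
  by apply: measurable_funB; exact: mB.
have key k : (\int[P]_w (expR (C k * (B (tau k.+1) w - B (tau k) w)))%:E =
    (expR (v * (C k ^+ 2 * (tau k.+1 - tau k)) / 2))%:E)%E.
  (* A cell of length 0 contributes the factor 1; it is treated apart because the Gaussian formula
     asks for a nonzero deviation. *)
  have := tau_nd _ _ (leqnSn k); rewrite le_eqVlt => /predU1P[->|tk].
    rewrite subrr !mulr0 mul0r expR0.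
    under eq_integral do rewrite subrr mulr0 expR0.
    by rewrite integral_cst// mul1e; exact: probability_setT.
  have vt0 : 0 < v * (tau k.+1 - tau k) by rewrite mulr_gt0// subr_gt0.
  rewrite (@normal_mgf _ _ _ P _ (Num.sqrt (v * (tau k.+1 - tau k))))//.
  - rewrite sqr_sqrtr ?(ltW vt0)//; congr (expR _)%:E; ring.
  - by rewrite gt_eqF// sqrtr_gt0.
  - by move=> A mA; apply: Bn.
transitivity (\int[P]_w (\prod_(k <- iota 0 n) expR (C k * (B (tau k.+1) w - B (tau k) w)))%:E)%E.
  apply: eq_integral => w _; rewrite hC expR_sum; congr EFin.
  by rewrite -(big_mkord predT (fun k => expR (C k * (B (tau k.+1) w - B (tau k) w)))) /index_iota subn0.
rewrite (integral_prod_independent (Bi tau tau0 tau_nd)); last 5 first.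
- by move=> i A _; apply: sigma_process_measurable.
- exact: iota_uniq.
- move=> i _; split => //.
  apply: (@sigma_process_preimage unit setT (fun _ w => B (tau i.+1) w - B (tau i) w) tt I (fun x => expR (C i * x))).
  by apply: measurableT_comp => //; exact: measurable_funM.
- by move=> i w; exact: expR_ge0.
- by move=> i _; rewrite key ltry.
under eq_bigr do rewrite key.
rewrite prodEFin -expR_sum; congr (expR _)%:E.
rewrite /step_energy hI /= mulr_sumr mulr_suml.
by rewrite -(big_mkord predT (fun k => v * (C k ^+ 2 * (tau k.+1 - tau k)) / 2)) /index_iota subn0.
Qed.

End Brownian.

(** * Real and imaginary parts *)

Section ComplexParts.
Context {R : realType}.
Implicit Types (z : R[i]).

Lemma cmod_sqr z : cmod z ^+ 2 = complex.Re z ^+ 2 + complex.Im z ^+ 2.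
Proof. by case: z => a b; rewrite /cmod /= sqr_sqrtr// addr_ge0// sqr_ge0. Qed.

Lemma cmod_ge0 z : 0 <= cmod z.
Proof. by case: z => a b; rewrite /cmod /= sqrtr_ge0. Qed.

Lemma ReD z1 z2 : complex.Re (z1 + z2) = complex.Re z1 + complex.Re z2.
Proof. by case: z1 => a b; case: z2 => a' b'. Qed.

Lemma ImD z1 z2 : complex.Im (z1 + z2) = complex.Im z1 + complex.Im z2.
Proof. by case: z1 => a b; case: z2 => a' b'. Qed.

Lemma ReN z : complex.Re (- z) = - complex.Re z.
Proof. by case: z. Qed.

Lemma ImN z : complex.Im (- z) = - complex.Im z.
Proof. by case: z. Qed.

Lemma ReB z1 z2 : complex.Re (z1 - z2) = complex.Re z1 - complex.Re z2.
Proof. by rewrite ReD ReN. Qed.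

Lemma ImB z1 z2 : complex.Im (z1 - z2) = complex.Im z1 - complex.Im z2.
Proof. by rewrite ImD ImN. Qed.

Lemma ReM z1 z2 : complex.Re (z1 * z2) =
  complex.Re z1 * complex.Re z2 - complex.Im z1 * complex.Im z2.
Proof. by case: z1 => a b; case: z2. Qed.

Lemma ImM z1 z2 : complex.Im (z1 * z2) =
  complex.Re z1 * complex.Im z2 + complex.Im z1 * complex.Re z2.
Proof. by case: z1 => a b; case: z2. Qed.

Lemma Re_sum (I : Type) (s : seq I) (Q : pred I) (F : I -> R[i]) :
  complex.Re (\sum_(i <- s | Q i) F i) = \sum_(i <- s | Q i) complex.Re (F i).
Proof.
elim: s => [|i s IH]; first by rewrite !big_nil.
by rewrite !big_cons; case: ifP => // _; rewrite ReD IH.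
Qed.

Lemma Im_sum (I : Type) (s : seq I) (Q : pred I) (F : I -> R[i]) :
  complex.Im (\sum_(i <- s | Q i) F i) = \sum_(i <- s | Q i) complex.Im (F i).
Proof.
elim: s => [|i s IH]; first by rewrite !big_nil.
by rewrite !big_cons; case: ifP => // _; rewrite ImD IH.
Qed.

Lemma eq_complexP z1 z2 : complex.Re z1 = complex.Re z2 ->
  complex.Im z1 = complex.Im z2 -> z1 = z2.
Proof. by case: z1 => a b; case: z2 => a' b' /= -> ->. Qed.

Lemma component_conjc b z : component b (conjc z) = (if b then 1 else -1) * component b z.
Proof. by case: z => x y; case: b; rewrite /= ?mul1r ?mulN1r. Qed.

Lemma norm_ReM_le z1 z2 : `|complex.Re (z1 * z2)| <= cmod z1 * cmod z2.
Proof.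
rewrite -ler_sqr ?nnegrE ?mulr_ge0 ?cmod_ge0//.
rewrite real_normK ?num_real// exprMn !cmod_sqr ReM.
rewrite -subr_ge0.
have -> : (complex.Re z1 ^+ 2 + complex.Im z1 ^+ 2) * (complex.Re z2 ^+ 2 + complex.Im z2 ^+ 2) -
  (complex.Re z1 * complex.Re z2 - complex.Im z1 * complex.Im z2) ^+ 2 =
  (complex.Re z1 * complex.Im z2 + complex.Im z1 * complex.Re z2) ^+ 2 by ring.
exact: sqr_ge0.
Qed.

Lemma component_step_integral (d : measure_display) (Omega : measurableType d) h (B : R -> Omega -> R[i]) b w :
  component b (step_integral h B w) = rstep h (fun t => component b (B t w)).
Proof.
rewrite /step_integral /rstep; case: b => /=.
  by rewrite Re_sum; apply: eq_bigr => j _; rewrite ReM /= mul0r subr0 ReB.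
by rewrite Im_sum; apply: eq_bigr => j _; rewrite ImM /= mul0r addr0 ImB.
Qed.

End ComplexParts.

Section StepAlgebra.
Context {R : realType}.
Implicit Types (h : seq (R * R * R)) (B : R -> R).

Definition scale_step (a : R) h := [seq (j.1, a * j.2) | j <- h].

Lemma rstep_scale a h B : rstep (scale_step a h) B = a * rstep h B.
Proof.
by rewrite /rstep big_map mulr_sumr; apply: eq_bigr => j _; rewrite /= mulrA.
Qed.

Lemma step_fun_scale a h r : step_fun (scale_step a h) r = a * step_fun h r.
Proof.
by rewrite /step_fun big_map mulr_sumr; apply: eq_bigr => j _; rewrite /= mulrA.
Qed.

Lemma nonneg_step_scale a h : nonneg_step h -> nonneg_step (scale_step a h).
Proof. by move=> h0 _ /mapP[j jh ->]; rewrite /=; exact: h0. Qed.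

Lemma rstep_cat h h' B : rstep (h ++ h') B = rstep h B + rstep h' B.
Proof. by rewrite /rstep big_cat. Qed.

Lemma step_fun_cat h h' r : step_fun (h ++ h') r = step_fun h r + step_fun h' r.
Proof. by rewrite /step_fun big_cat. Qed.

Lemma nonneg_step_cat h h' : nonneg_step h -> nonneg_step h' -> nonneg_step (h ++ h').
Proof. by move=> h0 h0' j; rewrite mem_cat => /orP[/h0|/h0']. Qed.

Lemma measurable_step_fun h : measurable_fun setT (step_fun h).
Proof.
elim: h => [|j h IH].
  rewrite (_ : step_fun _ = cst 0); first exact: measurable_cst.
  by apply/funext => r; rewrite /step_fun big_nil.
rewrite (_ : step_fun _ = (fun r => j.2 * \1_(`]j.1.1, j.1.2]%classic) r + step_fun h r)); last first.
  by apply/funext => r; rewrite /step_fun big_cons.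
by apply: measurable_funD => //; apply: measurable_funM => //; exact: measurable_indic.
Qed.

Lemma step_energy_ge0 h : 0 <= step_energy h.
Proof. by apply: fine_ge0; apply: integral_ge0 => r _; rewrite lee_fin sqr_ge0. Qed.

Lemma step_energy_scale a h : nonneg_step h ->
  step_energy (scale_step a h) = a ^+ 2 * step_energy h.
Proof.
move=> h0; apply/EFin_inj; rewrite EFinM -!step_energyE//; last exact: nonneg_step_scale.
rewrite -ge0_integralZl_EFin ?sqr_ge0//.
- by apply: eq_integral => r _; rewrite step_fun_scale exprMn EFinM.
- by move=> r _; rewrite lee_fin sqr_ge0.
- by apply/measurable_EFinP/measurable_funX; exact: measurable_step_fun.
Qed.

End StepAlgebra.

(** * Powers against exponentials, and limits inferior *)

Lemma exprn_le_expR (R : realType) (x : R) n : 0 <= x -> x ^+ n <= n`!%:R * expR x.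
Proof.
move=> x0; case: n => [|n]; first by rewrite expr0 mul1r -expR0 ler_expR.
rewrite mulrC -ler_pdivrMr ?ltr0n ?fact_gt0//.
by apply: le_trans (expR_ge1Dxn n x0); rewrite lerDr.
Qed.

(** An even power sees only [|x|], and the exponential of [|x|] is one of the two terms. This
    converts exponential moments at both signs into even moments. *)
Lemma even_exprn_le_expR (R : realType) (x : R) m :
  x ^+ (2 * m) <= (2 * m)`!%:R * (expR x + expR (- x)).
Proof.
have -> : x ^+ (2 * m) = `|x| ^+ (2 * m).
  by rewrite !exprM real_normK// num_real.
apply: le_trans (exprn_le_expR _ (normr_ge0 x)) _.
apply: ler_wpM2l; first exact: ler0n.
by case: (ger0P x) => _; rewrite ?lerDl ?lerDr expR_ge0.
Qed.

Lemma near_all_seq (I : eqType) (s : seq I) (Q : I -> nat -> Prop) :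
  (forall i, i \in s -> \forall n \near \oo, Q i n) ->
  \forall n \near \oo, forall i, i \in s -> Q i n.
Proof.
elim: s => [|i s IH] H; first by apply: nearW => n i; rewrite in_nil.
have : \forall n \near \oo, forall j, j \in s -> Q j n.
  by apply: IH => j js; apply: H; rewrite in_cons js orbT.
have := H i (mem_head _ _).
apply: filterS2 => n Qi Qs j; rewrite in_cons => /predU1P[->//|]; exact: Qs.
Qed.

Lemma cvge0_sum (R : realType) (I : Type) (s : seq I) (u : I -> nat -> \bar R) :
  (forall i n, (0 <= u i n)%E) -> (forall i, u i n @[n --> \oo] --> 0%E) ->
  (\sum_(i <- s) u i n)%E @[n --> \oo] --> 0%E.
Proof.
move=> u0 ucvg; elim: s => [|i s IH].
  by under eq_fun do rewrite big_nil; exact: cvg_cst.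
under eq_fun do rewrite big_cons.
have H := cvgeD (isT : (0 +? 0)%E) (ucvg i) IH; rewrite adde0 in H; exact: H.
Qed.

Lemma limn_einf_le_near (R : realType) (u : nat -> \bar R) (K : \bar R) :
  (\forall n \near \oo, (u n <= K)%E) -> (limn_einf u <= K)%E.
Proof.
case=> N _ NP; rewrite limn_einf_lim; apply: lime_le; first exact: is_cvg_einfs.
apply: nearW => n; apply: (@le_trans _ _ (u (maxn n N))).
  by apply: ereal_inf_lbound; exists (maxn n N) => //=; rewrite leq_maxl.
by apply: NP; rewrite /= leq_maxr.
Qed.

Lemma limn_einf_ge0 (R : realType) (u : nat -> \bar R) :
  (forall n, (0 <= u n)%E) -> (0 <= limn_einf u)%E.
Proof.
move=> u0; rewrite limn_einf_lim; apply: lime_ge; first exact: is_cvg_einfs.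
by apply: nearW => n; apply: le_ereal_inf_tmp => _ [k _ <-].
Qed.

Lemma measurable_fun_limn_einf (d : measure_display) (T : measurableType d)
    (R : realType) (f : nat -> T -> \bar R) :
  (forall n, measurable_fun setT (f n)) ->
  measurable_fun setT (fun x => limn_einf (f ^~ x)).
Proof.
move=> mf; rewrite (_ : (fun _ => _) = (fun x => - limn_esup (fun n => - f n x))%E).
  apply: measurableT_comp => //; apply: measurable_fun_limn_esup => n.
  exact: measurableT_comp.
apply/funext => x; rewrite -(limn_einfN (fun n => - f n x))%E.
by congr limn_einf; apply/funext => n /=; rewrite oppeK.
Qed.

(** * Moments of Wiener integrals over finitely many modes *)

Section CylindricalWiener.
Context {d : measure_display} {R : realType} {Omega : measurableType d}.
Variable P : probability Omega R.
Variable beta : int -> int -> R -> Omega -> R[i].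
Hypothesis Wbeta : cylindrical_wiener P beta.

Let comp (i : int * int * bool) (t : R) (w : Omega) : R :=
  component i.2 (beta i.1.1 i.1.2 t w).

Lemma Im_beta00 t w : 0 <= t -> complex.Im (beta 0 0 t w) = 0.
Proof.
move=> t0; have [H _ _ _] := Wbeta; have := H 0 0 t w t0.
rewrite oppr0; case: (beta 0 0 t w) => a b /= [] /eqP.
by rewrite -addr_eq0 -mulr2n mulrn_eq0 /= => /eqP.
Qed.

(** The imaginary part at the origin vanishes by the conjugation constraint; the other components
    have variance rate 1 or 1/2. Keeping only [v <= 1] gives one exponential bound for all of
    them. *)
Lemma comp_cases i : (forall t w, 0 <= t -> comp i t w = 0) \/
  exists2 v, 0 < v <= 1 & brownian P v (comp i).
Proof.
case: i => [[k l] b]; have [_ H0 H _] := Wbeta.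
have [[-> ->]|kl] := eqVneq (k, l) (0, 0); last first.
  right; exists 2^-1; last exact: H.
  by rewrite invr_gt0 ltr0n invf_le1 ?ler1n.
case: b; last by left => t w t0; rewrite /comp /= Im_beta00.
by right; exists 1; rewrite ?ltr01 ?lexx.
Qed.

Lemma measurable_comp_beta i t : 0 <= t -> measurable_fun setT (comp i t).
Proof.
move=> t0; case: (comp_cases i) => [H|[v _ [H _ _ _ _]]]; last exact: H.
rewrite (_ : comp i t = cst 0); first exact: measurable_cst.
by apply/funext => w; exact: H.
Qed.

Lemma rstep_eq0 h (B : R -> R) : nonneg_step h -> (forall t, 0 <= t -> B t = 0) ->
  rstep h B = 0.
Proof.
move=> h0 B0; rewrite /rstep big_seq big1// => j /h0/andP[a b].
by rewrite !B0 ?subrr ?mulr0//; exact: le_trans b.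
Qed.

Lemma comp_rstep_mgf i h : nonneg_step h ->
  (\int[P]_w (expR (rstep h (fun t => comp i t w)))%:E <= (expR (step_energy h / 2))%:E)%E.
Proof.
move=> h0; case: (comp_cases i) => [H|[v /andP[v0 v1] Bv]].
  under eq_integral => w _ do rewrite (rstep_eq0 h0 (H^~ w)) expR0.
  rewrite integral_cst// mul1e; apply: (@le_trans _ _ 1%E); first exact: probability_le1.
  by rewrite lee_fin -expR0 ler_expR divr_ge0// step_energy_ge0.
rewrite (brownian_rstep_mgf v0 Bv)// lee_fin ler_expR ler_pM2r ?invr_gt0//.
by rewrite ler_piMl// step_energy_ge0.
Qed.

Lemma comp_sum_rstep_mgf (s : seq (int * int * bool)) (h : int * int * bool -> seq (R * R * R)) :
  uniq s -> (forall i, i \in s -> half_lattice i.1.1 i.1.2) ->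
  (forall i, nonneg_step (h i)) ->
  (\int[P]_w (expR (\sum_(i <- s) rstep (h i) (fun t => comp i t w)))%:E <=
   (expR (\sum_(i <- s) step_energy (h i) / 2))%:E)%E.
Proof.
move=> us sH h0; have [_ _ _ Hi] := Wbeta.
under eq_integral do rewrite expR_sum.
rewrite (@integral_prod_independent _ _ _ P _ _ _ s (fun i w => expR (rstep (h i) (fun t => comp i t w))) Hi)//.
- rewrite expR_sum -prodEFin; elim: s {us sH} => [|i s IH]; first by rewrite !big_nil.
  rewrite !big_cons; apply: lee_pmul => //.
  + by apply: integral_ge0 => w _; rewrite lee_fin expR_ge0.
  + by apply: prode_ge0 => j _; apply: integral_ge0 => w _; rewrite lee_fin expR_ge0.
  + exact: comp_rstep_mgf.
- move=> i A Di; apply: sigma_process_measurable => t t0.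
  exact: (measurable_comp_beta i t0).
- move=> i /sH Di; split=> //.
  apply: (@sigma_process_rstep _ _ _ [set t | 0 <= t] (comp i) (h i) expR) => //.
  by move=> j /h0/andP[a b]; split => //=; exact: le_trans b.
- by move=> i _; apply: le_lt_trans (comp_rstep_mgf _ (h0 i)) _; rewrite ltry.
Qed.

Let X (F : seq (int * int)) (c : int * int -> R[i]) (h : int * int -> seq (R * R * R)) w :=
  complex.Re (\sum_(i <- F) c i * step_integral (h i) (beta i.1 i.2) w).

(** Over the half lattice all real and imaginary parts are independent. The two real coefficients of
    a mode, [Re c] and [- Im c], have squares adding up to the squared modulus. *)
Lemma step_field_mgf_half (F : seq (int * int)) c' (h : int * int -> seq (R * R * R)) (y : R) :
  uniq F -> (forall i, i \in F -> half_lattice i.1 i.2) -> (forall i, nonneg_step (h i)) ->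
  (\int[P]_w (expR (y * X F c' h w))%:E <=
   (expR (y ^+ 2 * (\sum_(i <- F) cmod (c' i) ^+ 2 * step_energy (h i)) / 2))%:E)%E.
Proof.
move=> uF FH h0.
pose a (i : int * int * bool) := y * (if i.2 then complex.Re (c' i.1) else - complex.Im (c' i.1)).
pose s := [seq (i, b) | i <- F, b <- [:: true; false]].
have := @comp_sum_rstep_mgf s (fun i => scale_step (a i) (h i.1)) _ _ _.
rewrite (_ : (fun w => _) = (fun w => (expR (y * X F c' h w))%:E)); last first.
  apply/funext => w; congr (expR _)%:E.
  rewrite big_allpairs_dep /X Re_sum mulr_sumr; apply: eq_bigr => i _.
  rewrite big_cons big_seq1 !rstep_scale /a /= ReM.
  by rewrite -(component_step_integral _ _ true) -(component_step_integral _ _ false) /=; ring.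
move=> H; apply: le_trans (H _ _ _) _.
- apply: allpairs_uniq => //.
  by move=> [i b] [j b'] _ _ [-> ->].
- by move=> i /allpairsP[[j b] [jF _ ->]]; exact: FH.
- by move=> i; exact: nonneg_step_scale.
rewrite lee_fin ler_expR big_allpairs_dep mulr_sumr mulr_suml.
rewrite le_eqVlt; apply/orP; left; apply/eqP; apply: eq_bigr => i _.
rewrite big_cons big_seq1 !step_energy_scale// /a /= cmod_sqr.
by field.
Qed.

(** The two halves of the lattice carry dependent noises. The inequality
    [p * q <= (p ^+ 2 + q ^+ 2) / 2] between their exponentials separates them and doubles [y], so
    that [y ^+ 2 / 2] becomes [2 * y ^+ 2]. *)
Lemma step_field_mgf (F : seq (int * int)) c' (h : int * int -> seq (R * R * R)) (y : R) :
  uniq F -> (forall i, nonneg_step (h i)) ->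
  (\int[P]_w (expR (y * X F c' h w))%:E <=
   (expR (2 * y ^+ 2 * \sum_(i <- F) cmod (c' i) ^+ 2 * step_energy (h i)))%:E)%E.
Proof.
move=> uF h0.
pose F1 := [seq i <- F | half_lattice i.1 i.2].
pose ng (i : int * int) := (- i.1, - i.2).
pose F2 := [seq ng i | i <- F & ~~ half_lattice i.1 i.2].
(* Reflection moves the remaining indices into the half lattice, where the noise is the conjugate
   one; conjugating the coefficient as well leaves the real part of the product unchanged. *)
pose c2 i := conjc (c' (ng i)).
have ngK i : ng (ng i) = i by case: i => k l; rewrite /ng /= !opprK.
have XE w : X F c' h w = X F1 c' h w + X F2 c2 (h \o ng) w.
  rewrite /X /F1 /F2 !Re_sum big_map !big_filter (bigID (fun i => half_lattice i.1 i.2)) /=.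
  congr (_ + _); apply: eq_bigr => i _.
  rewrite /c2 ngK !ReM.
  have [Hc _ _ _] := Wbeta.
  rewrite -[complex.Re (step_integral _ _ _)]/(component true _) -[complex.Im (step_integral _ _ _)]/(component false _).
  rewrite -[complex.Re (step_integral _ (beta (- _) _) _)]/(component true _) -[complex.Im (step_integral _ (beta (- _) _) _)]/(component false _).
  rewrite !component_step_integral.
  have Hr b : rstep (h i) (fun t => component b (beta (- i.1) (- i.2) t w)) =
     (if b then 1 else -1) * rstep (h i) (fun t => component b (beta i.1 i.2 t w)).
    rewrite /rstep mulr_sumr; apply: eq_big_seq => j /h0/andP[j0 j1].
    rewrite !Hc ?(le_trans j0 j1)// !component_conjc; ring.
  rewrite (Hr true) (Hr false) mul1r mulN1r.
  by case: (c' i) => x z /=; rewrite mulrNN.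
pose V (G : seq (int * int)) := \sum_(i <- G) cmod (c' i) ^+ 2 * step_energy (h i).
have V0 i : 0 <= cmod (c' i) ^+ 2 * step_energy (h i).
  by rewrite mulr_ge0 ?sqr_ge0 ?step_energy_ge0.
have V1 : V F1 <= V F.
  rewrite /V big_filter [leRHS](bigID (fun i => half_lattice i.1 i.2)) /= lerDl.
  by apply: sumr_ge0 => i _.
have V2 : \sum_(i <- F2) cmod (c2 i) ^+ 2 * step_energy ((h \o ng) i) <= V F.
  rewrite /V big_map big_filter [leRHS](bigID (fun i => half_lattice i.1 i.2)) /=.
  rewrite [X in X <= _](_ : _ = \sum_(i <- F | ~~ half_lattice i.1 i.2) cmod (c' i) ^+ 2 * step_energy (h i)).
    by rewrite lerDr; apply: sumr_ge0 => i _.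
  apply: eq_bigr => i _; rewrite ngK /c2 ngK !cmod_sqr; case: (c' i) => a b /=.
  by rewrite sqrrN.
have E1 := @step_field_mgf_half F1 c' h (2 * y) _ _ h0.
have E2 := @step_field_mgf_half F2 c2 (h \o ng) (2 * y) _ _ (fun i => h0 _).
have mX G c0 h1 y0 : (forall i, nonneg_step (h1 i)) -> measurable_fun setT (fun w => expR (y0 * X G c0 h1 w)).
  move=> h10; apply: measurableT_comp => //; apply: measurable_funM => //.
  rewrite (_ : X G c0 h1 = (fun w => \sum_(i <- G) (complex.Re (c0 i) * rstep (h1 i) (fun t => comp (i, true) t w) - complex.Im (c0 i) * rstep (h1 i) (fun t => comp (i, false) t w)))); last first.
    apply/funext => w; rewrite /X Re_sum; apply: eq_bigr => i _; rewrite ReM.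
    by rewrite -(component_step_integral _ _ true) -(component_step_integral _ _ false).
  have mr i : measurable_fun setT (fun w => rstep (h1 i.1) (fun t => comp i t w)).
    move=> _ A mA; rewrite setTI.
    apply: (@sigma_process_measurable _ _ _ R [set t | 0 <= t] (comp i)).
      by move=> t t0; exact: measurable_comp_beta.
    apply: (@sigma_process_rstep _ _ _ _ _ _ id) => // j /h10/andP[a b]; split => //=.
    exact: le_trans b.
  apply: measurable_sum => i; apply: measurable_funB; apply: measurable_funM => //.
    exact: (mr (i, true)).
  exact: (mr (i, false)).
have mX1 := mX F1 c' h (2 * y) h0.
have mX2 := mX F2 c2 (h \o ng) (2 * y) (fun i => h0 (ng i)).
have mX0 := mX F c' h y h0.
apply: (@le_trans _ _ (\int[P]_w (2^-1%:E * ((expR (2 * y * X F1 c' h w))%:E + (expR (2 * y * X F2 c2 (h \o ng) w))%:E)))%E).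
  apply: ge0_le_integral => //=.
  - exact/measurable_EFinP.
  - by apply: emeasurable_funM => //; apply: emeasurable_funD; exact/measurable_EFinP.
  - move=> w _; rewrite -EFinD -EFinM lee_fin XE mulrDr expRD.
    have sqE x : expR (2 * y * x) = expR (y * x) ^+ 2.
      by rewrite -mulrA mulrC expRM_natr.
    rewrite !sqE; set p := expR (y * X F1 c' h w); set q := expR (y * _).
    have := sqr_ge0 (p - q); lra.
rewrite ge0_integralZl_EFin ?invr_ge0//; last 2 first.
  - by move=> w _; rewrite adde_ge0// lee_fin expR_ge0.
  - by apply: emeasurable_funD; exact/measurable_EFinP.
rewrite ge0_integralD//; last 2 first.
  - exact/measurable_EFinP.
  - exact/measurable_EFinP.
rewrite -[leRHS]mul1e (_ : 1%E = (2^-1%:E * (1 + 1)%:E)%E); last first.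
  by rewrite -EFinM; congr EFin; field.
rewrite -muleA; apply: lee_wpmul2l; first by rewrite lee_fin invr_ge0.
rewrite EFinD muleDl// !mul1e; apply: leeD.
  apply: (le_trans (E1 _ _)).
  - exact: filter_uniq.
  - by move=> i; rewrite mem_filter => /andP[].
  rewrite lee_fin ler_expR.
  rewrite [leLHS](_ : _ = 2 * y ^+ 2 * V F1); last by rewrite /V; field.
  by apply: ler_wpM2l V1; rewrite mulr_ge0// sqr_ge0.
apply: (le_trans (E2 _ _)).
- by rewrite map_inj_uniq ?filter_uniq//; exact: can_inj ngK.
- move=> i /mapP[[k l]]; rewrite mem_filter /half_lattice /= => /andP[+ _] ->.
  rewrite /ng /=; lia.
rewrite lee_fin ler_expR.
set V' := \sum_(i <- F2) _ in V2 *.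
rewrite [leLHS](_ : _ = 2 * y ^+ 2 * V'); last by field.
by apply: ler_wpM2l V2; rewrite mulr_ge0// sqr_ge0.
Qed.

Lemma measurable_step_field (i : int * int) h : nonneg_step h ->
  cmeasurable (fun w => step_integral h (beta i.1 i.2) w).
Proof.
move=> h0.
have mr (j : int * int * bool) : measurable_fun setT (fun w => rstep h (fun t => comp j t w)).
  move=> _ A mA; rewrite setTI.
  apply: (@sigma_process_measurable _ _ _ R [set t | 0 <= t] (comp j)).
    by move=> t t0; exact: measurable_comp_beta.
  apply: (@sigma_process_rstep _ _ _ _ _ _ id) => // k /h0/andP[a b]; split => //=.
  exact: le_trans b.
split.
  rewrite (_ : (fun w => _) = (fun w => rstep h (fun t => comp (i, true) t w))); first exact: mr.
  by apply/funext => w; rewrite -(component_step_integral _ _ true).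
rewrite (_ : (fun w => _) = (fun w => rstep h (fun t => comp (i, false) t w))); first exact: mr.
by apply/funext => w; rewrite -(component_step_integral _ _ false).
Qed.

(** [2 * expR 2] bounds the sum of the two exponential moments at the critical scale, and the
    factorial is the price of comparing a power with an exponential. *)
Definition moment_cst m : R := 2 * expR 2 * (2 * m)`!%:R.

Lemma step_field_moment m (F : seq (int * int)) c' (h : int * int -> seq (R * R * R)) V :
  uniq F -> (forall i, nonneg_step (h i)) -> 0 < V ->
  \sum_(i <- F) cmod (c' i) ^+ 2 * step_energy (h i) <= V ->
  (\int[P]_w ((X F c' h w) ^+ (2 * m))%:E <= (moment_cst m * V ^+ m)%:E)%E.
Proof.
move=> uF h0 V0 leV.
have mX : measurable_fun setT (X F c' h).
  rewrite (_ : X F c' h = (fun w => \sum_(i <- F)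
     (complex.Re (c' i) * complex.Re (step_integral (h i) (beta i.1 i.2) w) -
      complex.Im (c' i) * complex.Im (step_integral (h i) (beta i.1 i.2) w)))); last first.
    by apply/funext => w; rewrite /X Re_sum; apply: eq_bigr => i _; rewrite ReM.
  apply: measurable_sum => i; have [m1 m2] := measurable_step_field i (h0 i).
  by apply: measurable_funB; apply: measurable_funM.
(* At this scale the exponent [2 * y ^+ 2 * V] of the exponential bound is the constant 2. *)
pose y := (Num.sqrt V)^-1.
have sV0 : 0 < Num.sqrt V by rewrite sqrtr_gt0.
have y2 : y ^+ 2 = V^-1 by rewrite /y exprVn sqr_sqrtr// ltW.
have mE z : measurable_fun setT (fun w => (expR (z * X F c' h w))%:E).
  by apply/measurable_EFinP/measurableT_comp => //; exact: measurable_funM.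
have Ebnd z : z ^+ 2 = V^-1 -> (\int[P]_w (expR (z * X F c' h w))%:E <= (expR 2)%:E)%E.
  move=> z2; apply: le_trans (step_field_mgf _ _ uF h0) _.
  rewrite z2 lee_fin ler_expR -mulrA ler_piMr//.
  by rewrite mulrC ler_pdivrMr// mul1r.
apply: (@le_trans _ _ (\int[P]_w ((V ^+ m * (2 * m)`!%:R)%:E *
   ((expR (y * X F c' h w))%:E + (expR (- y * X F c' h w))%:E)))%E).
  apply: ge0_le_integral => //=.
  - by move=> w _; rewrite lee_fin exprM exprn_ge0// sqr_ge0.
  - by apply/measurable_EFinP/measurable_funX.
  - by apply: emeasurable_funM => //; apply: emeasurable_funD; exact: mE.
  - move=> w _; rewrite -EFinD -EFinM lee_fin mulNr -mulrA.
    apply: le_trans (_ : V ^+ m * (y * X F c' h w) ^+ (2 * m) <= _); last first.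
      by apply: ler_wpM2l; [exact/exprn_ge0/ltW|exact: even_exprn_le_expR].
    rewrite exprMn [y ^+ _]exprM y2 mulrA -exprMn divff ?gt_eqF// expr1n mul1r//.
have cst0 : 0 <= V ^+ m * (2 * m)`!%:R by rewrite mulr_ge0// exprn_ge0// ltW.
rewrite ge0_integralZl_EFin//; last 2 first.
  - by move=> w _; rewrite adde_ge0// lee_fin expR_ge0.
  - by apply: emeasurable_funD; exact: mE.
rewrite ge0_integralD//.
have -> : ((moment_cst m * V ^+ m)%:E = (V ^+ m * (2 * m)`!%:R)%:E * ((expR 2)%:E + (expR 2)%:E))%E.
  by rewrite -EFinD -EFinM; congr EFin; rewrite /moment_cst; ring.
apply: lee_wpmul2l; first by rewrite lee_fin.
by apply: leeD; apply: Ebnd; rewrite ?sqrrN.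
Qed.

(* [f] is the integrand of the Wiener integral [J] against [beta k l], extended
   by zero to the whole line. *)
Definition wiener_image (i : int * int) (f : R -> R) (J : Omega -> R[i]) : Prop :=
  cmeasurable J /\
  exists h : nat -> seq (R * R * R),
    [/\ forall n, nonneg_step (h n),
        (\int[lebesgue_measure]_r ((step_fun (h n) r - f r) ^+ 2)%:E @[n --> \oo] --> 0)%E
      & (\int[P]_w (cmod (step_integral (h n) (beta i.1 i.2) w - J w) ^+ 2)%:E
          @[n --> \oo] --> 0)%E].

(** Mean-square convergence gives an almost everywhere convergent subsequence of step integrals, and
    Fatou's lemma carries their moment bound to the limit. The approximating steps have energy at
    most [2 * v i] plus a small error, which is why the hypothesis has a factor 2 and a strict
    inequality. *)
Lemma wiener_image_moment m (F : seq (int * int)) c' (f : int * int -> R -> R)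
    (v : int * int -> R) (J : int * int -> Omega -> R[i]) V :
  uniq F -> (forall i, i \in F -> wiener_image i (f i) (J i)) ->
  (forall i, i \in F -> measurable_fun setT (f i)) ->
  (forall i, i \in F -> (\int[lebesgue_measure]_r (f i r ^+ 2)%:E <= (v i)%:E)%E) ->
  2 * \sum_(i <- F) cmod (c' i) ^+ 2 * v i < V ->
  (\int[P]_w ((complex.Re (\sum_(i <- F) c' i * J i w)) ^+ (2 * m))%:E <=
    (moment_cst m * V ^+ m)%:E)%E.
Proof.
move=> uF FJ mf fv ltV.
(* Outside [F] the empty step is used, so that every [h i n] satisfies [nonneg_step]. *)
pose h i n : seq (R * R * R) :=
  match pselect (i \in F) with left iF => projT1 (cid (FJ i iF).2) n | right _ => [::] end.
have hP i : i \in F -> [/\ forall n, nonneg_step (h i n),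
        (\int[lebesgue_measure]_r ((step_fun (h i n) r - f i r) ^+ 2)%:E @[n --> \oo] --> 0)%E
      & (\int[P]_w (cmod (step_integral (h i n) (beta i.1 i.2) w - J i w) ^+ 2)%:E
          @[n --> \oo] --> 0)%E].
  move=> iF; rewrite /h; case: pselect => // iF'.
  by case: cid => h' /= [].
have h0 i n : nonneg_step (h i n).
  by have [/hP[]|iF] := pselect (i \in F); rewrite // /h; case: pselect.
pose S i n w := step_integral (h i n) (beta i.1 i.2) w.
pose err i n := (\int[lebesgue_measure]_r ((step_fun (h i n) r - f i r) ^+ 2)%:E)%E.
pose g n w := \sum_(i <- F) cmod (S i n w - J i w) ^+ 2.
have mRS i n : measurable_fun setT (fun w => complex.Re (S i n w)).
  by have [] := measurable_step_field i (h0 i n).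
have mIS i n : measurable_fun setT (fun w => complex.Im (S i n w)).
  by have [] := measurable_step_field i (h0 i n).
have mRJ i : i \in F -> measurable_fun setT (fun w => complex.Re (J i w)) by move=> /FJ[[]].
have mIJ i : i \in F -> measurable_fun setT (fun w => complex.Im (J i w)) by move=> /FJ[[]].
have mdiff i n : i \in F -> measurable_fun setT (fun w => cmod (S i n w - J i w) ^+ 2).
  move=> iF; rewrite (_ : (fun w => _) = (fun w =>
    (complex.Re (S i n w) - complex.Re (J i w)) ^+ 2 +
    (complex.Im (S i n w) - complex.Im (J i w)) ^+ 2)); last first.
    by apply/funext => w; rewrite cmod_sqr ReB ImB.
  by apply: measurable_funD; apply: measurable_funX; apply: measurable_funB => //;
    [exact: mRJ|exact: mIJ].
have g0 n w : 0 <= g n w by apply: sumr_ge0 => i _; rewrite sqr_ge0.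
have gE n : g n = (fun w => \sum_(i <- F) (if i \in F then cmod (S i n w - J i w) ^+ 2 else 0)).
  apply/funext => w; rewrite /g big_seq [RHS]big_seq; apply: eq_bigr => i iF.
  by rewrite iF.
have mg n : measurable_fun setT (g n).
  rewrite gE; apply: measurable_sum => i; case: (boolP (i \in F)) => // iF; exact: mdiff.
have gcvg : (\int[P]_w (g n w)%:E @[n --> \oo] --> 0)%E.
  rewrite (_ : (fun n => _) = (fun n => \sum_(i <- F) (if i \in F then \int[P]_w (cmod (S i n w - J i w) ^+ 2)%:E else 0))%E); last first.
    apply/funext => n; rewrite gE.
    under eq_integral do rewrite -sumEFin.
    rewrite ge0_integral_sum//.
    - apply: eq_bigr => i _; case: ifP => // _; exact: integral0.
    - by move=> i; apply/measurable_EFinP; case: (boolP (i \in F)) => // iF; exact: mdiff.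
    - by move=> i w _; rewrite lee_fin; case: ifP => // _; rewrite sqr_ge0.
  apply: (@cvge0_sum R _ F (fun i n => if i \in F then \int[P]_w (cmod (S i n w - J i w) ^+ 2)%:E else 0)%E) => [i n|i].
    by case: ifP => // _; apply: integral_ge0 => w _; rewrite lee_fin sqr_ge0.
  case: (boolP (i \in F)) => [/hP[_ _ ]//|_]; exact: cvg_cst.
have [phi [phik phiae]] := ae_cvg_subseq mg g0 gcvg.
pose Xn n w := complex.Re (\sum_(i <- F) c' i * S i n w).
pose XJ w := complex.Re (\sum_(i <- F) c' i * J i w).
have XnXJ w : g (phi k) w @[k --> \oo] --> (0 : R) -> Xn (phi k) w @[k --> \oo] --> XJ w.
  move=> gw; apply/cvgrPdist_le => e e0.
  pose C := \sum_(i <- F) cmod (c' i) + 1.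
  have C0 : 0 < C by rewrite ltr_wpDl// sumr_ge0// => i _; exact: cmod_ge0.
  have eC0 : 0 < e / C by rewrite divr_gt0.
  have : \forall k \near \oo, g (phi k) w < (e / C) ^+ 2.
    by apply: (cvgr_lt _ gw); rewrite exprn_gt0.
  apply: filterS => k gk.
  rewrite /XJ /Xn !Re_sum -sumrB.
  apply: le_trans (ler_norm_sum _ _ _) _.
  apply: (@le_trans _ _ (\sum_(i <- F) cmod (c' i) * (e / C))).
    rewrite big_seq [leRHS]big_seq; apply: ler_sum => i iF.
    rewrite -ReB -mulrBr; apply: le_trans (norm_ReM_le _ _) _.
    apply: ler_wpM2l; first exact: cmod_ge0.
    rewrite -ler_sqr ?nnegrE ?cmod_ge0 ?(ltW eC0)//.
    have -> : cmod (J i w - S i (phi k) w) ^+ 2 = cmod (S i (phi k) w - J i w) ^+ 2.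
      by rewrite !cmod_sqr !ReB !ImB; ring.
    apply: le_trans (ltW gk); rewrite /g (big_rem i)//= lerDl.
    by apply: sumr_ge0 => j _; rewrite sqr_ge0.
  rewrite -mulr_suml mulrCA ler_piMr ?(ltW e0)// ler_pdivrMr// mul1r /C lerDl//.
have mXn n : measurable_fun setT (Xn n).
  rewrite (_ : Xn n = (fun w => \sum_(i <- F)
     (complex.Re (c' i) * complex.Re (S i n w) -
      complex.Im (c' i) * complex.Im (S i n w)))); last first.
    by apply/funext => w; rewrite /Xn Re_sum; apply: eq_bigr => i _; rewrite ReM.
  by apply: measurable_sum => i; apply: measurable_funB; apply: measurable_funM.
have V0 : 0 < V.
  apply: le_lt_trans ltV; rewrite mulr_ge0// big_seq; apply: sumr_ge0 => i iF.
  rewrite mulr_ge0 ?sqr_ge0// -lee_fin; apply: le_trans (fv i iF).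
  by apply: integral_ge0 => r _; rewrite lee_fin sqr_ge0.
have Ebnd : \forall n \near \oo, \sum_(i <- F) cmod (c' i) ^+ 2 * step_energy (h i n) <= V.
  pose C := \sum_(i <- F) cmod (c' i) ^+ 2.
  have C0 : 0 <= C by apply: sumr_ge0 => i _; rewrite sqr_ge0.
  pose dl := V - 2 * \sum_(i <- F) cmod (c' i) ^+ 2 * v i.
  have dl0 : 0 < dl by rewrite subr_gt0.
  (* The gap [dl] in the strict inequality is shared among the modes in proportion to their squared
     coefficients; adding 1 keeps the denominator positive. *)
  pose eta := dl / (2 * (C + 1)).
  have C1 : 0 < 2 * (C + 1) by rewrite mulr_gt0// ltr_wpDl.
  have eta0 : 0 < eta by rewrite divr_gt0.
  have : \forall n \near \oo, forall i, i \in F -> (err i n < eta%:E)%E.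
    by apply: near_all_seq => i /hP[_ H _]; exact: cvge0_near_lt.
  apply: filterS => n errn.
  have le_en i : i \in F -> step_energy (h i n) <= 2 * v i + 2 * eta.
    move=> iF; rewrite -lee_fin -step_energyE//.
    have mstep := measurable_step_fun (h i n).
    have mf2 : measurable_fun setT (fun r => (f i r ^+ 2)%:E).
      by apply/measurable_EFinP/measurable_funX; exact: mf.
    have msf2 : measurable_fun setT (fun r => ((step_fun (h i n) r - f i r) ^+ 2)%:E).
      by apply/measurable_EFinP/measurable_funX; apply: measurable_funB => //; exact: mf.
    apply: (@le_trans _ _ (\int[lebesgue_measure]_r (2%:E * (f i r ^+ 2)%:E + 2%:E * ((step_fun (h i n) r - f i r) ^+ 2)%:E))%E).
      apply: ge0_le_integral => //=.
      - by move=> r _; rewrite lee_fin sqr_ge0.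
      - exact/measurable_EFinP/measurable_funX.
      - by apply: emeasurable_funD; exact: emeasurable_funM.
      - move=> r _; rewrite -!EFinM -EFinD lee_fin.
        have := sqr_ge0 (step_fun (h i n) r - 2 * f i r); nra.
    rewrite ge0_integralDT; first last.
    - by move=> r; rewrite -EFinM lee_fin mulr_ge0// sqr_ge0.
    - by move=> r; rewrite -EFinM lee_fin mulr_ge0// sqr_ge0.
    - exact: emeasurable_funM.
    - exact: emeasurable_funM.
    rewrite !ge0_integralZT//; try by move=> r; rewrite lee_fin sqr_ge0.
    rewrite (_ : (2 * v i + 2 * eta)%:E = 2%:E * (v i)%:E + 2%:E * eta%:E)%E; last first.
      by rewrite -!EFinM -EFinD.
    apply: leeD; apply: lee_wpmul2l => //; first exact: fv.
    exact/ltW/errn.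
  apply: (@le_trans _ _ (\sum_(i <- F) cmod (c' i) ^+ 2 * (2 * v i + 2 * eta))).
    rewrite big_seq [leRHS]big_seq; apply: ler_sum => i iF.
    by apply: ler_wpM2l; [exact: sqr_ge0|exact: le_en].
  rewrite (eq_bigr (fun i => 2 * (cmod (c' i) ^+ 2 * v i) + cmod (c' i) ^+ 2 * (2 * eta))); last first.
    by move=> i _; ring.
  rewrite big_split /= -mulr_sumr -mulr_suml -/C.
  have dlE : dl = 2 * (C + 1) * eta by rewrite /eta mulrC divfK// gt_eqF.
  have : C * (2 * eta) <= dl by rewrite dlE -subr_ge0; have := ltW eta0; lra.
  by rewrite /dl lerBrDl.
have Ephi : \forall k \near \oo, (\int[P]_w (Xn (phi k) w ^+ (2 * m))%:E <= (moment_cst m * V ^+ m)%:E)%E.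
  case: Ebnd => N _ NP; exists N => // k /= Nk.
  by apply: step_field_moment => //; apply: NP; exact: leq_trans (phik k).
have mXnm k : measurable_fun setT (fun w => (Xn (phi k) w ^+ (2 * m))%:E).
  by apply/measurable_EFinP/measurable_funX.
have Xn0 k w : (0 <= (Xn (phi k) w ^+ (2 * m))%:E)%E.
  by rewrite lee_fin exprM exprn_ge0// sqr_ge0.
apply: (@le_trans _ _ (\int[P]_w limn_einf (fun k => (Xn (phi k) w ^+ (2 * m))%:E))%E).
  apply: ae_ge0_le_integral => //.
  - by move=> w _; rewrite lee_fin exprM exprn_ge0// sqr_ge0.
  - apply/measurable_EFinP/measurable_funX.
    rewrite (_ : (fun w => _) = (fun w => \sum_(i <- F) (if i \in F then
       (complex.Re (c' i) * complex.Re (J i w) -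
        complex.Im (c' i) * complex.Im (J i w)) else 0))); last first.
      apply/funext => w; rewrite Re_sum big_seq [RHS]big_seq; apply: eq_bigr => i iF.
      by rewrite iF ReM.
    apply: measurable_sum => i; case: (boolP (i \in F)) => // iF.
    by apply: measurable_funB; apply: measurable_funM => //; [exact: mRJ|exact: mIJ].
  - by move=> w _; apply: limn_einf_ge0 => k.
  - exact: measurable_fun_limn_einf.
  - apply: filterS phiae => w /XnXJ gw _.
    have H : (Xn (phi k) w ^+ (2 * m))%:E @[k --> \oo] --> (XJ w ^+ (2 * m))%:E.
      apply: cvg_EFin; first exact: nearW.
      exact: (cvg_comp _ _ gw (@exprn_continuous R (2 * m) (XJ w))).
    by rewrite is_cvg_limn_einfE; [rewrite (cvg_lim _ H)|exact: cvgP H].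
apply: le_trans (fatou _ measurableT mXnm (fun k w _ => Xn0 k w)) _.
exact: limn_einf_le_near.
Qed.

End CylindricalWiener.

(** * Exponential integrals and sums of powers *)

Section ExponentialIntegral.
Context {R : realType}.

Lemma integral_expR_itv (a b w : R) : a <= b -> 0 < w ->
  (\int[lebesgue_measure]_(u in `[a, b]) (expR (w * (u - b)))%:E =
    ((1 - expR (w * (a - b))) / w)%:E)%E.
Proof.
rewrite le_eqVlt => /predU1P[->|ab] w0.
  by rewrite set_itv1 integral_set1 subrr mulr0 expR0 subrr mul0r.
have dF (z : R) : is_derive z 1 (fun u => expR (w * (u - b)) / w) (expR (w * (z - b))).
  apply: is_derive_eq.
  rewrite /GRing.scale /=; field; by rewrite gt_eqF.
have cF : continuous (fun u : R => expR (w * (u - b)) / w).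
  move=> z; apply: differentiable_continuous; apply/derivable1_diffP.
  exact: ex_derive.
have cf : continuous (fun u : R => expR (w * (u - b))).
  move=> z; apply: differentiable_continuous; apply/derivable1_diffP.
  exact: ex_derive.
rewrite (@continuous_FTC2 R (fun u => expR (w * (u - b))) (fun u => expR (w * (u - b)) / w))//.
- by rewrite subrr mulr0 expR0 -EFinB; congr EFin; ring.
- by apply: continuous_subspaceT.
- split.
  + by move=> z _; exact: ex_derive.
  + exact/cvg_at_right_filter/cF.
  + exact/cvg_at_left_filter/cF.
- by move=> z _; rewrite derive1E; exact: derive_val.
Qed.

Lemma integral_expR_itv_le (a b w : R) : a <= b -> 0 < w ->
  (\int[lebesgue_measure]_(u in `[a, b]) (expR (w * (u - b)))%:E <= (w^-1)%:E)%E.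
Proof.
move=> ab w0; rewrite integral_expR_itv// lee_fin ler_pdivrMr// mulVf ?gt_eqF//.
Qed.

Lemma integral_expR_itv_le_length (a b w : R) : a <= b -> 0 < w ->
  (\int[lebesgue_measure]_(u in `[a, b]) (expR (w * (u - b)))%:E <= (b - a)%:E)%E.
Proof.
move=> ab w0; rewrite integral_expR_itv// lee_fin ler_pdivrMr//.
have := expR_ge1Dx (w * (a - b)); lra.
Qed.

End ExponentialIntegral.

Section PowerBounds.
Context {R : realType}.

(** This interpolation trades part of the decay in the symbol for a power of the time lag. *)
Lemma minr_le_powR (x theta : R) : 0 <= x -> 0 < theta -> theta <= 1 ->
  Num.min x 1 <= x `^ theta.
Proof.
move=> x0 t0 t1; case: (leP x 1) => x1.
  move: x0; rewrite le_eqVlt => /predU1P[<-|x0]; first by rewrite powR_ge0.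
  by apply: ger1_powR; rewrite ?x0.
by rewrite -(powRr0 x) ler_powR ?ltW.
Qed.

(** Comparison with the integral in discrete form: with [b = a - 1], each term after the first is at
    most a difference of consecutive values of [j.+1] to the power [- b], divided by [b], and these
    differences telescope. *)
Lemma sum_riemann_le (a : R) N : 1 < a ->
  \sum_(j < N) j.+1%:R `^ (- a) <= 1 + (a - 1)^-1 :> R.
Proof.
move=> a1; pose b := a - 1.
have b0 : 0 < b by rewrite subr_gt0.
have step (j : nat) : (j.+2%:R : R) `^ (- a) <= (j.+1%:R `^ (- b) - j.+2%:R `^ (- b)) / b.
  have j1 : 0 < j.+1%:R :> R by rewrite ltr0n.
  have j2 : 0 < j.+2%:R :> R by rewrite ltr0n.
  rewrite ler_pdivlMr//.
  have -> : (j.+2%:R : R) `^ (- a) = j.+2%:R `^ (- b) / j.+2%:R.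
    rewrite -[X in _ / X](powRr1 (ltW j2)) -powRB; last by apply/implyP => _; rewrite gt_eqF.
    by congr (_ `^ _); rewrite /b; ring.
  have -> : (j.+1%:R : R) `^ (- b) = j.+2%:R `^ (- b) * (j.+1%:R / j.+2%:R) `^ (- b).
    by rewrite -powRM ?ltW ?divr_gt0// mulrC divfK// gt_eqF.
  rewrite lerBrDr -mulrA -[X in _ + X]mulr1 -mulrDr.
  apply: ler_wpM2l; first exact: powR_ge0.
  rewrite /powR gt_eqF ?divr_gt0//.
  apply: le_trans (expR_ge1Dx _); rewrite addrC lerD2l.
  have lnle : ln (j.+1%:R / j.+2%:R : R) <= - j.+2%:R^-1.
    have -> : j.+1%:R / j.+2%:R = 1 + (- j.+2%:R^-1) :> R.
      have e : (j.+2%:R : R) = j.+1%:R + 1 by rewrite natr1.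
      apply: (mulIf (x := j.+2%:R)); first by rewrite gt_eqF.
      by rewrite divfK ?gt_eqF// mulrDl mul1r mulNr mulVf ?gt_eqF// e; ring.
    by apply: le_ln1Dx; rewrite ltrN2 invf_lt1// ltr1n.
  rewrite mulrC mulNr -mulrN; apply: ler_wpM2l; first exact: ltW.
  by rewrite lerNr.
case: N => [|N]; first by rewrite big_ord0 addr_ge0// invr_ge0 ltW.
rewrite big_ord_recl /= powR1 lerD2l.
apply: (@le_trans _ _ (\sum_(i < N) (i.+1%:R `^ (- b) - i.+2%:R `^ (- b)) / b)).
  by apply: ler_sum => i _; exact: step.
rewrite -mulr_suml -[leRHS]mul1r; apply: ler_wpM2r; first by rewrite invr_ge0 ltW.
have -> : \sum_(i < N) ((i.+1%:R : R) `^ (- b) - i.+2%:R `^ (- b)) = 1 - N.+1%:R `^ (- b).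
  rewrite -(big_mkord predT (fun i => (i.+1%:R : R) `^ (- b) - i.+2%:R `^ (- b))).
  rewrite -[LHS]opprK -sumrN; under eq_bigr do rewrite opprB.
  by rewrite (telescope_sumr (fun i => (i.+1%:R : R) `^ (- b)))// powR1 opprB.
by rewrite lerBlDr lerDl powR_ge0.
Qed.

(** Each absolute value is attained by at most two integers, whence the factor 2. *)
Lemma sum_int_box_le (g : nat -> R) N : (forall j, 0 <= g j) ->
  \sum_(k <- int_box N) g `|k|%N <= 2 * \sum_(j < N.+1) g j.
Proof.
move=> g0; rewrite /int_box big_map.
have -> : iota 0 (2 * N).+1 = index_iota 0 (2 * N).+1 by rewrite /index_iota subn0.
rewrite (@big_cat_nat _ _ _ N)//=; last by lia.
rewrite mulr_natl mulr2n; apply: lerD.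
  rewrite big_nat_rev /= (eq_big_nat _ _ (F2 := fun i => g i.+1)); last first.
    by move=> i /andP[_ iN]; congr g; lia.
  rewrite [leRHS]big_ord_recl /= -[leLHS](big_mkord predT (fun i => g i.+1)) || rewrite big_mkord.
  by rewrite [leRHS]big_ord_recl lerDr.
rewrite -{1}[N]add0n big_addn (_ : (2 * N).+1 - N = N.+1)%N; last by lia.
rewrite big_mkord le_eqVlt; apply/orP; left; apply/eqP.
by apply: eq_bigr => i _; congr g; lia.
Qed.

End PowerBounds.

(** * Growth of the symbol of 1 - L_0 *)

Section Symbol.
Context {R : realType}.
Variables (L : R).
Hypothesis L0 : 0 < L.

Definition symbol (k l : int) : R := 1 - lambda L 0 k l.

Lemma symbolE k l : symbol k l =
  1 + (1 - (pi / L) ^+ 2 * k%:~R ^+ 2) ^+ 2 + (pi / L) ^+ 2 * l%:~R ^+ 2.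
Proof. by rewrite /symbol /lambda expr0n /=; ring. Qed.

Lemma lambda1E k l : lambda L 1 k l = 2 - symbol k l.
Proof. by rewrite symbolE /lambda; ring. Qed.

Lemma symbol_ge1 k l : 1 <= symbol k l.
Proof.
rewrite symbolE -addrA lerDl; apply: addr_ge0; first exact: sqr_ge0.
by apply: mulr_ge0; exact: sqr_ge0.
Qed.

Lemma symbol_lower : exists2 c0 : R, 0 < c0 & forall k l,
  c0 * (1 + `|k|%N%:R) ^+ 4 <= symbol k l /\ c0 * (1 + `|l|%N%:R) ^+ 2 <= symbol k l.
Proof.
have c_gt0 : 0 < pi / L by rewrite divr_gt0// pi_gt0.
pose c := Num.min 1 (pi / L).
have c0 : 0 < c by rewrite lt_min ltr01.
have c1 : c <= 1 by rewrite ge_min lexx.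
have cL : c <= pi / L by rewrite ge_min lexx orbT.
have c2L : c ^+ 2 <= (pi / L) ^+ 2 by rewrite lerXn2r ?nnegrE// ltW.
(* Here 24 is [8 * 3]: the 8 comes from [(1 + x) ^+ 4 <= 8 * (1 + x ^+ 4)], the 3 from
   [(1 + X ^+ 2) / 3 <= 1 + (1 - X) ^+ 2], which controls the quartic part where [1 - X] vanishes.
   As [c <= 1], powers of [c] are absorbed by the constant terms. *)
exists (c ^+ 4 / 24); first by rewrite divr_gt0// exprn_gt0.
move=> k l; rewrite symbolE.
have sqk : k%:~R ^+ 2 = (`|k|%N%:R : R) ^+ 2 by rewrite pmulrn abszE intr_norm real_normK ?num_real.
have sql : l%:~R ^+ 2 = (`|l|%N%:R : R) ^+ 2 by rewrite pmulrn abszE intr_norm real_normK ?num_real.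
rewrite sqk sql; move: (`|k|%N%:R : R) (`|l|%N%:R : R) (ler0n R `|k|%N) (ler0n R `|l|%N) => x y x0 y0.
move: c2L; set C := (pi / L) ^+ 2 => c2L.
have c21 : c ^+ 2 <= 1 by rewrite expr_le1// ltW.
have c2_ge0 : 0 <= c ^+ 2 by exact: sqr_ge0.
have c4 : c ^+ 4 = (c ^+ 2) ^+ 2 by rewrite -exprM.
rewrite c4; move: (c ^+ 2) c2L c21 c2_ge0 => D DC D1 D0; split.
  have h1 : (1 + x) ^+ 4 <= 8 * (1 + x ^+ 4).
    rewrite -subr_ge0.
    have -> : 8 * (1 + x ^+ 4) - (1 + x) ^+ 4 = (x - 1) ^+ 2 * (7 * x ^+ 2 + 10 * x + 7) by ring.
    by rewrite mulr_ge0 ?sqr_ge0//; nra.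
  have h2 : (1 + (C * x ^+ 2) ^+ 2) / 3 <= 1 + (1 - C * x ^+ 2) ^+ 2.
    move: (C * x ^+ 2) => X; have := sqr_ge0 (X - 3 / 2); nra.
  have h3 : D ^+ 2 * (1 + x ^+ 4) <= 1 + (C * x ^+ 2) ^+ 2.
    have : D ^+ 2 <= 1 by rewrite expr_le1.
    have : D ^+ 2 * x ^+ 4 <= (C * x ^+ 2) ^+ 2.
      have -> : (C * x ^+ 2) ^+ 2 = C ^+ 2 * x ^+ 4 by ring.
      by apply: ler_wpM2r; [exact: exprn_ge0|rewrite lerXn2r// nnegrE (le_trans D0)].
    by rewrite mulrDr mulr1; lra.
  have h4 : 0 <= C * y ^+ 2 by rewrite mulr_ge0 ?sqr_ge0.
  have h5 : D ^+ 2 / 24 * (1 + x) ^+ 4 <= D ^+ 2 * (1 + x ^+ 4) / 3.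
    have := sqr_ge0 D; move: (D ^+ 2) => E E0.
    have := ler_wpM2l E0 h1; lra.
  lra.
have h1 : 0 <= (1 - C * x ^+ 2) ^+ 2 by exact: sqr_ge0.
have h2 : D ^+ 2 * (1 + y) ^+ 2 <= 2 * (1 + C * y ^+ 2).
  apply: (@le_trans _ _ (D * (2 * (1 + y ^+ 2)))).
    apply: ler_pM; rewrite ?sqr_ge0//; first by rewrite expr2 ler_piMr.
    have := sqr_ge0 (1 - y); nra.
  have := ler_wpM2r (sqr_ge0 y) DC; nra.
have := mulr_ge0 (sqr_ge0 D) (sqr_ge0 (1 + y)); nra.
Qed.

(** Multiplying the quartic bound in [k] once and the quadratic bound in [l] twice gives
    [symbol ^+ 3 >= c0 ^+ 3 * (x * y) ^+ 4], with [x] and [y] the shifted absolute values. The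
    double series is thus dominated by a product of two series with exponent [4 / 3 * q], which
    exceeds 1 when [q] exceeds 3/4. *)
Lemma sum_symbol_le (q : R) : 3 / 4 < q ->
  exists C : R, forall N,
    \sum_(k <- int_box N) \sum_(l <- int_box N) symbol k l `^ (- q) <= C.
Proof.
move=> q34; have [c0 c00 cP] := symbol_lower.
have q0 : 0 < q by lra.
pose a := 4 / 3 * q.
have a1 : 1 < a by rewrite /a; lra.
pose B : R := 2 * (1 + (a - 1)^-1).
exists (c0 `^ (- q) * (B * B)) => N.
have key k l : symbol k l `^ (- q) <=
    c0 `^ (- q) * ((1 + `|k|%N%:R) `^ (- a) * (1 + `|l|%N%:R) `^ (- a)).
  have [ck cl] := cP k l.
  have x1 : 0 < 1 + `|k|%N%:R :> R by rewrite ltr_pwDl.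
  have y1 : 0 < 1 + `|l|%N%:R :> R by rewrite ltr_pwDl.
  move: (1 + `|k|%N%:R) (1 + `|l|%N%:R) x1 y1 ck cl => x y x0 y0 ck cl.
  have s0 : 0 < symbol k l by apply: lt_le_trans (symbol_ge1 k l).
  have s3 : c0 ^+ 3 * (x * y) ^+ 4 <= symbol k l ^+ 3.
    have -> : c0 ^+ 3 * (x * y) ^+ 4 = (c0 * x ^+ 4) * (c0 * y ^+ 2) * (c0 * y ^+ 2) by ring.
    have -> : symbol k l ^+ 3 = symbol k l * symbol k l * symbol k l by ring.
    have p1 : 0 <= c0 * x ^+ 4 by rewrite mulr_ge0 ?exprn_ge0// ltW.
    have p2 : 0 <= c0 * y ^+ 2 by rewrite mulr_ge0 ?exprn_ge0// ltW.
    by apply: ler_pM => //; [exact: mulr_ge0|exact: ler_pM].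
  have xy0 : 0 < x * y by rewrite mulr_gt0.
  have -> : symbol k l `^ (- q) = (symbol k l ^+ 3) `^ (- (q / 3)).
    by rewrite -powR_mulrn ?(ltW s0)// -powRrM; congr (_ `^ _); field.
  have -> : c0 `^ (- q) * (x `^ (- a) * y `^ (- a)) = (c0 ^+ 3 * (x * y) ^+ 4) `^ (- (q / 3)).
    rewrite -powRM ?(ltW x0) ?(ltW y0)// [RHS]powRM ?exprn_ge0 ?(ltW c00) ?(ltW xy0)//.
    rewrite -!powR_mulrn ?(ltW c00) ?(ltW xy0)// -!powRrM.
    by congr (_ `^ _ * _ `^ _); rewrite /a; field.
  rewrite !powRN lef_pV2 ?posrE ?powR_gt0 ?mulr_gt0 ?exprn_gt0//.
  apply: ge0_ler_powR; last exact: s3.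
  - by rewrite divr_ge0// ltW.
  - by rewrite nnegrE; apply: mulr_ge0; apply: exprn_ge0; exact: ltW.
  - by rewrite nnegrE exprn_ge0// ltW.
apply: (@le_trans _ _ (\sum_(k <- int_box N) \sum_(l <- int_box N)
   c0 `^ (- q) * ((1 + `|k|%N%:R) `^ (- a) * (1 + `|l|%N%:R) `^ (- a)))).
  by apply: ler_sum => k _; apply: ler_sum => l _; exact: key.
under eq_bigr do rewrite -mulr_sumr -mulr_sumr.
rewrite -mulr_sumr -mulr_suml; apply: ler_wpM2l; first exact: powR_ge0.
have bnd : \sum_(k <- int_box N) (1 + `|k|%N%:R) `^ (- a) <= B.
  apply: le_trans (sum_int_box_le N (g := fun j => (1 + j%:R) `^ (- a)) _) _.
    by move=> j; exact: powR_ge0.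
  apply: ler_wpM2l => //; under eq_bigr do rewrite addrC natr1.
  exact: sum_riemann_le.
by apply: ler_pM => //; apply: sumr_ge0 => k _; exact: powR_ge0.
Qed.

End Symbol.

(** * Energy of the heat kernel and of its time increments *)

Section HeatKernel.
Context {R : realType}.
Variables (L T : R).
Hypothesis L0 : 0 < L.

(** The integrand is extended by 0 outside [[0, t]], so that kernels for different times can be
    subtracted. *)
Definition heat (t : R) (k l : int) (u : R) : R :=
  expR ((t - u) * lambda L 1 k l) * \1_(`[0, t]%classic) u.

Lemma measurable_heat t k l : measurable_fun setT (heat t k l).
Proof.
apply: measurable_funM; last exact: measurable_indic.
apply: measurableT_comp => //; apply: measurable_funM => //.
exact: measurable_funB.
Qed.

(** The exponent [2 - nu] is the eigenvalue of L_1. For [nu >= 2] the exponential is at most 1; for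
    [nu < 2] it grows, by a factor at most [expR T] over the whole interval, and the square of that
    factor is the constant. *)
Lemma expRm1_sqr_le (delta nu : R) : 0 <= delta -> delta <= T -> 1 <= nu ->
  (expR (delta * (2 - nu)) - 1) ^+ 2 <= expR (2 * T) * Num.min (delta * nu) 1.
Proof.
move=> d0 dT nu1; have T0 : 0 <= T by exact: le_trans dT.
have dnu0 : 0 <= delta * nu by rewrite mulr_ge0//; lra.
have [nu2|nu2] := leP 2 nu.
  set x := delta * (2 - nu).
  have x0 : x <= 0 by rewrite /x mulr_ge0_le0//; lra.
  have xle : - x <= delta * nu by rewrite /x; nra.
  have e1 : expR x <= 1 by rewrite -expR0 ler_expR.
  have e2 := expR_ge1Dx x.
  have e3 : 1 <= expR (2 * T) by rewrite -expR0 ler_expR mulr_ge0.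
  have e4 := expR_gt0 x.
  have m0 : 0 <= Num.min (delta * nu) 1 by rewrite le_min dnu0 ler01.
  apply: (@le_trans _ _ (Num.min (delta * nu) 1)); last by rewrite ler_peMl.
  rewrite le_min; apply/andP; split; nra.
set x := delta * (2 - nu).
have x0 : 0 <= x by rewrite /x mulr_ge0//; lra.
have xd : x <= delta by rewrite /x; nra.
have eT : expR x <= expR T by rewrite ler_expR (le_trans xd).
have e1 : 1 <= expR x by rewrite -expR0 ler_expR.
have e2 := expR_ge1Dx (- x).
have eN : expR (- x) * expR x = 1 by rewrite -expRD addNr expR0.
have e3 : expR x - 1 <= x * expR x by nra.
have -> : expR (2 * T) = expR T * expR T by rewrite -expRD; congr expR; ring.
rewrite expr2 -mulrA; apply: ler_pM; rewrite ?subr_ge0//; first by lra.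
have eT0 := expR_gt0 T.
rewrite minr_pMr ?expR_ge0//; rewrite le_min; apply/andP; split; last by lra.
apply: le_trans e3 _; rewrite [leRHS]mulrC; apply: ler_pM => //.
by apply: le_trans xd _; rewrite ler_peMr.
Qed.

(** The growing part of the exponential is absorbed into a constant, which leaves pure decay at rate
    [2 * nu]. *)
Lemma expR_lambda1_sqr_le (x nu : R) : 0 <= x -> x <= T ->
  expR (x * (2 - nu)) ^+ 2 <= expR (4 * T) * expR (2 * nu * (- x)).
Proof.
by move=> x0 xT; rewrite -expRM_natr -expRD ler_expR; lra.
Qed.

Lemma integral_mul_indic (f : R -> \bar R) (D : set R) :
  (\int[lebesgue_measure]_u (f u * (\1_D u)%:E) = \int[lebesgue_measure]_(u in D) f u)%E.
Proof.
rewrite [RHS]integral_mkcond; apply: eq_integral => u _; rewrite patchE indicE.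
by case: ifPn; rewrite ?mule1 ?mule0.
Qed.

Lemma measurable_expR_affine (w b : R) :
  measurable_fun setT (fun u : R => (expR (w * (u - b)))%:E).
Proof.
apply/measurable_EFinP; apply: measurableT_comp => //.
by apply: measurable_funM => //; exact: measurable_funB.
Qed.

Lemma heat_energy_le t k l : 0 <= t -> t <= T ->
  (\int[lebesgue_measure]_u (heat t k l u ^+ 2)%:E <= (expR (4 * T) / symbol L k l)%:E)%E.
Proof.
move=> t0 tT; set nu := symbol L k l.
have nu1 : 1 <= nu by exact: symbol_ge1.
have nu0 : 0 < nu by lra.
apply: (@le_trans _ _ (\int[lebesgue_measure]_u ((expR (4 * T))%:E * ((expR (2 * nu * (u - t)))%:E * (\1_(`[0, t]%classic) u)%:E)))%E).
  apply: ge0_le_integral => //=.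
  - by move=> u _; rewrite lee_fin sqr_ge0.
  - by apply/measurable_EFinP/measurable_funX; exact: measurable_heat.
  - apply: emeasurable_funM => //; apply: emeasurable_funM; first exact: measurable_expR_affine.
    by apply/measurable_EFinP; exact: measurable_indic.
  - move=> u _; rewrite -!EFinM lee_fin /heat lambda1E -/nu indicE mem_setE in_itv /=.
    have [/andP[u0 ut]|_] := boolP (0 <= u <= t); last by rewrite mulr0 expr0n /= !mulr0.
    rewrite !mulr1; have := @expR_lambda1_sqr_le (t - u) nu; rewrite (opprB t u); apply; lra.
rewrite ge0_integralZT ?expR_ge0//; first last.
  - apply: emeasurable_funM; first exact: measurable_expR_affine.
    by apply/measurable_EFinP; exact: measurable_indic.
rewrite integral_mul_indic EFinM; apply: lee_wpmul2l; first by rewrite lee_fin expR_ge0.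
apply: le_trans (integral_expR_itv_le _ _) _ => //; first by rewrite mulr_gt0.
by rewrite lee_fin lef_pV2 ?posrE ?mulr_gt0//; lra.
Qed.

(** On [[0, r]] the difference is the kernel for [r] times [expR ((t - r) * lambda) - 1], and the
    square of that factor is controlled by [min ((t - r) * nu) 1]. On [[r, t]] only the kernel for
    [t] remains, with energy controlled by [min (t - r) nu^-1]. Both minima are interpolated to the
    power [theta]. *)
Lemma heat_increment_energy_le theta t r k l : 0 < theta -> theta <= 1 ->
  0 <= r -> r <= t -> t <= T ->
  (\int[lebesgue_measure]_u ((heat t k l u - heat r k l u) ^+ 2)%:E <=
   (2 * expR (6 * T) * ((t - r) * symbol L k l) `^ theta / symbol L k l)%:E)%E.
Proof.
move=> th0 th1 r0 rt tT; set nu := symbol L k l.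
have nu1 : 1 <= nu by exact: symbol_ge1.
have nu0 : 0 < nu by lra.
have T0 : 0 <= T by lra.
set dl := t - r; have dl0 : 0 <= dl by rewrite subr_ge0.
have dlnu : 0 <= dl * nu by rewrite mulr_ge0// ltW.
set p := (dl * nu) `^ theta.
have minp : Num.min (dl * nu) 1 <= p by exact: minr_le_powR.
have p0 : 0 <= p by exact: powR_ge0.
pose A := expR (6 * T) * p.
have A0 : 0 <= A by rewrite mulr_ge0// expR_ge0.
have m1 b : measurable_fun setT (fun u : R => ((expR (2 * nu * (u - b)))%:E * (\1_(`[0, b]%classic) u)%:E)%E).
  apply: emeasurable_funM; first exact: measurable_expR_affine.
  by apply/measurable_EFinP; exact: measurable_indic.
have m2 : measurable_fun setT (fun u : R => ((expR (2 * nu * (u - t)))%:E * (\1_(`[r, t]%classic) u)%:E)%E).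
  apply: emeasurable_funM; first exact: measurable_expR_affine.
  by apply/measurable_EFinP; exact: measurable_indic.
apply: (@le_trans _ _ (\int[lebesgue_measure]_u (A%:E * ((expR (2 * nu * (u - r)))%:E * (\1_(`[0, r]%classic) u)%:E) +
   (expR (4 * T))%:E * ((expR (2 * nu * (u - t)))%:E * (\1_(`[r, t]%classic) u)%:E)))%E).
  apply: ge0_le_integral => //=.
  - by move=> u _; rewrite lee_fin sqr_ge0.
  - by apply/measurable_EFinP/measurable_funX/measurable_funB; exact: measurable_heat.
  - by apply: emeasurable_funD; apply: emeasurable_funM => //; exact: m1.
  - move=> u _; rewrite -!EFinM -EFinD lee_fin /heat lambda1E -/nu !indicE !mem_setE !in_itv /=.
    have [u0|u0] := leP 0 u; last first.
      have -> : (r <= u) = false by apply/negbTE; rewrite -ltNge; lra.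
      by rewrite /= !mulr0 subrr expr0n /= addr0.
    have [ur|ru] := leP u r.
      have -> : u <= t by lra.
      rewrite /= !mulr1.
      apply: (@le_trans _ _ (A * expR (2 * nu * (u - r)))); last first.
        by rewrite lerDl mulr_ge0 ?expR_ge0// mulr_ge0 ?expR_ge0.
      have -> : expR ((t - u) * (2 - nu)) = expR ((r - u) * (2 - nu)) * expR (dl * (2 - nu)).
        by rewrite -expRD; congr expR; rewrite /dl; ring.
      rewrite -[X in _ - X]mulr1 -mulrBr exprMn.
      have e1 : expR ((r - u) * (2 - nu)) ^+ 2 <= expR (4 * T) * expR (2 * nu * (u - r)).
        by have := @expR_lambda1_sqr_le (r - u) nu; rewrite (opprB r u); apply; lra.
      have e2 : (expR (dl * (2 - nu)) - 1) ^+ 2 <= expR (2 * T) * p.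
        apply: le_trans (expRm1_sqr_le _ _ _) _ => //; first by rewrite /dl; lra.
        by apply: ler_wpM2l => //; exact: expR_ge0.
      have -> : A * expR (2 * nu * (u - r)) =
          (expR (4 * T) * expR (2 * nu * (u - r))) * (expR (2 * T) * p).
        have -> : A = expR (4 * T) * expR (2 * T) * p.
          by rewrite /A -expRD; congr (expR _ * _); ring.
        by ring.
      by apply: ler_pM => //; exact: sqr_ge0.
    rewrite /= !mulr0 add0r subr0 (ltW ru) /=.
    have [ut|ut] := boolP (u <= t); last by rewrite !mulr0 expr0n /= ?mulr0.
    rewrite !mulr1.
    by have := @expR_lambda1_sqr_le (t - u) nu; rewrite (opprB t u); apply; lra.
rewrite ge0_integralDT; first last.
- by move=> u; rewrite !mule_ge0// lee_fin// expR_ge0.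
- by move=> u; rewrite !mule_ge0// lee_fin// expR_ge0.
- by apply: emeasurable_funM.
- by apply: emeasurable_funM => //; exact: m1.
rewrite !ge0_integralZT ?expR_ge0//; try by move=> u; rewrite mule_ge0// lee_fin// expR_ge0.
rewrite !integral_mul_indic.
have w0 : 0 < 2 * nu by rewrite mulr_gt0.
have nuV : (2 * nu)^-1 <= nu^-1 by rewrite lef_pV2 ?posrE//; lra.
have -> : 2 * expR (6 * T) * p / nu = A * nu^-1 + expR (6 * T) * (p / nu).
  by rewrite /A; ring.
rewrite EFinD; apply: leeD.
  rewrite (EFinM A); apply: lee_wpmul2l; first by rewrite lee_fin.
  by apply: le_trans (integral_expR_itv_le _ _) _ => //; rewrite lee_fin.
rewrite (EFinM (expR (6 * T))); apply: lee_pmul; rewrite ?lee_fin ?expR_ge0 ?ler_expR//; last 1 first.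
- apply: (@le_trans _ _ (Num.min dl nu^-1)%:E).
    rewrite EFin_min le_min integral_expR_itv_le_length//=.
    by apply: le_trans (integral_expR_itv_le _ _) _ => //; rewrite lee_fin.
  have -> : Num.min dl nu^-1 = Num.min (dl * nu) 1 / nu.
    rewrite minr_pMl ?invr_ge0 ?(ltW nu0)// mulfK ?gt_eqF// mul1r//.
  by rewrite lee_fin ler_wpM2r// invr_ge0 ltW.
- by apply: integral_ge0 => u _; rewrite lee_fin expR_ge0.
- lra.
- exact: m1.
Qed.

End HeatKernel.

(** * Wiener integrals with integrands on the whole line *)

Section WienerImage.
Context {d : measure_display} {R : realType} {Omega : measurableType d}.
Variable P : probability Omega R.
Variable beta : int -> int -> R -> Omega -> R[i].
Hypothesis Wbeta : cylindrical_wiener P beta.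

Lemma is_step_nonneg t (h : seq (R * R * R)) : is_step t h -> nonneg_step h.
Proof. by move=> ht j /ht[a [b _]]; rewrite a b. Qed.

Lemma is_step_out t (h : seq (R * R * R)) r : is_step t h ->
  ~~ (0 <= r <= t) -> step_fun h r = 0.
Proof.
move=> ht rt; rewrite /step_fun big_seq big1// => j /ht[a [b c]].
rewrite indicE mem_setE in_itv /=; have [/andP[ar rb]|_] := boolP (j.1.1 < r <= j.1.2); last by rewrite mulr0.
by move: rt; rewrite (le_trans a (ltW ar)) (le_trans rb c).
Qed.

(** Step functions supported in [[0, t]] vanish outside it, as does the extended integrand, so the
    error on the line is the error on the interval. *)
Lemma wiener_integral_image (i : int * int) (t : R) (f : R -> R) (J : Omega -> R[i]) :
  wiener_integral P t f (beta i.1 i.2) J ->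
  wiener_image P beta i (fun u => f u * \1_(`[0, t]%classic) u) J.
Proof.
move=> [mJ [h [hs hf hJ]]]; split => //; exists h; split => //.
  by move=> n; exact: is_step_nonneg (hs n).
rewrite (_ : (fun n => _) = (fun n => (\int[lebesgue_measure]_(r in `[0%R, t]%classic)
           ((step_fun (h n) r - f r) ^+ 2)%:E)%E))//.
apply/funext => n; rewrite -[RHS]integral_mul_indic; apply: eq_integral => r _.
rewrite -EFinM indicE mem_setE in_itv /=; have [rt|rt] := boolP (0 <= r <= t).
  by rewrite !mulr1.
by rewrite !mulr0 subr0 (is_step_out (hs n)) ?expr0n.
Qed.

Lemma ge0_cvge0_le (u v : nat -> \bar R) :
  (forall n, (0 <= u n)%E) -> (forall n, (u n <= v n)%E) ->
  v n @[n --> \oo] --> 0%E -> u n @[n --> \oo] --> 0%E.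
Proof.
move=> u0 uv vcvg; apply: (squeeze_cvge _ (cvg_cst 0%E) vcvg).
by apply: nearW => n; rewrite u0 uv.
Qed.

Lemma sqrB_le (a b x y : R) :
  ((a - b) - (x - y)) ^+ 2 <= 2 * (a - x) ^+ 2 + 2 * (b - y) ^+ 2.
Proof.
rewrite -subr_ge0.
have -> : 2 * (a - x) ^+ 2 + 2 * (b - y) ^+ 2 - (a - b - (x - y)) ^+ 2 =
  ((a - x) + (b - y)) ^+ 2 by ring.
exact: sqr_ge0.
Qed.

Lemma cvge0_double_sum (u v : nat -> \bar R) :
  u n @[n --> \oo] --> 0%E -> v n @[n --> \oo] --> 0%E ->
  (2%:E * u n + 2%:E * v n)%E @[n --> \oo] --> 0%E.
Proof.
move=> u0 v0.
have Hu := cvgeZl (y := 2%:E) isT u0; have Hv := cvgeZl (y := 2%:E) isT v0.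
rewrite mule0 in Hu Hv.
have H := cvgeD (isT : (0 +? 0)%E) Hu Hv; rewrite adde0 in H; exact: H.
Qed.

Lemma step_integralB h h' (B : R -> Omega -> R[i]) w :
  step_integral (h ++ scale_step (- 1) h') B w =
  step_integral h B w - step_integral h' B w.
Proof.
apply: eq_complexP.
  rewrite ReB -![complex.Re (step_integral _ _ _)]/(component true _).
  by rewrite !component_step_integral rstep_cat rstep_scale mulN1r.
rewrite ImB -![complex.Im (step_integral _ _ _)]/(component false _).
by rewrite !component_step_integral rstep_cat rstep_scale mulN1r.
Qed.

Lemma measurable_cmod_sqr (f : Omega -> R[i]) : cmeasurable f ->
  measurable_fun setT (fun w => (cmod (f w) ^+ 2)%:E).
Proof.
move=> [mr mi]; apply/measurable_EFinP.
rewrite (_ : (fun w => _) = (fun w => complex.Re (f w) ^+ 2 + complex.Im (f w) ^+ 2)).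
  by apply: measurable_funD; exact: measurable_funX.
by apply/funext => w; rewrite cmod_sqr.
Qed.

Lemma cmeasurableB (f g : Omega -> R[i]) : cmeasurable f -> cmeasurable g ->
  cmeasurable (fun w => f w - g w).
Proof.
move=> [f1 f2] [g1 g2]; split.
  under eq_fun do rewrite ReB; exact: measurable_funB.
under eq_fun do rewrite ImB; exact: measurable_funB.
Qed.

(** It makes time increments of the coefficients Wiener integrals of differences of kernels.
    Approximating steps are subtracted by concatenating one list with the negated other. *)
Lemma wiener_imageB (i : int * int) (f g : R -> R) (J J' : Omega -> R[i]) :
  measurable_fun setT f -> measurable_fun setT g ->
  wiener_image P beta i f J -> wiener_image P beta i g J' ->
  wiener_image P beta i (fun u => f u - g u) (fun w => J w - J' w).
Proof.
move=> mf mg [mJ [h [h0 hf hJ]]] [mJ' [h' [h0' hg hJ']]]; split.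
  exact: cmeasurableB.
have mS n := measurable_step_field Wbeta i (h0 n).
have mS' n := measurable_step_field Wbeta i (h0' n).
exists (fun n => h n ++ scale_step (- 1) (h' n)); split.
- by move=> n; apply: nonneg_step_cat => //; exact: nonneg_step_scale.
- apply: (ge0_cvge0_le _ _ (cvge0_double_sum hf hg)).
    by move=> n; apply: integral_ge0 => r _; rewrite lee_fin sqr_ge0.
  move=> n.
  have m1 : measurable_fun setT (fun r => ((step_fun (h n) r - f r) ^+ 2)%:E).
    apply/measurable_EFinP/measurable_funX/measurable_funB => //.
    exact: measurable_step_fun.
  have m2 : measurable_fun setT (fun r => ((step_fun (h' n) r - g r) ^+ 2)%:E).
    apply/measurable_EFinP/measurable_funX/measurable_funB => //.
    exact: measurable_step_fun.
  rewrite -!ge0_integralZT//; try by move=> r; rewrite lee_fin sqr_ge0.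
  rewrite -ge0_integralDT; first last.
  + by move=> r; rewrite -EFinM lee_fin mulr_ge0// sqr_ge0.
  + by move=> r; rewrite -EFinM lee_fin mulr_ge0// sqr_ge0.
  + exact: emeasurable_funM.
  + exact: emeasurable_funM.
  apply: ge0_le_integralT.
  + apply/measurable_EFinP/measurable_funX/measurable_funB; first exact: measurable_step_fun.
    exact: measurable_funB.
  + by apply: emeasurable_funD; exact: emeasurable_funM.
  + by move=> r; rewrite lee_fin sqr_ge0.
  + move=> r; rewrite -!EFinM -EFinD lee_fin step_fun_cat step_fun_scale mulN1r.
    exact: sqrB_le.
- apply: (ge0_cvge0_le _ _ (cvge0_double_sum hJ hJ')).
    by move=> n; apply: integral_ge0 => r _; rewrite lee_fin sqr_ge0.
  move=> n.
  have m1 := measurable_cmod_sqr (cmeasurableB (mS n) mJ).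
  have m2 := measurable_cmod_sqr (cmeasurableB (mS' n) mJ').
  rewrite -!ge0_integralZT//; try by move=> r; rewrite lee_fin sqr_ge0.
  rewrite -ge0_integralDT; first last.
  + by move=> r; rewrite -EFinM lee_fin mulr_ge0// sqr_ge0.
  + by move=> r; rewrite -EFinM lee_fin mulr_ge0// sqr_ge0.
  + exact: emeasurable_funM.
  + exact: emeasurable_funM.
  have mSS : cmeasurable (fun w => step_integral (h n ++ scale_step (-1) (h' n)) (beta i.1 i.2) w).
    apply: (measurable_step_field Wbeta).
    by apply: nonneg_step_cat => //; exact: nonneg_step_scale.
  apply: ge0_le_integralT.
  + apply: measurable_cmod_sqr; apply: cmeasurableB => //; exact: cmeasurableB.
  + by apply: emeasurable_funD; exact: emeasurable_funM.
  + by move=> r; rewrite lee_fin sqr_ge0.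
  + move=> w; rewrite -!EFinM -EFinD lee_fin step_integralB !cmod_sqr.
    rewrite !ReB !ImB !mulrDr addrACA.
    by apply: lerD; exact: sqrB_le.
Qed.

End WienerImage.

(** * Dyadic times *)

Section DyadicIndex.
Context {R : realType}.
Variable (T : R).
Hypothesis T0 : 0 < T.

Definition dyadic_index (n : nat) (t : R) : nat := Num.truncn (t / T * 2 ^+ n).

Lemma dyadic_index_itv n t : 0 <= t ->
  (dyadic_index n t)%:R <= t / T * 2 ^+ n < (dyadic_index n t).+1%:R.
Proof. by move=> t0; apply: truncn_itv; rewrite mulr_ge0 ?divr_ge0// ltW. Qed.

Lemma dyadic_index_le n t : 0 <= t -> t <= T -> (dyadic_index n t <= 2 ^ n)%N.
Proof.
move=> t0 tT; have /andP[it _] := dyadic_index_itv n t0.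
rewrite -(ler_nat R) natrX; apply: le_trans it _.
by rewrite ler_piMl ?exprn_ge0// ler_pdivrMr// mul1r.
Qed.

Lemma dyadic_indexS n t : 0 <= t ->
  dyadic_index n.+1 t = (2 * dyadic_index n t)%N \/
  dyadic_index n.+1 t = (2 * dyadic_index n t).+1.
Proof.
move=> t0; have /andP[a1 a2] := dyadic_index_itv n t0.
have /andP[b1 b2] := dyadic_index_itv n.+1 t0.
move: a1 a2 b1 b2; rewrite exprS; set x := t / T; set i := dyadic_index n t; set j := dyadic_index _ t => a1 a2 b1 b2.
have h1 : (2 * i < j.+1)%N.
  rewrite -(ltr_nat R) natrM; apply: le_lt_trans b2.
  by rewrite mulrCA ler_pM2l.
have h2 : (j < 2 * i.+1)%N.
  rewrite -(ltr_nat R) natrM; apply: le_lt_trans b1 _.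
  by rewrite mulrCA ltr_pM2l.
by clear -h1 h2; lia.
Qed.

(** Because of this, the chains of two nearby times differ at level [n] by at most one increment of
    the grid. *)
Lemma dyadic_index_close n s t : 0 <= s -> s <= t -> t - s <= T / 2 ^+ n ->
  dyadic_index n t = dyadic_index n s \/ dyadic_index n t = (dyadic_index n s).+1.
Proof.
move=> s0 st ts; have t0 := le_trans s0 st.
have /andP[a1 a2] := dyadic_index_itv n s0.
have /andP[b1 b2] := dyadic_index_itv n t0.
have p0 : 0 < 2 ^+ n :> R by rewrite exprn_gt0.
have xy : s / T * 2 ^+ n <= t / T * 2 ^+ n.
  by rewrite ler_pM2r// ler_pM2r// invr_gt0.
have yx : t / T * 2 ^+ n <= s / T * 2 ^+ n + 1.
  rewrite -lerBlDl -!mulrBl -mulrA mulrC -ler_pdivlMl ?mulr_gt0 ?invr_gt0// mulr1.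
  by rewrite invfM invrK.
have h1 : (dyadic_index n s < (dyadic_index n t).+1)%N.
  rewrite -(ltr_nat R); lra.
have h2 : (dyadic_index n t < (dyadic_index n s).+2)%N.
  by rewrite -(ltr_nat R) -[X in _ < X]natr1; lra.
by clear -h1 h2; lia.
Qed.

Lemma dyadic_index0 t : 0 <= t -> t <= T ->
  dyadic_index 0 t = 0%N \/ dyadic_index 0 t = 1%N.
Proof. by move=> t0 tT; have := dyadic_index_le 0 t0 tT; rewrite expn0; lia. Qed.

End DyadicIndex.

(** * Geometric convergence at a point *)

Section ChainPointwise.
Context {R : realType}.

Lemma cvg_geometric_increments (x : nat -> R) (M rho : R) :
  0 < rho -> rho < 1 -> 0 <= M ->
  (forall n, `|x n.+1 - x n| <= M * rho ^+ n) ->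
  exists l, x n @[n --> \oo] --> l /\ forall n, `|l - x n| <= M * rho ^+ n / (1 - rho).
Proof.
move=> r0 r1 M0 xM.
have r1' : 0 < 1 - rho by rewrite subr_gt0.
have dist n k : `|x (n + k)%N - x n| <= M * rho ^+ n / (1 - rho).
  have : `|x (n + k)%N - x n| <= M * rho ^+ n * (1 - rho ^+ k) / (1 - rho).
    elim: k => [|k IH]; first by rewrite addn0 subrr normr0 expr0 subrr mulr0 mul0r.
    have -> : x (n + k.+1)%N - x n = (x (n + k).+1 - x (n + k)%N) + (x (n + k)%N - x n).
      by rewrite addnS; ring.
    apply: le_trans (ler_normD _ _) _; apply: le_trans (lerD (xM _) IH) _.
    rewrite le_eqVlt; apply/orP; left; apply/eqP; rewrite exprD exprS; field.
    by rewrite gt_eqF.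
  move=> /le_trans; apply; rewrite ler_pM2r ?invr_gt0// ler_piMr//.
    by rewrite mulr_ge0// exprn_ge0// ltW.
  by rewrite lerBlDr lerDl exprn_ge0// ltW.
have xcvg : cvgn x.
  rewrite (_ : x = (fun n => x 0%N + series (fun k => x k.+1 - x k) n)); last first.
    apply/funext => n; rewrite /series /= (telescope_sumr x)//; ring.
  apply: is_cvgD; first exact: is_cvg_cst.
  apply: normed_cvg.
  apply: (@series_le_cvg _ _ (geometric M rho)) => //.
  - by move=> n /=.
  - by move=> n /=; rewrite mulr_ge0// exprn_ge0// ltW.
  - by apply: is_cvg_geometric_series; rewrite gtr0_norm.
have [l xl] := (cvg_ex _).1 xcvg.
exists l; split => // n.
have H : `|x (k + n)%N - x n| @[k --> \oo] --> `|l - x n|.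
  apply: cvg_norm; apply: cvgB; last exact: cvg_cst.
  by rewrite cvg_shiftn.
rewrite -(cvg_lim _ H)//; apply: limr_le; first exact: cvgP H.
by apply: nearW => k; rewrite addnC; exact: dist.
Qed.

(** Every single term of the series is at most [W], so the increments are at most the [q]-th root of
    [W] times [rho ^+ n], and a geometric series bounds the tail. *)
Lemma chain_pointwise (x : nat -> R) (W rho : R) q : (0 < q)%N ->
  0 < rho -> rho < 1 ->
  (\sum_(0 <= n <oo) ((rho^-1 ^+ n) ^+ q * `|x n.+1 - x n| ^+ q)%:E <= W%:E)%E ->
  exists l, x n @[n --> \oo] --> l /\
    forall n, `|l - x n| ^+ q <= (rho ^+ n) ^+ q * ((1 - rho)^-1 ^+ q * W).
Proof.
move=> q0 r0 r1 sumW.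
have r1' : 0 < 1 - rho by rewrite subr_gt0.
have t0 n : 0 <= (rho^-1 ^+ n) ^+ q * `|x n.+1 - x n| ^+ q.
  by rewrite mulr_ge0// ?exprn_ge0// invr_ge0 ltW.
have termW n : (rho^-1 ^+ n) ^+ q * `|x n.+1 - x n| ^+ q <= W.
  rewrite -lee_fin; apply: le_trans sumW.
  apply: le_trans (nneseries_lim_ge n.+1 _); last by move=> k _; rewrite lee_fin.
  rewrite big_nat_recr//= leeDr// sume_ge0// => k _; by rewrite lee_fin.
have W0 : 0 <= W by exact: le_trans (termW 0%N).
pose M := W `^ (q%:R^-1).
have M0 : 0 <= M by exact: powR_ge0.
have qn0 : (q%:R : R) != 0 by rewrite pnatr_eq0 -lt0n.
have Mq : M ^+ q = W by rewrite -powR_mulrn// -powRrM mulVf// powRr1.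
have xM n : `|x n.+1 - x n| <= M * rho ^+ n.
  rewrite -(ler_pXn2r q0) ?nnegrE ?mulr_ge0 ?exprn_ge0 ?(ltW r0)//.
  rewrite exprMn Mq mulrC -ler_pdivrMl ?exprn_gt0//.
  by apply: le_trans (termW n); rewrite !exprVn.
have [l [xl lx]] := cvg_geometric_increments r0 r1 M0 xM.
exists l; split => // n.
apply: le_trans (_ : (M * rho ^+ n / (1 - rho)) ^+ q <= _).
  rewrite lerXn2r ?nnegrE//.
  by rewrite divr_ge0 ?mulr_ge0 ?exprn_ge0 ?(ltW r0) ?(ltW r1').
by rewrite !exprMn Mq le_eqVlt; apply/orP; left; apply/eqP; ring.
Qed.

Lemma exprn_normD_le (a b : R) q : `|a + b| ^+ q <= 2 ^+ q * (`|a| ^+ q + `|b| ^+ q).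
Proof.
have m0 : 0 <= Num.max `|a| `|b| by rewrite le_max normr_ge0.
apply: (@le_trans _ _ ((2 * Num.max `|a| `|b|) ^+ q)).
  rewrite lerXn2r ?nnegrE ?mulr_ge0//; apply: le_trans (ler_normD _ _) _.
  by rewrite mulr_natl mulr2n lerD// le_max lexx ?orbT.
rewrite exprMn ler_wpM2l ?exprn_ge0//.
by case: (leP `|a| `|b|) => _; rewrite ?lerDl ?lerDr exprn_ge0.
Qed.

Lemma exprn_normD3_le (a b c : R) q :
  `|a + b + c| ^+ q <= 4 ^+ q * (`|a| ^+ q + `|b| ^+ q + `|c| ^+ q).
Proof.
apply: le_trans (exprn_normD_le _ _ _) _.
have -> : 4 ^+ q = 2 ^+ q * 2 ^+ q :> R by rewrite -exprMn; congr (_ ^+ _); ring.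
rewrite -mulrA ler_wpM2l ?exprn_ge0// [leRHS]mulrDr lerD ?exprn_normD_le//.
by rewrite ler_peMl ?exprn_ge0// exprn_ege1// ler1n.
Qed.

End ChainPointwise.

(** * Chaining in L^q over dyadic levels *)

Section Chaining.
Context {d : measure_display} {X : measurableType d} {R : realType}.
Variable mu : {measure set X -> \bar R}.
Variables (T rho : R) (q : nat).
Hypotheses (T0 : 0 < T) (q0 : (0 < q)%N) (r0 : 0 < rho) (r1 : rho < 1).

Section Field.
Variable Y : nat -> nat -> X -> R.
Hypothesis mY : forall n i, measurable_fun setT (Y n i).

(** The [q]-th power of the norm, without the root, so that sums over levels and expectations
    commute with it. *)
Definition Lq (f : X -> R) : \bar R := (\int[mu]_z (`|f z| ^+ q)%:E)%E.

Definition time_variation n : \bar R := (\sum_(i < 2 ^ n) Lq (Y n i.+1 \- Y n i)%R)%E.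

(** Index [2 * i] at level [n.+1] stands for the same time as [i] at level [n]. There are
    [2 ^ n + 1] grid points because the final time has index [2 ^ n]. *)
Definition level_variation n : \bar R :=
  (\sum_(i < (2 ^ n).+1) Lq (Y n.+1 (2 * i)%N \- Y n i)%R)%E.

(** Finite energy forces the variations at level [n] to be of order [rho ^+ n] in norm; for
    [rho = 2 ^ (- alpha)] this is Hölder regularity of exponent [alpha] at mesh [T / 2 ^+ n]. *)
Definition chain_energy : \bar R :=
  (\sum_(0 <= n <oo) (((rho^-1 ^+ n) ^+ q)%:E * (time_variation n + level_variation n)))%E.

Definition chain t n : X -> R := Y n (dyadic_index T n t).

(* A limsup, so that the limit is measurable and total; it is a true limit
   almost everywhere when the energy is finite. *)
Definition chain_limit t (z : X) : R := fine (limn_esup (fun n => (chain t n z)%:E)).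

Lemma Lq_ge0 f : (0 <= Lq f)%E.
Proof. by apply: integral_ge0 => z _; rewrite lee_fin exprn_ge0. Qed.

Lemma time_variation_ge0 n : (0 <= time_variation n)%E.
Proof. by apply: sume_ge0 => i _; exact: Lq_ge0. Qed.

Lemma level_variation_ge0 n : (0 <= level_variation n)%E.
Proof. by apply: sume_ge0 => i _; exact: Lq_ge0. Qed.

Lemma weight_ge0 n : 0 <= (rho^-1 ^+ n) ^+ q.
Proof. by rewrite !exprn_ge0// invr_ge0 ltW. Qed.

Lemma weighted_variation_ge0 n :
  (0 <= ((rho^-1 ^+ n) ^+ q)%:E * (time_variation n + level_variation n))%E.
Proof.
by rewrite mule_ge0 ?lee_fin ?weight_ge0// adde_ge0 ?time_variation_ge0 ?level_variation_ge0.
Qed.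

Lemma chain_energy_ge0 : (0 <= chain_energy)%E.
Proof. by apply: nneseries_ge0 => n _ _; exact: weighted_variation_ge0. Qed.

Lemma weighted_variation_le N :
  (\sum_(0 <= n < N) (((rho^-1 ^+ n) ^+ q)%:E * (time_variation n + level_variation n))
    <= chain_energy)%E.
Proof. by apply: nneseries_lim_ge => n _ _; exact: weighted_variation_ge0. Qed.

Lemma measurable_Lq_integrand (f : X -> R) : measurable_fun setT f ->
  measurable_fun setT (fun z => (`|f z| ^+ q)%:E).
Proof.
by move=> mf; apply/measurable_EFinP/measurable_funX; exact: measurableT_comp.
Qed.

Lemma Lq_le (f g h : X -> R) (c1 c2 : R) : measurable_fun setT f ->
  measurable_fun setT g -> measurable_fun setT h -> 0 <= c1 -> 0 <= c2 ->
  (forall z, `|f z| ^+ q <= c1 * `|g z| ^+ q + c2 * `|h z| ^+ q) ->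
  (Lq f <= c1%:E * Lq g + c2%:E * Lq h)%E.
Proof.
move=> /measurable_Lq_integrand mf /measurable_Lq_integrand mg /measurable_Lq_integrand mh c10 c20 fgh.
rewrite /Lq -!ge0_integralZT//; try by move=> z; rewrite lee_fin exprn_ge0.
rewrite -ge0_integralDT; first last.
- by move=> z; rewrite -EFinM lee_fin mulr_ge0// exprn_ge0.
- by move=> z; rewrite -EFinM lee_fin mulr_ge0// exprn_ge0.
- exact: emeasurable_funM.
- exact: emeasurable_funM.
apply: ge0_le_integralT => //.
by apply: emeasurable_funD; exact: emeasurable_funM.
Qed.

Lemma Lq_sum2_le (f g : X -> R) : measurable_fun setT f -> measurable_fun setT g ->
  (Lq (f \+ g)%R <= (2 ^+ q)%:E * Lq f + (2 ^+ q)%:E * Lq g)%E.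
Proof.
move=> mf mg; apply: Lq_le => //; try exact: exprn_ge0; first exact: measurable_funD.
by move=> z; rewrite -mulrDr; exact: exprn_normD_le.
Qed.

Lemma Lq0 : Lq (cst 0) = 0%E.
Proof.
rewrite /Lq; under eq_integral do rewrite normr0 expr0n gtn_eqF//.
exact: integral0.
Qed.

(** Passing to the next level refines the field at an unchanged grid time and then moves by at most
    one increment of the finer grid. *)
Lemma chain_step_le t n : 0 <= t -> t <= T ->
  (Lq (chain t n.+1 \- chain t n)%R <=
   (2 ^+ q)%:E * (time_variation n.+1 + level_variation n))%E.
Proof.
move=> t0 tT.
have iN := dyadic_index_le T0 n t0 tT; have iN1 := dyadic_index_le T0 n.+1 t0 tT.
pose i := dyadic_index T n t.
have -> : chain t n.+1 \- chain t n =
    (chain t n.+1 \- Y n.+1 (2 * i)%N) \+ (Y n.+1 (2 * i)%N \- Y n i).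
  by apply/funext => z /=; rewrite /chain -/i; ring.
apply: le_trans (Lq_sum2_le _ _) _; try by apply: measurable_funB; exact: mY.
rewrite (ge0_muleDr _ (time_variation_ge0 _) (level_variation_ge0 _)).
apply: leeD; (apply: lee_wpmul2l; first by rewrite lee_fin exprn_ge0).
  rewrite /chain; case: (dyadic_indexS T0 n t0) => iE; rewrite iE -/i.
    rewrite (_ : _ \- _ = cst 0) ?Lq0 ?time_variation_ge0//.
    by apply/funext => z /=; rewrite subrr.
  have i2 : (2 * i < 2 ^ n.+1)%N by rewrite -iE.
  rewrite /time_variation (bigD1 (Ordinal i2))//= leeDl// sume_ge0// => j _.
  exact: Lq_ge0.
rewrite /level_variation (bigD1 (Ordinal (iN : i < (2 ^ n).+1)%N))//= leeDl//.
by apply: sume_ge0 => j _; exact: Lq_ge0.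
Qed.

Definition chain_weight t (z : X) : \bar R :=
  (\sum_(0 <= n <oo) ((rho^-1 ^+ n) ^+ q * `|chain t n.+1 z - chain t n z| ^+ q)%:E)%E.

Lemma measurable_chain_weight t : measurable_fun setT (chain_weight t).
Proof.
apply: ge0_emeasurable_sum => [n z _ _|n _].
  by rewrite lee_fin mulr_ge0 ?weight_ge0 ?exprn_ge0.
apply/measurable_EFinP/measurable_funM => //; apply: measurable_funX.
by apply: measurableT_comp => //; apply: measurable_funB; exact: mY.
Qed.

Lemma chain_weight_ge0 t z : (0 <= chain_weight t z)%E.
Proof.
by apply: nneseries_ge0 => n _ _; rewrite lee_fin mulr_ge0 ?weight_ge0 ?exprn_ge0.
Qed.

(** The time variation at level [n.+1] is charged to the next term of the energy, which is allowed
    because the weights increase with the level. The energy is therefore counted twice, whence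
    [2 ^+ q.+1]. *)
Lemma integral_chain_weight_le t : 0 <= t -> t <= T ->
  (\int[mu]_z chain_weight t z <= (2 ^+ q.+1)%:E * chain_energy)%E.
Proof.
move=> t0 tT.
have mdiff n : measurable_fun setT (fun z => (`|chain t n.+1 z - chain t n z| ^+ q)%:E).
  by apply: measurable_Lq_integrand; apply: measurable_funB; exact: mY.
rewrite integral_nneseries//; last first.
- by move=> n z _; rewrite lee_fin mulr_ge0 ?weight_ge0 ?exprn_ge0.
- move=> n; under eq_fun do rewrite EFinM; exact: emeasurable_funM.
apply: lime_le.
  apply: is_cvg_nneseries => n _ _; apply: integral_ge0 => z _.
  by rewrite lee_fin mulr_ge0 ?weight_ge0 ?exprn_ge0.
apply: nearW => N.
pose w n : \bar R := ((rho^-1 ^+ n) ^+ q)%:E.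
have w0 n : (0 <= w n)%E by rewrite lee_fin weight_ge0.
have wS n : (w n <= w n.+1)%E.
  rewrite lee_fin lerXn2r ?nnegrE ?exprn_ge0 ?invr_ge0 ?(ltW r0)//.
  by rewrite exprS ler_peMl ?exprn_ge0 ?invr_ge0 ?(ltW r0)// invf_ge1// ltW.
have tv0 := time_variation_ge0; have lv0 := level_variation_ge0.
apply: (@le_trans _ _ (\sum_(0 <= n < N) ((2 ^+ q)%:E *
    (w n.+1 * (time_variation n.+1 + level_variation n.+1)) +
    (2 ^+ q)%:E * (w n * (time_variation n + level_variation n))))%E).
  apply: lee_sum => n _.
  under eq_integral do rewrite EFinM.
  rewrite ge0_integralZT ?weight_ge0//.
  apply: (@le_trans _ _ (w n * ((2 ^+ q)%:E * (time_variation n.+1 + level_variation n)))%E).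
    apply: lee_wpmul2l; first exact: (w0 n).
    exact: (chain_step_le n t0 tT).
  rewrite muleCA -ge0_muleDr ?mule_ge0 ?adde_ge0//.
  apply: lee_wpmul2l; first by rewrite lee_fin exprn_ge0.
  rewrite !ge0_muleDr//; apply: leeD.
    apply: (@le_trans _ _ (w n.+1 * time_variation n.+1)%E).
      exact: lee_wpmul2r.
    by rewrite leeDl// mule_ge0.
  by rewrite leeDr// mule_ge0.
rewrite big_split /= -!ge0_sume_distrr//; last 2 first.
- by move=> n _; rewrite mule_ge0// adde_ge0.
- by move=> n _; rewrite mule_ge0// adde_ge0.
have -> : ((2 ^+ q.+1)%:E * chain_energy = (2 ^+ q)%:E * chain_energy + (2 ^+ q)%:E * chain_energy)%E.
  rewrite -ge0_muleDl ?lee_fin ?exprn_ge0// -EFinD exprS; congr (_%:E * _)%E; ring.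
apply: leeD; (apply: lee_wpmul2l; first by rewrite lee_fin exprn_ge0).
  apply: le_trans (weighted_variation_le N.+1).
  by rewrite [leRHS]big_nat_recl//= leeDr//; exact: weighted_variation_ge0.
exact: weighted_variation_le.
Qed.

Hypothesis energy_fin : (chain_energy < +oo)%E.

Lemma chain_weight_fin t : 0 <= t -> t <= T ->
  {ae mu, forall z, chain_weight t z \is a fin_num}.
Proof.
move=> t0 tT.
have : mu.-integrable setT (chain_weight t).
  apply/integrableP; split; first exact: measurable_chain_weight.
  under eq_integral do rewrite gee0_abs ?chain_weight_ge0//.
  apply: le_lt_trans (integral_chain_weight_le t0 tT) _.
  by rewrite lte_mul_pinfty// lee_fin exprn_ge0.
by move=> /(integrable_ae measurableT); apply: filterS => z; apply.
Qed.

Lemma chain_limit_pointwise t z : chain_weight t z \is a fin_num ->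
  chain t n z @[n --> \oo] --> chain_limit t z /\
  forall n, ((`|chain_limit t z - chain t n z| ^+ q)%:E <=
    ((rho ^+ n) ^+ q * (1 - rho)^-1 ^+ q)%:E * chain_weight t z)%E.
Proof.
move=> fin; have := @chain_pointwise R (chain t ^~ z) (fine (chain_weight t z)) rho q q0 r0 r1.
rewrite fineK// => /(_ (lexx _))[l [xl lx]].
have El : chain_limit t z = l.
  rewrite /chain_limit.
  have xl' : (chain t n z)%:E @[n --> \oo] --> l%:E by apply: cvg_EFin => //; exact: nearW.
  by have [_ ->] := cvg_limn_einf_sup xl'.
rewrite El; split => // n.
by rewrite -(fineK fin) -EFinM lee_fin -mulrA; exact: lx.
Qed.

Lemma chain_limit_cvg t : 0 <= t -> t <= T ->
  {ae mu, forall z, chain t n z @[n --> \oo] --> chain_limit t z}.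
Proof.
move=> t0 tT; apply: filterS (chain_weight_fin t0 tT) => z.
by move=> /chain_limit_pointwise[].
Qed.

Lemma measurable_chain_limit t : measurable_fun setT (chain_limit t).
Proof.
apply: (measurableT_comp (fine_measurable measurableT)).
apply: measurable_fun_limn_esup => n; apply/measurable_EFinP; exact: mY.
Qed.

Definition chain_cst : R := (1 - rho)^-1 ^+ q * 2 ^+ q.+1.

Lemma chain_cst_ge0 : 0 <= chain_cst.
Proof. by rewrite mulr_ge0 ?exprn_ge0// invr_ge0 subr_ge0 ltW. Qed.

Lemma chain_limit_rate t n : 0 <= t -> t <= T ->
  (Lq (chain_limit t \- chain t n)%R <=
   ((rho ^+ n) ^+ q * chain_cst)%:E * chain_energy)%E.
Proof.
move=> t0 tT.
have k0 : 0 <= (rho ^+ n) ^+ q * (1 - rho)^-1 ^+ q.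
  by rewrite mulr_ge0 ?exprn_ge0// ?invr_ge0 ?subr_ge0 ltW.
apply: (@le_trans _ _ (\int[mu]_z (((rho ^+ n) ^+ q * (1 - rho)^-1 ^+ q)%:E * chain_weight t z))%E).
  apply: ae_ge0_le_integral => //.
  - apply: measurable_Lq_integrand; apply: measurable_funB; last exact: mY.
    exact: measurable_chain_limit.
  - by move=> z _; rewrite mule_ge0 ?chain_weight_ge0// lee_fin.
  - by apply: emeasurable_funM => //; exact: measurable_chain_weight.
  - apply: filterS (chain_weight_fin t0 tT) => z fin _.
    exact: (chain_limit_pointwise fin).2.
rewrite ge0_integralZT//; last 2 first.
- exact: measurable_chain_weight.
- exact: chain_weight_ge0.
rewrite (_ : ((rho ^+ n) ^+ q * chain_cst)%:E * chain_energy =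
  ((rho ^+ n) ^+ q * (1 - rho)^-1 ^+ q)%:E * ((2 ^+ q.+1)%:E * chain_energy))%E; last first.
  by rewrite muleA -EFinM mulrA.
apply: lee_wpmul2l; first by rewrite lee_fin.
exact: integral_chain_weight_le.
Qed.

Lemma chain_close_le s t n : 0 <= s -> s <= t -> t <= T -> t - s <= T / 2 ^+ n ->
  (Lq (chain t n \- chain s n)%R <= ((rho ^+ n) ^+ q)%:E * chain_energy)%E.
Proof.
move=> s0 st tT ts; have t0 := le_trans s0 st.
have rn0 : 0 < (rho ^+ n) ^+ q by rewrite !exprn_gt0.
case: (dyadic_index_close T0 s0 st ts) => iE; rewrite /chain iE.
  rewrite (_ : _ \- _ = cst 0) ?Lq0 ?mule_ge0 ?chain_energy_ge0 ?lee_fin ?ltW//.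
  by apply/funext => z /=; rewrite subrr.
have iN := dyadic_index_le T0 n t0 tT; rewrite iE in iN.
apply: (@le_trans _ _ (time_variation n)).
  rewrite /time_variation (bigD1 (Ordinal iN))//= leeDl// sume_ge0// => j _.
  exact: Lq_ge0.
rewrite -[leLHS]mul1e -(_ : ((rho ^+ n) ^+ q)%:E * ((rho^-1 ^+ n) ^+ q)%:E = 1)%E; last first.
  by rewrite -EFinM -!exprMn divff ?expr1n// gt_eqF.
rewrite -muleA; apply: lee_wpmul2l; first by rewrite lee_fin ltW.
apply: le_trans (weighted_variation_le n.+1).
rewrite big_nat_recr//=; apply: (@le_trans _ _ (((rho^-1 ^+ n) ^+ q)%:E * (time_variation n + level_variation n))%E).
  by apply: lee_wpmul2l; rewrite ?lee_fin ?weight_ge0// leeDl// level_variation_ge0.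
by rewrite leeDr// sume_ge0// => k _; exact: weighted_variation_ge0.
Qed.

Definition holder_cst : R := 4 ^+ q * (chain_cst + 1 + chain_cst).

Lemma holder_cst_ge0 : 0 <= holder_cst.
Proof. by rewrite mulr_ge0 ?exprn_ge0// !addr_ge0 ?chain_cst_ge0. Qed.

(** Level [n] serves as intermediary: two approximation errors and one comparison of the chains at
    [s] and [t], each of order [rho ^+ n] in norm. *)
Lemma chain_limit_holder s t n : 0 <= s -> s <= t -> t <= T -> t - s <= T / 2 ^+ n ->
  (Lq (chain_limit t \- chain_limit s)%R <= ((rho ^+ n) ^+ q * holder_cst)%:E * chain_energy)%E.
Proof.
move=> s0 st tT ts; have t0 := le_trans s0 st; have sT := le_trans st tT.
have mL u : measurable_fun setT (chain_limit u) := measurable_chain_limit u.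
have E0 := chain_energy_ge0.
have H1 := chain_limit_rate n t0 tT; have H3 := chain_limit_rate n s0 sT.
have H2 := chain_close_le s0 st tT ts.
apply: (@le_trans _ _ ((4 ^+ q)%:E * (Lq (chain_limit t \- chain t n)%R + Lq (chain t n \- chain s n)%R + Lq (chain_limit s \- chain s n)%R))%E).
  have mA : measurable_fun setT (fun z => (`|(chain_limit t \- chain t n) z| ^+ q)%:E).
    by apply: measurable_Lq_integrand; apply: measurable_funB => //; exact: mY.
  have mB : measurable_fun setT (fun z => (`|(chain t n \- chain s n) z| ^+ q)%:E).
    by apply: measurable_Lq_integrand; apply: measurable_funB => //; exact: mY.
  have mC : measurable_fun setT (fun z => (`|(chain_limit s \- chain s n) z| ^+ q)%:E).
    by apply: measurable_Lq_integrand; apply: measurable_funB => //; exact: mY.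
  have p0 (f : X -> R) z : (0 <= (`|f z| ^+ q)%:E)%E by rewrite lee_fin exprn_ge0.
  rewrite /Lq -!ge0_integralDT//; last 2 first.
  - exact: emeasurable_funD.
  - by move=> z; rewrite adde_ge0.
  rewrite -ge0_integralZT ?exprn_ge0//; last 2 first.
  - by apply: emeasurable_funD => //; exact: emeasurable_funD.
  - by move=> z; rewrite !adde_ge0.
  apply: ge0_le_integralT => //.
  - by apply: measurable_Lq_integrand; exact: measurable_funB.
  - by apply: emeasurable_funM => //; apply: emeasurable_funD => //; exact: emeasurable_funD.
  - move=> z; rewrite -!EFinD -EFinM lee_fin /=.
    have -> : chain_limit t z - chain_limit s z = (chain_limit t z - chain t n z) +
       (chain t n z - chain s n z) + (- (chain_limit s z - chain s n z)) by ring.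
    by apply: le_trans (exprn_normD3_le _ _ _ _) _; rewrite normrN.
have -> : (((rho ^+ n) ^+ q * holder_cst)%:E * chain_energy =
   (4 ^+ q)%:E * (((rho ^+ n) ^+ q * chain_cst)%:E * chain_energy + ((rho ^+ n) ^+ q)%:E * chain_energy + ((rho ^+ n) ^+ q * chain_cst)%:E * chain_energy) :> \bar R)%E.
  have b0 : 0 <= (rho ^+ n) ^+ q by rewrite !exprn_ge0// ltW.
  have c0 : 0 <= (rho ^+ n) ^+ q * chain_cst by rewrite mulr_ge0// chain_cst_ge0.
  rewrite -!ge0_muleDl ?adde_ge0 ?lee_fin//.
  rewrite muleA -!EFinD -EFinM; congr (_%:E * _)%E.
  by rewrite /holder_cst; ring.
apply: lee_wpmul2l; first by rewrite lee_fin exprn_ge0.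
by rewrite !leeD.
Qed.

(** Comparison with level 0, where times in [[0, T]] only have the indices 0 and 1. *)
Lemma chain_limit_bound t : 0 <= t -> t <= T ->
  (Lq (chain_limit t) <= (2 ^+ q)%:E * (chain_cst%:E * chain_energy + (Lq (Y 0 0) + Lq (Y 0 1))))%E.
Proof.
move=> t0 tT.
have -> : chain_limit t = (chain_limit t \- chain t 0) \+ chain t 0.
  by apply/funext => z /=; ring.
apply: le_trans (Lq_sum2_le _ _) _; [|exact: mY|].
  by apply: measurable_funB; [exact: measurable_chain_limit|exact: mY].
rewrite -ge0_muleDr ?Lq_ge0//; apply: lee_wpmul2l; first by rewrite lee_fin exprn_ge0.
apply: leeD.
  by have := chain_limit_rate 0 t0 tT; rewrite expr0 expr1n mul1r.
by rewrite /chain; case: (dyadic_index0 T0 t0 tT) => ->; rewrite ?leeDl ?leeDr ?Lq_ge0.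
Qed.

End Field.

End Chaining.

(** * Tonelli's theorem against a finite measure *)

Section FiniteTonelli.
Local Open Scope ereal_scope.
Context {d d' : measure_display} {R : realType} {Omega : measurableType d}
  {X : measurableType d'}.
Variables (P : probability Omega R) (mu : {measure set X -> \bar R}).
Hypothesis mu_fin : mu setT < +oo.
Variable f : Omega * X -> \bar R.
Hypotheses (mf : measurable_fun setT f) (f0 : forall x, 0 <= f x).

(** Restricting to the whole space changes no value of [mu] but records its finiteness in the
    structure on which the product theorems act. *)
Let m : {finite_measure set X -> \bar R} := mfrestr measurableT mu_fin.

Let integral_m (g : X -> \bar R) : \int[m]_z g z = \int[mu]_z g z.
Proof.
apply: eq_measure_integral => A mA _.
by transitivity (mu (A `&` setT)); first [by [] | by rewrite setIT].
Qed.

Lemma measurable_integral_section : measurable_fun setT (fun w => \int[mu]_z f (w, z)).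
Proof.
under eq_fun => w do rewrite -(integral_m (fun z => f (w, z))).
exact: (measurable_fun_fubini_tonelli_F (m2 := m) f mf f0).
Qed.

Lemma measurable_expectation_section : measurable_fun setT (fun z => \int[P]_w f (w, z)).
Proof. exact: (measurable_fun_fubini_tonelli_G (m1 := P) f mf f0). Qed.

Lemma tonelli_finite : \int[P]_w \int[mu]_z f (w, z) = \int[mu]_z \int[P]_w f (w, z).
Proof.
transitivity (\int[P]_w \int[m]_z f (w, z)).
  by apply: eq_integral => w _; rewrite integral_m.
rewrite -[RHS]integral_m; exact: (fubini_tonelli (m1 := P) (m2 := m) f mf f0).
Qed.

End FiniteTonelli.

(** * Integration over the cell *)

Section TorusMeasure.
Context {R : realType}.
Variable L : R.
Hypothesis L0 : 0 < L.

Local Notation leb := (@lebesgue_measure R).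
Local Notation I := (`[- L, L[%classic : set R).

Lemma lebesgue_cell_side : leb I = (2 * L)%:E.
Proof.
rewrite lebesgue_measure_itv /= lte_fin; have -> : - L < L by rewrite -subr_gt0 opprK addr_gt0.
by rewrite -EFinB; congr EFin; ring.
Qed.

Lemma dxdy_setT : dxdy L setT = ((2 * L) ^+ 2)%:E.
Proof.
change ((leb \x leb)%E (setT `&` cell L) = ((2 * L) ^+ 2)%:E).
rewrite setTI /cell product_measure1E; [|exact: measurable_itv|exact: measurable_itv].
transitivity ((2 * L)%:E * (2 * L)%:E)%E; last by rewrite -EFinM expr2.
by congr (_ * _)%E; exact: lebesgue_cell_side.
Qed.

Lemma nu2_setT : nu2 L setT = 1%E.
Proof.
change (((2 * L)^-1 ^+ 2)%:E * dxdy L setT = 1)%E.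
rewrite dxdy_setT -EFinM -exprMn mulVf ?expr1n//.
by rewrite mulf_neq0 ?gt_eqF.
Qed.

Lemma integral_nu2 (f : plane R -> \bar R) : measurable_fun setT f ->
  (forall z, (0 <= f z)%E) ->
  (\int[nu2 L]_z f z = ((2 * L)^-1 ^+ 2)%:E * \int[dxdy L]_z f z)%E.
Proof. by move=> mf f0; rewrite /nu2 ge0_integral_mscale. Qed.

Lemma integral_dxdy_nu2 (f : plane R -> \bar R) : measurable_fun setT f ->
  (forall z, (0 <= f z)%E) ->
  (\int[dxdy L]_z f z = ((2 * L) ^+ 2)%:E * \int[nu2 L]_z f z)%E.
Proof.
move=> mf f0; rewrite integral_nu2// muleA -EFinM -exprMn divff ?expr1n ?mul1e//.
by rewrite mulf_neq0 ?gt_eqF.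
Qed.

Let cell_weight (f : plane R -> \bar R) : plane R -> \bar R :=
  fun z => ((\1_(cell L) z : R)%:E * f z)%E.

Let measurable_cell_weight f : measurable_fun setT f -> measurable_fun setT (cell_weight f).
Proof.
move=> mf; apply: emeasurable_funM => //.
by apply/measurable_EFinP; apply: measurable_indic; exact: measurable_cell.
Qed.

Let cell_weight_ge0 f : (forall z, (0 <= f z)%E) -> forall z, (0 <= cell_weight f z)%E.
Proof. by move=> f0 z; rewrite mule_ge0// lee_fin. Qed.

Let integral_dxdy (f : plane R -> \bar R) : measurable_fun setT f ->
  (forall z, (0 <= f z)%E) ->
  (\int[dxdy L]_z f z = \int[leb \x leb]_z cell_weight f z)%E.
Proof.
move=> mf f0.
rewrite -(@integral_transfer R _ _ _ _ (leb \x leb)%E (dxdy L) (\1_(cell L)) id _ _ _ _ f mf f0)//.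
- by apply: measurable_indic; exact: measurable_cell.
- move=> A mA; rewrite /dxdy /mrestr /=.
  transitivity (\int[leb \x leb]_z (\1_(A `&` cell L) z)%:E)%E.
    apply: eq_integral => z _; rewrite -EFinM; congr EFin.
    by rewrite !indicE in_setI mulrC -natrM mulnb.
  rewrite integral_indic ?setIT//; apply: measurableI => //; exact: measurable_cell.
Qed.

Let cell_weightE f (x y : R) :
  cell_weight f (x, y) = ((\1_I x : R)%:E * ((\1_I y : R)%:E * f (x, y)))%E.
Proof.
rewrite /cell_weight /cell muleA -EFinM; congr (_%:E * _)%E.
by rewrite !indicE in_setX /= -natrM mulnb.
Qed.

Lemma integral_indic_itv (g : R -> \bar R) :
  (\int[leb]_x ((\1_I x : R)%:E * g x) = \int[leb]_(x in I) g x)%E.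
Proof.
by rewrite -[RHS]integral_mul_indic; apply: eq_integral => x _; rewrite muleC.
Qed.

Lemma integral_dxdy_xy (f : plane R -> \bar R) : measurable_fun setT f ->
  (forall z, (0 <= f z)%E) ->
  (\int[dxdy L]_z f z = \int[leb]_(x in I) \int[leb]_(y in I) f (x, y))%E.
Proof.
move=> mf f0; rewrite integral_dxdy// fubini_tonelli1; last 2 first.
- exact: measurable_cell_weight.
- exact: cell_weight_ge0.
rewrite -integral_indic_itv; apply: eq_integral => x _.
rewrite /fubini_F; under eq_integral do rewrite cell_weightE.
rewrite ge0_integralZT//; last 2 first.
- apply: emeasurable_funM; first by apply/measurable_EFinP; exact: measurable_indic.
  exact: measurableT_comp.
- by move=> y; rewrite mule_ge0// lee_fin.
by rewrite integral_indic_itv.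
Qed.

Lemma integral_dxdy_yx (f : plane R -> \bar R) : measurable_fun setT f ->
  (forall z, (0 <= f z)%E) ->
  (\int[dxdy L]_z f z = \int[leb]_(y in I) \int[leb]_(x in I) f (x, y))%E.
Proof.
move=> mf f0; rewrite integral_dxdy// fubini_tonelli2; last 2 first.
- exact: measurable_cell_weight.
- exact: cell_weight_ge0.
rewrite -integral_indic_itv; apply: eq_integral => y _.
rewrite /fubini_G; under eq_integral do rewrite cell_weightE muleCA.
rewrite ge0_integralZT//; last 2 first.
- apply: emeasurable_funM; first by apply/measurable_EFinP; exact: measurable_indic.
  exact: measurableT_comp.
- by move=> x; rewrite mule_ge0// lee_fin.
by rewrite integral_indic_itv.
Qed.

End TorusMeasure.

(** * Integrals of trigonometric functions over the torus *)

Section Trigonometry.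
Context {R : realType}.

Lemma sin_int_pi (j : int) : sin (j%:~R * pi) = 0 :> R.
Proof.
have H n : sin (n%:R * pi) = 0 :> R.
  elim: n => [|n IH]; first by rewrite mul0r sin0.
  by rewrite -natr1 mulrDl mul1r sinD IH sinpi mul0r mulr0 addr0.
case: j => n; first exact: H.
by rewrite NegzE mulrNz mulNr sinN H oppr0.
Qed.

Lemma cos_int_2pi (j : int) : cos (j%:~R * (2 * pi)) = 1 :> R.
Proof.
have -> : j%:~R * (2 * pi) = j%:~R * pi + j%:~R * pi :> R by ring.
by rewrite cosD sin_int_pi mulr0 subr0 -expr2 cos2sin2 sin_int_pi expr0n subr0.
Qed.

Lemma sin_int_2pi (j : int) : sin (j%:~R * (2 * pi)) = 0 :> R.
Proof.
have -> : j%:~R * (2 * pi) = j%:~R * pi + j%:~R * pi :> R by ring.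
by rewrite sinD sin_int_pi mulr0 mul0r addr0.
Qed.

(** Adding 1 makes the integrand nonnegative, so that iterated integrals are available at once; the
    shift [b] absorbs the part of the phase that depends on the outer variable. *)
Lemma integral_1Dcos (L a b : R) : 0 < L -> a != 0 -> sin (a * L) = 0 ->
  (\int[lebesgue_measure]_(x in (`[(- L)%R, L[%classic : set R)) (1 + cos (a * x + b))%:E = (2 * L)%:E)%E.
Proof.
move=> L0 a0 saL.
have cf : continuous (fun x : R => 1 + cos (a * x + b)).
  move=> z; apply: differentiable_continuous; apply/derivable1_diffP.
  exact: ex_derive.
have cF : continuous (fun x : R => x + sin (a * x + b) / a).
  move=> z; apply: differentiable_continuous; apply/derivable1_diffP.
  exact: ex_derive.
have dF (z : R) : is_derive z 1 (fun x => x + sin (a * x + b) / a) (1 + cos (a * z + b)).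
  apply: is_derive_eq; rewrite /GRing.scale /=; field; exact: a0.
rewrite integral_itv_bndo_bndc; last first.
  by apply/measurable_EFinP; apply: measurable_funTS; exact: continuous_measurable_fun.
rewrite (@continuous_FTC2 R (fun x => 1 + cos (a * x + b)) (fun x => x + sin (a * x + b) / a)).
- rewrite -EFinB; congr EFin.
  by rewrite mulrN !sinD sinN cosN saL; field.
- by rewrite -subr_gt0 opprK addr_gt0.
- exact: continuous_subspaceT.
- split.
  + by move=> z _; exact: ex_derive.
  + exact/cvg_at_right_filter/cF.
  + exact/cvg_at_left_filter/cF.
- by move=> z _; rewrite derive1E; exact: derive_val.
Qed.

Variable L : R.
Hypothesis L0 : 0 < L.

Definition phase (k l : int) (z : R * R) : R := pi * (k%:~R * z.1 + l%:~R * z.2) / L.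

Lemma measurable_phase k l : measurable_fun setT (phase k l : plane R -> R).
Proof.
apply: measurable_funM => //; apply: measurable_funM => //.
by apply: measurable_funD; apply: measurable_funM.
Qed.

Lemma measurable_cos_phase k l c : measurable_fun setT (fun z : plane R => cos (phase k l z + c)).
Proof.
apply: (measurableT_comp (continuous_measurable_fun (@continuous_cos R))).
by apply: measurable_funD => //; exact: measurable_phase.
Qed.

Lemma integral_1Dcos_phase k l c : (k, l) != (0, 0) ->
  (\int[dxdy L]_z (1 + cos (phase k l z + c))%:E = ((2 * L) ^+ 2)%:E)%E.
Proof.
move=> kl.
have mf : measurable_fun setT (fun z : plane R => (1 + cos (phase k l z + c))%:E).
  by apply/measurable_EFinP; apply: measurable_funD => //; exact: measurable_cos_phase.
have f0 z : (0 <= (1 + cos (phase k l z + c))%:E)%E.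
  by rewrite lee_fin; have := cos_geN1 (phase k l z + c); lra.
have cst_int : (\int[lebesgue_measure]_(x in (`[(- L)%R, L[%classic : set R)) (2 * L)%:E = ((2 * L) ^+ 2)%:E)%E.
  rewrite integral_cst; last exact: measurable_itv.
  transitivity ((2 * L)%:E * (2 * L)%:E)%E; last by rewrite -EFinM expr2.
  by congr (_ * _)%E; exact: (lebesgue_cell_side L0).
have key (j : int) b : j != 0 ->
    (\int[lebesgue_measure]_(x in (`[(- L)%R, L[%classic : set R)) (1 + cos (pi * j%:~R / L * x + b))%:E = (2 * L)%:E)%E.
  move=> j0; apply: integral_1Dcos => //.
    apply: mulf_neq0; last by rewrite invr_neq0// gt_eqF.
    by apply: mulf_neq0; [rewrite gt_eqF// pi_gt0|rewrite intr_eq0].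
  by rewrite mulfVK ?gt_eqF// mulrC sin_int_pi.
have [k0|k0] := eqVneq k 0.
  have l0 : l != 0 by apply: contraNneq kl => ->; rewrite k0.
  rewrite integral_dxdy_xy// -[RHS]cst_int; apply: eq_integral => x _.
  rewrite -[RHS](key l c l0); apply: eq_integral => y _.
  by rewrite /phase /= k0; congr (1 + cos _)%:E; ring.
rewrite integral_dxdy_yx// -[RHS]cst_int; apply: eq_integral => y _.
rewrite -[RHS](key k (pi * l%:~R / L * y + c) k0); apply: eq_integral => x _.
by rewrite /phase /=; congr (1 + cos _)%:E; ring.
Qed.

Lemma dxdy_bounded_integrable (f : plane R -> R) (K : R) : measurable_fun setT f ->
  (forall z, `|f z| <= K) -> (dxdy L).-integrable setT (EFin \o f).
Proof.
move=> mf fK; apply: measurable_bounded_integrable => //.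
  by rewrite dxdy_setT ?ltry.
by exists K; split; [exact: num_real|move=> x Kx z _; exact: le_trans (fK z) (ltW Kx)].
Qed.

Lemma integral_cos_phase k l c : (k, l) != (0, 0) ->
  (\int[dxdy L]_z (cos (phase k l z + c))%:E = 0)%E.
Proof.
move=> kl.
have H := integral_1Dcos_phase c kl.
have mc := measurable_cos_phase k l c.
have ic : (dxdy L).-integrable setT (EFin \o (fun z => cos (phase k l z + c))).
  by apply: (@dxdy_bounded_integrable _ 1) => // z; rewrite ler_norml cos_geN1 cos_le1.
have i1 : (dxdy L).-integrable setT (EFin \o (fun=> 1)).
  by apply: (@dxdy_bounded_integrable _ 1) => // z; rewrite normr1.
have {}H : (\int[dxdy L]_z (1%:E + (cos (phase k l z + c))%:E) = ((2 * L) ^+ 2)%:E)%E.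
  by rewrite -H; apply: eq_integral => z _; rewrite -EFinD.
move: H; rewrite integralD//=.
have -> : (\int[dxdy L]_z 1%:E = ((2 * L) ^+ 2)%:E)%E.
  by rewrite integral_cst// mul1e; exact: dxdy_setT.
have fin := integrable_fin_num measurableT ic.
rewrite -(fineK fin) -EFinD => -[] /eqP.
by rewrite -[X in _ == X]addr0 => /eqP /addrI ->.
Qed.

Lemma integral_sin_phase k l : (k, l) != (0, 0) ->
  (\int[dxdy L]_z (sin (phase k l z))%:E = 0)%E.
Proof.
move=> kl; rewrite -(integral_cos_phase (- (pi / 2)) kl).
by apply: eq_integral => z _; rewrite -[in LHS](subrK (pi / 2) (phase k l z)) sinDpihalf.
Qed.

End Trigonometry.

(** * Continuous functions on the plane *)

Section PlaneContinuous.
Context {R : realType}.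

(* A continuous function is the pointwise limit of the functions obtained by
   freezing the first variable at the points of a grid of mesh 1/(n+1). *)
Lemma continuous_plane_measurable (f : R * R -> R) : continuous f ->
  measurable_fun setT (f : plane R -> R).
Proof.
move=> cf.
pose g n (x : R) : R := (Num.floor (x * n.+1%:R))%:~R / n.+1%:R.
have gcvg x : g n x @[n --> \oo] --> x.
  apply/cvgrPdist_le => e e0.
  have : \forall n \near \oo, (n.+1%:R^-1 : R) < e.
    by have := near_infty_natSinv_lt (PosNum e0).
  apply: filterS => n ne.
  have n0 : 0 < n.+1%:R :> R by rewrite ltr0n.
  have /andP[h1 h2] := floor_itv (x * n.+1%:R).
  have -> : x - g n x = (x * n.+1%:R - (Num.floor (x * n.+1%:R))%:~R) / n.+1%:R.
    by rewrite /g mulrBl mulfK ?gt_eqF.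
  rewrite ger0_norm; last by rewrite divr_ge0 ?subr_ge0// ltW.
  apply: le_trans (ltW ne); rewrite -[leRHS]mul1r ler_pM2r ?invr_gt0//.
  by rewrite lerBlDl; move: h2; rewrite intrD => /ltW.
pose h n (z : plane R) : R := f (g n z.1, z.2).
have mh n : measurable_fun setT (h n).
  have -> : [set: plane R] = \bigcup_k
      [set z : plane R | (fun z => unpickle k == Some (Num.floor (z.1 * n.+1%:R))) z].
    apply/seteqP; split => // z _; exists (pickle (Num.floor (z.1 * n.+1%:R))) => //=.
    by rewrite pickleK.
  have mE k : measurable [set z : plane R | (fun z => unpickle k == Some (Num.floor (z.1 * n.+1%:R))) z].
    case: (unpickle k) => [j|]; last by rewrite (_ : [set _ | _] = set0)//; apply/seteqP; split => // z /=.
    have -> : [set z : plane R | Some j == Some (Num.floor (z.1 * n.+1%:R))] =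
        (fun z : plane R => z.1 * n.+1%:R) @^-1` `[j%:~R, (j + 1)%:~R[%classic.
      apply/seteqP; split => z /=; rewrite in_itv /=.
        by move=> /eqP[->]; exact: floor_itv _.
      by move=> H; apply/eqP; congr Some; apply/esym/floor_def.
    rewrite -[X in measurable X]setTI.
    have : measurable_fun setT (fun z : plane R => z.1 * n.+1%:R) by exact: measurable_funM.
    by apply => //; exact: measurable_itv.
  apply/measurable_fun_bigcup => // k.
  case E : (unpickle k) => [j|]; last first.
    by rewrite (_ : [set _ | _] = set0); [exact: measurable_fun_set0|apply/seteqP; split => // z /=].
  apply: (@eq_measurable_fun _ _ _ _ _ (fun z : plane R => f (j%:~R / n.+1%:R, z.2))).
    by move=> z; rewrite inE /= => /eqP[jE]; rewrite /h /g -jE.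
  apply: measurable_funTS.
  apply: (@measurableT_comp _ _ _ _ _ _ (fun y : R => f (j%:~R / n.+1%:R, y))) => //.
  apply: continuous_measurable_fun => y.
  apply: (@cvg_comp _ _ _ (fun y : R => (j%:~R / n.+1%:R : R, y)) f _ (nbhs (j%:~R / n.+1%:R : R, y))); last exact: cf.
  exact: (@cvg_pair _ _ _ (nbhs y) (nbhs (j%:~R / n.+1%:R : R)) (nbhs y) _ _ _ (fun=> j%:~R / n.+1%:R) id (cvg_cst _) cvg_id).
apply: (measurable_fun_cvg mh) => -[x y] _; apply: (@cvg_comp _ _ _ (fun n => (g n x, y)) f _ (nbhs (x, y))); last exact: cf.
exact: (@cvg_pair _ _ _ \oo (nbhs x) (nbhs y) _ _ _ (g ^~ x) (fun=> y) (gcvg x) (cvg_cst _)).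
Qed.

Lemma continuous_bounded_cell (L : R) (f : R * R -> R) : continuous f ->
  exists K, forall z, cell L z -> `|f z| <= K.
Proof.
move=> cf.
have cK : compact (`[- L, L]%classic `*` `[- L, L]%classic : set (R * R)).
  by apply: compact_setX; exact: segment_compact.
have := continuous_compact (continuous_subspaceT cf) cK.
move=> /compact_bounded[M [_ HM]]; exists (M + 1) => z [z1 z2].
apply: (HM (M + 1)); first by rewrite ltrDl.
exists z => //; split => /=.
  by move: z1; rewrite /= !in_itv /= => /andP[-> /ltW].
by move: z2; rewrite /= !in_itv /= => /andP[-> /ltW].
Qed.

End PlaneContinuous.

(** * Integrals of complex functions *)

Section ComplexIntegral.
Context {d : measure_display} {R : realType} {X : measurableType d}.
Variable mu : {measure set X -> \bar R}.
Implicit Types f g : X -> R[i].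

Definition cintegrable f : Prop :=
  mu.-integrable setT (fun x => (complex.Re (f x))%:E) /\
  mu.-integrable setT (fun x => (complex.Im (f x))%:E).

Lemma cintegralD f g : cintegrable f -> cintegrable g ->
  cintegral mu (fun x => f x + g x) = cintegral mu f + cintegral mu g.
Proof.
move=> [f1 f2] [g1 g2]; apply: eq_complexP; rewrite ?ReD ?ImD /=.
  by rewrite -RintegralD//; apply: eq_Rintegral => x _; rewrite ReD.
by rewrite -RintegralD//; apply: eq_Rintegral => x _; rewrite ImD.
Qed.

Lemma cintegrableD f g : cintegrable f -> cintegrable g -> cintegrable (fun x => f x + g x).
Proof.
move=> [f1 f2] [g1 g2]; split.
  by under eq_fun do rewrite ReD EFinD; exact: integrableD.
by under eq_fun do rewrite ImD EFinD; exact: integrableD.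
Qed.

Lemma cintegrableZ (a : R[i]) f : cintegrable f -> cintegrable (fun x => a * f x).
Proof.
move=> [f1 f2]; split.
  under eq_fun do rewrite ReM EFinB !EFinM.
  by apply: integrableB => //; exact: integrableZl.
under eq_fun do rewrite ImM EFinD !EFinM.
by apply: integrableD => //; exact: integrableZl.
Qed.

Lemma cintegralZ (a : R[i]) f : cintegrable f ->
  cintegral mu (fun x => a * f x) = a * cintegral mu f.
Proof.
move=> [f1 f2].
have i1 (b : R) : mu.-integrable setT (EFin \o (fun x => b * complex.Re (f x))).
  rewrite (_ : _ \o _ = (fun x => b%:E * (complex.Re (f x))%:E)%E); last by apply/funext => x /=; rewrite EFinM.
  exact: integrableZl.
have i2 (b : R) : mu.-integrable setT (EFin \o (fun x => b * complex.Im (f x))).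
  rewrite (_ : _ \o _ = (fun x => b%:E * (complex.Im (f x))%:E)%E); last by apply/funext => x /=; rewrite EFinM.
  exact: integrableZl.
apply: eq_complexP; rewrite ?ReM ?ImM /=.
  rewrite -!RintegralZl// -RintegralB//.
  by apply: eq_Rintegral => x _; rewrite ReM.
rewrite -!RintegralZl// -RintegralD//.
by apply: eq_Rintegral => x _; rewrite ImM.
Qed.

Lemma cintegralB f g : cintegrable f -> cintegrable g ->
  cintegral mu (fun x => f x - g x) = cintegral mu f - cintegral mu g.
Proof.
move=> fi gi; rewrite -[- cintegral mu g]mulN1r -cintegralZ// -cintegralD//.
  by congr cintegral; apply/funext => x; rewrite mulN1r.
exact: cintegrableZ.
Qed.

Lemma cintegrable0 : cintegrable (fun=> 0).
Proof. by split; exact: integrable0. Qed.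

Lemma cintegral0 : cintegral mu (fun=> 0) = 0.
Proof. by apply: eq_complexP; rewrite /= /Rintegral integral0. Qed.

Lemma cintegrable_sum (I : Type) (s : seq I) (F : I -> X -> R[i]) :
  (forall i, cintegrable (F i)) -> cintegrable (fun x => \sum_(i <- s) F i x).
Proof.
move=> Fi; elim: s => [|i s IH].
  by under eq_fun do rewrite big_nil; exact: cintegrable0.
by under eq_fun do rewrite big_cons; exact: cintegrableD.
Qed.

Lemma cintegral_sum (I : Type) (s : seq I) (F : I -> X -> R[i]) :
  (forall i, cintegrable (F i)) ->
  cintegral mu (fun x => \sum_(i <- s) F i x) = \sum_(i <- s) cintegral mu (F i).
Proof.
move=> Fi; elim: s => [|i s IH].
  by under eq_fun do rewrite big_nil; rewrite big_nil cintegral0.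
under eq_fun do rewrite big_cons.
by rewrite cintegralD ?IH ?big_cons//; exact: cintegrable_sum.
Qed.

Lemma cmod_le (z : R[i]) : cmod z <= `|complex.Re z| + `|complex.Im z|.
Proof.
rewrite -ler_sqr ?nnegrE ?cmod_ge0 ?addr_ge0// cmod_sqr sqrrD !real_normK ?num_real//.
by rewrite -addrA lerD2l lerDr mulrn_wge0// mulr_ge0.
Qed.

Lemma cmod_cintegral_le f (K : R) : cintegrable f ->
  (\int[mu]_x (`|complex.Re (f x)|%:E + `|complex.Im (f x)|%:E) <= K%:E)%E ->
  cmod (cintegral mu f) <= K.
Proof.
move=> [f1 f2] fK; apply: le_trans (cmod_le _) _; rewrite /=.
rewrite -lee_fin EFinD; apply: le_trans fK.
rewrite ge0_integralDT; first last.
- by move=> x; rewrite lee_fin.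
- by move=> x; rewrite lee_fin.
- apply/measurable_EFinP/measurableT_comp => //; apply/measurable_EFinP.
  exact: measurable_int f2.
- apply/measurable_EFinP/measurableT_comp => //; apply/measurable_EFinP.
  exact: measurable_int f1.
apply: leeD.
  by rewrite EFin_normr_Rintegral//; apply: le_abse_integral => //; exact: measurable_int f1.
by rewrite EFin_normr_Rintegral//; apply: le_abse_integral => //; exact: measurable_int f2.
Qed.

End ComplexIntegral.

Lemma int_box_uniq N : uniq (int_box N).
Proof.
rewrite map_inj_uniq ?iota_uniq// => i j /eqP.
by rewrite (inj_eq (addIr _)) => /eqP [].
Qed.

Lemma mem_int_box N (k : int) : (k \in int_box N) = (`|k| <= N)%N.
Proof.
apply/mapP/idP => [[i iN ->]|kN].
  by move: iN; rewrite mem_iota; lia.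
exists (absz (k + N%:Z)); last by lia.
by rewrite mem_iota; lia.
Qed.

(** * Fourier coefficients of trigonometric polynomials *)

Section FourierCoefficients.
Context {R : realType}.
Variable L : R.
Hypothesis L0 : 0 < L.

Lemma Re_ebasis k l z : complex.Re (ebasis L k l z) = (2 * L)^-1 * cos (phase L k l z).
Proof. by []. Qed.

Lemma Im_ebasis k l z : complex.Im (ebasis L k l z) = - ((2 * L)^-1 * sin (phase L k l z)).
Proof. by []. Qed.

Lemma phaseD k l k' l' z : phase L (k + k') (l + l') z = phase L k l z + phase L k' l' z.
Proof. by rewrite /phase !intrD; ring. Qed.

Lemma ebasisM k l k' l' z :
  ebasis L k l z * ebasis L k' l' z = Complex (2 * L)^-1 0 * ebasis L (k + k') (l + l') z.
Proof.
apply: eq_complexP; rewrite ?ReM ?ImM !Re_ebasis !Im_ebasis phaseD ?cosD ?sinD /=; ring.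
Qed.

Lemma cmod_ebasis_sqr k l z : cmod (ebasis L k l z) ^+ 2 = (2 * L)^-1 ^+ 2.
Proof.
rewrite cmod_sqr Re_ebasis Im_ebasis sqrrN !exprMn -mulrDr cos2Dsin2 mulr1//.
Qed.

Lemma periodic_ebasis k l : Defs.periodic L (ebasis L k l).
Proof.
have H (t : R) (j : int) : cos (t + j%:~R * (2 * pi)) = cos t /\ sin (t + j%:~R * (2 * pi)) = sin t.
  by rewrite cosD sinD cos_int_2pi sin_int_2pi !mulr0 !mulr1 subr0 addr0.
move=> x y; split; apply: eq_complexP; rewrite ?Re_ebasis ?Im_ebasis.
- rewrite (_ : phase L k l (x + 2 * L, y) = phase L k l (x, y) + k%:~R * (2 * pi)).
    by rewrite (H _ _).1.
  by rewrite /phase /=; field; rewrite gt_eqF.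
- rewrite (_ : phase L k l (x + 2 * L, y) = phase L k l (x, y) + k%:~R * (2 * pi)).
    by rewrite (H _ _).2.
  by rewrite /phase /=; field; rewrite gt_eqF.
- rewrite (_ : phase L k l (x, y + 2 * L) = phase L k l (x, y) + l%:~R * (2 * pi)).
    by rewrite (H _ _).1.
  by rewrite /phase /=; field; rewrite gt_eqF.
- rewrite (_ : phase L k l (x, y + 2 * L) = phase L k l (x, y) + l%:~R * (2 * pi)).
    by rewrite (H _ _).2.
  by rewrite /phase /=; field; rewrite gt_eqF.
Qed.

Lemma measurable_ebasis k l : cmeasurable (ebasis L k l : plane R -> R[i]).
Proof.
have mp := measurable_phase L k l.
split.
  apply: (eq_measurable_fun (fun z => (2 * L)^-1 * cos (phase L k l z))) => //.
  apply: measurable_funM => //.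
  exact: (measurableT_comp (continuous_measurable_fun (@continuous_cos R))).
apply: (eq_measurable_fun (fun z => - ((2 * L)^-1 * sin (phase L k l z)))) => //.
apply: measurable_funN; apply: measurable_funM => //.
exact: (measurableT_comp (continuous_measurable_fun (@continuous_sin R))).
Qed.

Lemma ebasis_bounded k l z : `|complex.Re (ebasis L k l z)| <= (2 * L)^-1 /\
  `|complex.Im (ebasis L k l z)| <= (2 * L)^-1.
Proof.
have L2 : 0 <= (2 * L)^-1 by rewrite invr_ge0 mulr_ge0// ltW.
rewrite Re_ebasis Im_ebasis normrN !normrM ger0_norm//; split.
  by rewrite ler_piMr// ler_norml cos_geN1 cos_le1.
by rewrite ler_piMr// ler_norml sin_geN1 sin_le1.
Qed.

Lemma cintegrable_mul_bounded (g phi : plane R -> R[i]) (K : R) :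
  cintegrable (dxdy L) g -> cmeasurable phi ->
  (forall z, cell L z -> `|complex.Re (phi z)| <= K /\ `|complex.Im (phi z)| <= K) ->
  cintegrable (dxdy L) (fun z => g z * phi z).
Proof.
move=> [g1 g2] [p1 p2] pK.
have bnd (u v : plane R -> R) : measurable_fun setT v ->
    (forall z, cell L z -> `|v z| <= K) ->
    (dxdy L).-integrable setT (fun z => (u z)%:E) ->
    (dxdy L).-integrable setT (fun z => (u z * v z)%:E).
  move=> mv vK iu.
  have mu_ : measurable_fun setT u by apply/measurable_EFinP; exact: measurable_int iu.
  (* The bound holds on the cell only. Cutting [v] off outside makes it bounded everywhere and
     changes it on a null set of [dxdy]. *)
  pose w z := v z * \1_(cell L) z.
  have mw : measurable_fun setT w.
    apply: measurable_funM => //; apply: measurable_indic; exact: measurable_cell.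
  have wK z : `|w z| <= `|K|.
    rewrite /w indicE; case: (boolP (z \in cell L)) => [/set_mem zc|_].
      by rewrite mulr1 (le_trans (vK _ zc))// ler_norm.
    by rewrite mulr0 normr0.
  have iw : (dxdy L).-integrable setT (fun z => (u z * w z)%:E).
    apply: (@le_integrable _ _ _ (dxdy L) setT measurableT _ (fun z => `|K|%:E * (u z)%:E)%E).
    - by apply/measurable_EFinP; exact: measurable_funM.
    - move=> z _; rewrite -EFinM /= lee_fin (normrM (u z) (w z)) (normrM `|K|) normr_id [leRHS]mulrC.
      by apply: ler_wpM2l; [exact: normr_ge0|exact: wK].
    - exact: integrableZl.
  have aeq : ae_eq (dxdy L) setT (fun z => (u z * w z)%:E) (fun z => (u z * v z)%:E).
    exists (~` cell L); split.
    - by apply: measurableC; exact: measurable_cell.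
    - change ((@lebesgue_measure R \x @lebesgue_measure R)%E (~` cell L `&` cell L) = 0%E).
      by rewrite setICl measure0.
    - move=> z /= H zc; apply: H => _; rewrite /w indicE mem_set// mulr1//.
  have m1 : measurable_fun setT (fun z => (u z * v z)%:E) by apply/measurable_EFinP; exact: measurable_funM.
  have m2 : measurable_fun setT (fun z => (u z * w z)%:E) by apply/measurable_EFinP; exact: measurable_funM.
  apply/integrableP; split => //.
  have E : (\int[dxdy L]_z `|(u z * w z)%:E| = \int[dxdy L]_z `|(u z * v z)%:E|)%E.
    apply: ae_eq_integral => //.
    - exact: measurableT_comp.
    - exact: measurableT_comp.
    - exact: (ae_eq_abse aeq).
  by rewrite -E; have /integrableP[] := iw.
split.
  under eq_fun do rewrite ReM EFinB.
  apply: integrableB => //; apply: bnd => // z zc; by have [] := pK z zc.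
under eq_fun do rewrite ImM EFinD.
apply: integrableD => //; apply: bnd => // z zc; by have [] := pK z zc.
Qed.

Lemma cintegrable_ebasis k l : cintegrable (dxdy L) (ebasis L k l).
Proof.
have [m1 m2] := measurable_ebasis k l.
split.
  apply: (dxdy_bounded_integrable L0 (f := fun z => complex.Re (ebasis L k l z)) (K := (2 * L)^-1)) => // z.
  by have [] := ebasis_bounded k l z.
apply: (dxdy_bounded_integrable L0 (f := fun z => complex.Im (ebasis L k l z)) (K := (2 * L)^-1)) => // z.
by have [] := ebasis_bounded k l z.
Qed.

Lemma cintegral_ebasis k l : (k, l) != (0, 0) -> cintegral (dxdy L) (ebasis L k l) = 0.
Proof.
move=> kl.
have ic : (dxdy L).-integrable setT (EFin \o (fun z => cos (phase L k l z))).
  apply: (dxdy_bounded_integrable L0 (K := 1)) => [|z]; last by rewrite ler_norml cos_geN1 cos_le1.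
  apply: (measurableT_comp (continuous_measurable_fun (@continuous_cos R))).
  exact: measurable_phase.
have is_ : (dxdy L).-integrable setT (EFin \o (fun z => sin (phase L k l z))).
  apply: (dxdy_bounded_integrable L0 (K := 1)) => [|z]; last by rewrite ler_norml sin_geN1 sin_le1.
  apply: (measurableT_comp (continuous_measurable_fun (@continuous_sin R))).
  exact: measurable_phase.
apply: eq_complexP => /=.
  transitivity (\int[dxdy L]_z ((2 * L)^-1 * cos (phase L k l z))); first exact: eq_Rintegral.
  rewrite RintegralZl// /Rintegral.
  under eq_integral do rewrite -[phase _ _ _ _]addr0.
  by rewrite (integral_cos_phase L0 0 kl) mulr0.
transitivity (\int[dxdy L]_z (- (2 * L)^-1 * sin (phase L k l z))).
  by apply: eq_Rintegral => z _ /=; rewrite mulNr.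
by rewrite RintegralZl// /Rintegral (integral_sin_phase L0 kl) mulr0.
Qed.

Definition trig (N : nat) (a : int -> int -> R[i]) (z : R * R) : R[i] :=
  \sum_(k <- int_box N) \sum_(l <- int_box N) a k l * ebasis L k l z.

Lemma periodic_trig N a : Defs.periodic L (trig N a).
Proof.
move=> x y; rewrite /trig; split; apply: eq_bigr => k _; apply: eq_bigr => l _;
  by have [h1 h2] := periodic_ebasis k l x y; rewrite ?h1 ?h2.
Qed.

(** It stays unevaluated: the coefficients for exponents [s] and 0 are compared with each other, and
    both contain this factor. *)
Definition ebasis_mass (k l : int) : R[i] :=
  cintegral (dxdy L) (fun z => ebasis L k l z * ebasis L (- k) (- l) z).

Lemma fcoef_trig N a k l : (`|k| <= N)%N -> (`|l| <= N)%N ->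
  fcoef L (distr_of L (trig N a)) k l = a k l * ebasis_mass k l.
Proof.
move=> kN lN; rewrite /fcoef /distr_of.
have key k' l' : cintegral (dxdy L) (fun z => a k' l' * (ebasis L k' l' z * ebasis L (- k) (- l) z)) =
    if (k' == k) && (l' == l) then a k l * ebasis_mass k l else 0.
  have -> : (fun z => a k' l' * (ebasis L k' l' z * ebasis L (- k) (- l) z)) =
      (fun z => a k' l' * (Complex (2 * L)^-1 0 * ebasis L (k' - k) (l' - l) z)).
    by apply/funext => z; rewrite ebasisM.
  case: ifPn => [/andP[/eqP -> /eqP ->]|kl].
    rewrite cintegralZ; last exact/cintegrableZ/cintegrable_ebasis.
    by congr (_ * _); rewrite /ebasis_mass; congr cintegral; apply/funext => z; rewrite ebasisM.
  rewrite cintegralZ; last exact/cintegrableZ/cintegrable_ebasis.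
  rewrite cintegralZ; last exact: cintegrable_ebasis.
  rewrite cintegral_ebasis ?mulr0//; apply: contraNneq kl => -[].
  by move=> /eqP; rewrite subr_eq0 => -> /eqP; rewrite subr_eq0 => ->.
have int1 k' l' : cintegrable (dxdy L) (fun z => a k' l' * (ebasis L k' l' z * ebasis L (- k) (- l) z)).
  have -> : (fun z => a k' l' * (ebasis L k' l' z * ebasis L (- k) (- l) z)) =
      (fun z => a k' l' * (Complex (2 * L)^-1 0 * ebasis L (k' - k) (l' - l) z)).
    by apply/funext => z; rewrite ebasisM.
  exact/cintegrableZ/cintegrableZ/cintegrable_ebasis.
have -> : (fun z => trig N a z * ebasis L (- k) (- l) z) = (fun z => \sum_(k' <- int_box N)
    \sum_(l' <- int_box N) a k' l' * (ebasis L k' l' z * ebasis L (- k) (- l) z)).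
  apply/funext => z; rewrite /trig mulr_suml; apply: eq_bigr => k' _.
  by rewrite mulr_suml; apply: eq_bigr => l' _; rewrite mulrA.
rewrite cintegral_sum; last by move=> k'; apply: cintegrable_sum => l'.
rewrite (bigD1_seq k) ?int_box_uniq ?mem_int_box//= [X in _ + X]big1; last first.
  move=> k' /negbTE kk; rewrite cintegral_sum// big1// => l' _.
  by rewrite key kk.
rewrite addr0 cintegral_sum// (bigD1_seq l) ?int_box_uniq ?mem_int_box//= [X in _ + X]big1.
  by rewrite addr0 key !eqxx.
by move=> l' /negbTE ll; rewrite key ll andbF.
Qed.

End FourierCoefficients.

(** * L^p norms from powers of L^q norms *)

Section TorusNorms.
Context {R : realType}.
Variable L : R.
Hypothesis L0 : 0 < L.

Local Notation mu := (nu2 L).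

Lemma powR_le_1Dexprn (x p : R) (q : nat) : 0 <= x -> 1 <= p -> p <= q%:R ->
  x `^ p <= 1 + x ^+ q.
Proof.
move=> x0 p1 pq; have p0 : 0 <= p by lra.
have [x1|x1] := leP x 1.
  apply: (@le_trans _ _ 1); last by rewrite lerDl exprn_ge0.
  have <- : 1 `^ p = 1 :> R by rewrite powR1.
  apply: ge0_ler_powR => //; rewrite nnegrE//.
apply: (@le_trans _ _ (x ^+ q)); last by rewrite lerDr.
by rewrite -powR_mulrn// ler_powR// ltW.
Qed.

Lemma cmod_powR_le (z : R[i]) (a p : R) (q : nat) : 0 < a -> 1 <= p -> p <= q%:R ->
  cmod z `^ p <= (2 * a) `^ p * (1 + (a^-1 ^+ q * `|complex.Re z| ^+ q + a^-1 ^+ q * `|complex.Im z| ^+ q)).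
Proof.
move=> a0 p1 pq; have p0 : 0 <= p by lra.
set x := `|complex.Re z|; set y := `|complex.Im z|.
have x0 : 0 <= x by exact: normr_ge0. have y0 : 0 <= y by exact: normr_ge0.
set t := Num.max x y / a.
have m0 : 0 <= Num.max x y by rewrite le_max x0.
have t0 : 0 <= t by rewrite divr_ge0// ltW.
have zt : cmod z <= 2 * a * t.
  apply: le_trans (cmod_le z) _; rewrite -/x -/y.
  have -> : 2 * a * t = Num.max x y + Num.max x y by rewrite /t; field; rewrite gt_eqF.
  by apply: lerD; rewrite le_max lexx ?orbT.
apply: (@le_trans _ _ ((2 * a * t) `^ p)).
  by apply: ge0_ler_powR => //; rewrite nnegrE ?cmod_ge0// mulr_ge0// mulr_ge0// ltW.
rewrite powRM//; last by rewrite mulr_ge0// ltW.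
apply: ler_wpM2l; first exact: powR_ge0.
apply: le_trans (powR_le_1Dexprn t0 p1 pq) _; rewrite lerD2l -mulrDr /t mulrC exprMn.
apply: ler_wpM2l; first by rewrite exprn_ge0// invr_ge0 ltW.
by case: (leP x y) => _; rewrite ?lerDl ?lerDr exprn_ge0.
Qed.

Lemma measurable_cmod (f : plane R -> R[i]) : cmeasurable f ->
  measurable_fun setT (fun z => cmod (f z)).
Proof.
move=> [m1 m2].
rewrite (_ : (fun z => _) = (fun z => Num.sqrt (complex.Re (f z) ^+ 2 + complex.Im (f z) ^+ 2))).
  apply: (measurableT_comp (continuous_measurable_fun (@sqrt_continuous R))).
  by apply: measurable_funD; exact: measurable_funX.
by apply/funext => z; rewrite -cmod_sqr sqrtr_sqr ger0_norm// cmod_ge0.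
Qed.

Lemma Lp_normE p (f : plane R -> R[i]) :
  Lp_norm L p f = ((\int[nu2 L]_z ((cmod (f z)) `^ p)%:E) `^ p^-1)%E.
Proof.
rewrite /Lp_norm unlock; apply: (congr1 (fun x => x `^ p^-1)%E).
by apply: eq_integral => z _; rewrite abse_EFin poweR_EFin ger0_norm// cmod_ge0.
Qed.

(** The inequality [x ^ p <= 1 + x ^ q] is applied to [f] divided by [a] and integrated against the
    probability measure [nu2]. Rescaling first makes the bound linear in [a], which later is the
    rate [rho ^+ n]. *)
Lemma Lp_norm_le (f : plane R -> R[i]) (a K p : R) (q : nat) : 0 < a -> 0 <= K ->
  1 <= p -> p <= q%:R -> cmeasurable f ->
  (Lq mu q (fun z => complex.Re (f z)) <= (a ^+ q * K)%:E)%E ->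
  (Lq mu q (fun z => complex.Im (f z)) <= (a ^+ q * K)%:E)%E ->
  (Lp_norm L p f <= (2 * a * (1 + 2 * K))%:E)%E.
Proof.
move=> a0 K0 p1 pq [m1 m2] f1 f2; have p0 : 0 < p by lra.
have a2 : 0 <= 2 * a by rewrite mulr_ge0// ltW.
have aq : 0 <= a^-1 ^+ q by rewrite exprn_ge0// invr_ge0 ltW.
rewrite Lp_normE.
have mcmod := measurable_cmod (conj m1 m2).
have mlhs : measurable_fun setT (fun z => ((cmod (f z)) `^ p)%:E).
  by apply/measurable_EFinP; exact: (measurableT_comp (measurable_powR p)).
have mr1 : measurable_fun setT (fun z => (`|complex.Re (f z)| ^+ q)%:E) by exact: measurable_Lq_integrand.
have mr2 : measurable_fun setT (fun z => (`|complex.Im (f z)| ^+ q)%:E) by exact: measurable_Lq_integrand.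
have key : (\int[mu]_z ((cmod (f z)) `^ p)%:E <= ((2 * a) `^ p * (1 + 2 * K))%:E)%E.
  apply: (@le_trans _ _ (\int[mu]_z (((2 * a) `^ p)%:E * (1%:E + ((a^-1 ^+ q)%:E * (`|complex.Re (f z)| ^+ q)%:E + (a^-1 ^+ q)%:E * (`|complex.Im (f z)| ^+ q)%:E))))%E).
    apply: ge0_le_integralT => //.
    - apply: emeasurable_funM => //; apply: emeasurable_funD => //.
      by apply: emeasurable_funD; exact: emeasurable_funM.
    - by move=> z; rewrite lee_fin powR_ge0.
    - move=> z; have h : ((cmod (f z) `^ p)%:E <= ((2 * a) `^ p * (1 + (a^-1 ^+ q * `|complex.Re (f z)| ^+ q + a^-1 ^+ q * `|complex.Im (f z)| ^+ q)))%:E)%E.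
        by rewrite lee_fin; exact: cmod_powR_le.
      exact: h.
  have mm1 : measurable_fun setT (fun z => (a^-1 ^+ q)%:E * (`|complex.Re (f z)| ^+ q)%:E)%E by exact: emeasurable_funM.
  have mm2 : measurable_fun setT (fun z => (a^-1 ^+ q)%:E * (`|complex.Im (f z)| ^+ q)%:E)%E by exact: emeasurable_funM.
  have p1' z : (0 <= (a^-1 ^+ q)%:E * (`|complex.Re (f z)| ^+ q)%:E)%E by rewrite -EFinM lee_fin mulr_ge0// exprn_ge0.
  have p2' z : (0 <= (a^-1 ^+ q)%:E * (`|complex.Im (f z)| ^+ q)%:E)%E by rewrite -EFinM lee_fin mulr_ge0// exprn_ge0.
  rewrite ge0_integralZT ?powR_ge0//; last 2 first.
  - by apply: emeasurable_funD => //; exact: emeasurable_funD.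
  - by move=> z; rewrite !adde_ge0.
  rewrite (EFinM ((2 * a) `^ p)); apply: lee_wpmul2l; first by rewrite lee_fin powR_ge0.
  rewrite ge0_integralDT//; last 2 first.
  - exact: emeasurable_funD.
  - by move=> z; rewrite adde_ge0.
  rewrite ge0_integralDT// !ge0_integralZT//; try by move=> z; rewrite lee_fin exprn_ge0.
  have -> : (1 + 2 * K)%:E = (1%:E + (K%:E + K%:E))%E by rewrite -!EFinD; congr EFin; ring.
  apply: leeD.
    by rewrite integral_cst// mul1e nu2_setT.
  have fin (u : \bar R) : (u <= (a ^+ q * K)%:E)%E -> ((a^-1 ^+ q)%:E * u <= K%:E)%E.
    move=> uK; apply: (@le_trans _ _ ((a^-1 ^+ q)%:E * (a ^+ q * K)%:E)%E).
      by apply: lee_wpmul2l; rewrite ?lee_fin.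
    by rewrite -EFinM lee_fin mulrA -exprMn mulVf ?gt_eqF// expr1n mul1r.
  by apply: leeD; exact: fin.
apply: (@le_trans _ _ ((((2 * a) `^ p * (1 + 2 * K))%:E) `^ p^-1)%E).
  apply: gt0_ler_poweR.
  - by rewrite invr_ge0 ltW.
  - by rewrite in_itv /= leey andbT; apply: integral_ge0 => z _; rewrite lee_fin powR_ge0.
  - by rewrite in_itv /= leey andbT lee_fin mulr_ge0 ?powR_ge0// addr_ge0// mulr_ge0.
  - exact: key.
rewrite poweR_EFin lee_fin powRM ?powR_ge0//; last by rewrite addr_ge0// mulr_ge0.
rewrite -powRrM mulfV ?gt_eqF// powRr1//; apply: ler_wpM2l => //.
apply: ler1_powR; first by rewrite lerDl mulr_ge0.
by rewrite invf_le1.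
Qed.

Lemma L1_le (f : plane R -> R) (a K : R) (q : nat) : 0 < a -> 0 <= K -> (0 < q)%N ->
  measurable_fun setT f ->
  (Lq mu q f <= (a ^+ q * K)%:E)%E -> (\int[mu]_z `|f z|%:E <= (a * (1 + K))%:E)%E.
Proof.
move=> a0 K0 q0 mf fK.
have aq : 0 <= a^-1 ^+ q by rewrite exprn_ge0// invr_ge0 ltW.
have mr : measurable_fun setT (fun z => (`|f z| ^+ q)%:E) by exact: measurable_Lq_integrand.
have mm : measurable_fun setT (fun z => (a^-1 ^+ q)%:E * (`|f z| ^+ q)%:E)%E by exact: emeasurable_funM.
have pp z : (0 <= (a^-1 ^+ q)%:E * (`|f z| ^+ q)%:E)%E by rewrite -EFinM lee_fin mulr_ge0// exprn_ge0.
apply: (@le_trans _ _ (\int[mu]_z (a%:E * (1%:E + (a^-1 ^+ q)%:E * (`|f z| ^+ q)%:E)))%E).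
  apply: ge0_le_integralT => //.
  - by apply/measurable_EFinP; exact: measurableT_comp.
  - by apply: emeasurable_funM => //; exact: emeasurable_funD.
  - move=> z; suff h : (`|f z|%:E <= (a * (1 + (a^-1 ^+ q * `|f z| ^+ q)))%:E)%E by exact: h.
    rewrite lee_fin.
    have := @powR_le_1Dexprn (a^-1 * `|f z|) 1 q _ (lexx _).
    rewrite powRr1 ?mulr_ge0 ?invr_ge0 ?(ltW a0)// ler1n => /(_ isT q0).
    by rewrite ler_pdivrMl// exprMn.
rewrite ge0_integralZT ?(ltW a0)//; last 2 first.
- exact: emeasurable_funD.
- by move=> z; rewrite adde_ge0.
rewrite (EFinM a); apply: lee_wpmul2l; first by rewrite lee_fin ltW.
rewrite ge0_integralDT// ge0_integralZT//.
rewrite EFinD; apply: leeD.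
  by rewrite integral_cst// mul1e nu2_setT.
apply: (@le_trans _ _ ((a^-1 ^+ q)%:E * (a ^+ q * K)%:E)%E).
  by apply: lee_wpmul2l; rewrite ?lee_fin.
by rewrite -EFinM lee_fin mulrA -exprMn mulVf ?gt_eqF// expr1n mul1r.
Qed.

Lemma integrable_dxdy_of_L1 (f : plane R -> R) (K : R) : measurable_fun setT f ->
  (\int[mu]_z `|f z|%:E <= K%:E)%E -> (dxdy L).-integrable setT (fun z => (f z)%:E).
Proof.
move=> mf fK; have mnf : measurable_fun setT (fun z => `|f z|%:E).
  by apply/measurable_EFinP; exact: measurableT_comp.
apply/integrableP; split; first exact/measurable_EFinP.
under eq_integral do rewrite abse_EFin.
rewrite (integral_dxdy_nu2 L0)//.
apply: (@le_lt_trans _ _ (((2 * L) ^+ 2)%:E * K%:E)%E); last by rewrite -EFinM ltry.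
by apply: lee_wpmul2l; rewrite ?lee_fin ?sqr_ge0.
Qed.

End TorusNorms.

(** * Integrable functions as periodic distributions *)

Section TorusDistributions.
Context {R : realType}.
Variable L : R.
Hypothesis L0 : 0 < L.

Lemma smooth_continuous (h : R * R -> R) : smooth h -> continuous h.
Proof. by move=> sh z; apply: differentiable_continuous; exact: (sh [::]). Qed.

Lemma test_fun_mul_integrable (f phi : R * R -> R[i]) : cintegrable (dxdy L) f ->
  test_fun L phi -> cintegrable (dxdy L) (fun z => f z * phi z).
Proof.
move=> fi [_ s1 s2].
have c1 := smooth_continuous s1; have c2 := smooth_continuous s2.
have [K1 HK1] := continuous_bounded_cell L c1; have [K2 HK2] := continuous_bounded_cell L c2.
apply: (cintegrable_mul_bounded (K := Num.max K1 K2)) => //.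
  by split; exact: continuous_plane_measurable.
by move=> z zc; rewrite !le_max HK1// HK2// orbT.
Qed.

Lemma distr_of_periodic (f : R * R -> R[i]) : cintegrable (dxdy L) f ->
  periodic_distribution L (distr_of L f).
Proof.
move=> fi; split.
  move=> a b phi psi tphi tpsi; rewrite /distr_of.
  have i1 := test_fun_mul_integrable fi tphi; have i2 := test_fun_mul_integrable fi tpsi.
  rewrite -cintegralZ// -cintegralZ// -cintegralD//; last 2 first.
  - exact: cintegrableZ.
  - exact: cintegrableZ.
  by congr cintegral; apply/funext => z; ring.
have [f1 f2] := fi.
pose K := fine (\int[dxdy L]_z (`|complex.Re (f z)|%:E + `|complex.Im (f z)|%:E)).
have n1 : (dxdy L).-integrable setT (fun z => `|complex.Re (f z)|%:E) by exact: (integrable_abse f1).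
have n2 : (dxdy L).-integrable setT (fun z => `|complex.Im (f z)|%:E) by exact: (integrable_abse f2).
have nsum := integrableD measurableT n1 n2.
have KE : (\int[dxdy L]_z (`|complex.Re (f z)|%:E + `|complex.Im (f z)|%:E) = K%:E)%E.
  by rewrite /K fineK//; exact: (integrable_fin_num measurableT nsum).
(* The distribution has order 0; the factor 2 counts the real and the imaginary part of the
   product. *)
exists 0%N, (2 * K) => phi A tphi phiA.
have ii := test_fun_mul_integrable fi tphi.
have bnd z : `|complex.Re (phi z)| <= A /\ `|complex.Im (phi z)| <= A by exact: (phiA [::] z isT).
have A0 : 0 <= A by apply: le_trans (bnd (0, 0)).1.
apply: cmod_cintegral_le => //.
apply: (@le_trans _ _ (\int[dxdy L]_z ((2 * A)%:E * (`|complex.Re (f z)|%:E + `|complex.Im (f z)|%:E)))%E).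
  have mfp : cmeasurable (fun z : plane R => f z * phi z).
    by case: ii => i1 i2; split; apply/measurable_EFinP; [exact: measurable_int i1|exact: measurable_int i2].
  apply: ge0_le_integralT => //.
  - by apply: emeasurable_funD; apply/measurable_EFinP/measurableT_comp => //; [exact: mfp.1|exact: mfp.2].
  - by apply: emeasurable_funM => //; exact: measurable_int nsum.
  - by move=> z; rewrite adde_ge0// lee_fin.
  - move=> z; rewrite -!EFinD -EFinM lee_fin ReM ImM.
    have [b1 b2] := bnd z.
    have h (x y u v : R) : `|u| <= A -> `|v| <= A -> `|x * u + y * v| <= A * (`|x| + `|y|).
      move=> uA vA; apply: le_trans (ler_normD _ _) _; rewrite !normrM mulrDr.
      by apply: lerD; rewrite mulrC ler_wpM2r.
    have := h (complex.Re (f z)) (- complex.Im (f z)) _ _ b1 b2.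
    have := h (complex.Re (f z)) (complex.Im (f z)) _ _ b2 b1.
    by rewrite mulNr normrN; lra.
rewrite ge0_integralZT ?mulr_ge0//; last 2 first.
- exact: measurable_int nsum.
- by move=> z; rewrite adde_ge0// lee_fin.
by rewrite KE -EFinM lee_fin; lra.
Qed.

Lemma cintegrable_mul_ebasis (f : R * R -> R[i]) k l : cintegrable (dxdy L) f ->
  cintegrable (dxdy L) (fun z => f z * ebasis L k l z).
Proof.
move=> fi; apply: (cintegrable_mul_bounded (K := (2 * L)^-1)) => //.
  exact: measurable_ebasis.
by move=> z _; exact: ebasis_bounded.
Qed.

Lemma fcoef_distrB (f g : R * R -> R[i]) k l : cintegrable (dxdy L) f ->
  cintegrable (dxdy L) g ->
  fcoef L (distr_of L (fun z => f z - g z)) k l =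
  fcoef L (distr_of L f) k l - fcoef L (distr_of L g) k l.
Proof.
move=> fi gi; rewrite /fcoef /distr_of -cintegralB; try exact: cintegrable_mul_ebasis.
by congr cintegral; apply/funext => z; rewrite mulrBl.
Qed.

(** The parts of a basis function are at most [(2 * L)^-1] and the cell has area [(2 * L) ^+ 2];
    with two parts of the product and two parts of [f - g] this makes [8 * L]. *)
Lemma fcoef_dist (f g : R * R -> R[i]) (e : R) k l : cintegrable (dxdy L) f ->
  cintegrable (dxdy L) g ->
  (\int[nu2 L]_z `|complex.Re (f z) - complex.Re (g z)|%:E <= e%:E)%E ->
  (\int[nu2 L]_z `|complex.Im (f z) - complex.Im (g z)|%:E <= e%:E)%E ->
  cmod (fcoef L (distr_of L f) k l - fcoef L (distr_of L g) k l) <= 8 * L * e.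
Proof.
move=> fi gi e1 e2; rewrite -fcoef_distrB//.
have di : cintegrable (dxdy L) (fun z => f z - g z).
  have -> : (fun z => f z - g z) = (fun z => f z + -1 * g z) by apply/funext => z; rewrite mulN1r.
  by apply: cintegrableD => //; exact: cintegrableZ.
have ii := cintegrable_mul_ebasis (- k) (- l) di.
apply: cmod_cintegral_le => //.
have [d1 d2] := di; have [i1 i2] := ii.
have m1 : measurable_fun setT (fun z => `|complex.Re (f z) - complex.Re (g z)|%:E).
  apply/measurable_EFinP/measurableT_comp => //.
  under eq_fun do rewrite -ReB; apply/measurable_EFinP; exact: measurable_int d1.
have m2 : measurable_fun setT (fun z => `|complex.Im (f z) - complex.Im (g z)|%:E).
  apply/measurable_EFinP/measurableT_comp => //.
  under eq_fun do rewrite -ImB; apply/measurable_EFinP; exact: measurable_int d2.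
have L2 : 0 <= 2 * (2 * L)^-1 by rewrite mulr_ge0// invr_ge0 mulr_ge0// ltW.
apply: (@le_trans _ _ (\int[dxdy L]_z ((2 * (2 * L)^-1)%:E * (`|complex.Re (f z) - complex.Re (g z)|%:E + `|complex.Im (f z) - complex.Im (g z)|%:E)))%E).
  apply: ge0_le_integralT => //.
  - apply: emeasurable_funD; apply/measurable_EFinP/measurableT_comp => //; apply/measurable_EFinP.
      exact: measurable_int i1.
    exact: measurable_int i2.
  - by apply: emeasurable_funM => //; exact: emeasurable_funD.
  - by move=> z; rewrite adde_ge0// lee_fin.
  - move=> z; rewrite -!EFinD -EFinM lee_fin ReM ImM ReB ImB.
    have [b1 b2] := ebasis_bounded L0 (- k) (- l) z.
    set A := (2 * L)^-1 in b1 b2 *.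
    have h (x y u v : R) : `|u| <= A -> `|v| <= A -> `|x * u + y * v| <= A * (`|x| + `|y|).
      move=> uA vA; apply: le_trans (ler_normD _ _) _; rewrite !normrM mulrDr.
      by apply: lerD; rewrite mulrC ler_wpM2r.
    have := h (complex.Re (f z) - complex.Re (g z)) (- (complex.Im (f z) - complex.Im (g z))) _ _ b1 b2.
    have := h (complex.Re (f z) - complex.Re (g z)) (complex.Im (f z) - complex.Im (g z)) _ _ b2 b1.
    by rewrite mulNr normrN; lra.
rewrite ge0_integralZT//; last 2 first.
- exact: emeasurable_funD.
- by move=> z; rewrite adde_ge0// lee_fin.
rewrite (integral_dxdy_nu2 L0); last 2 first.
- exact: emeasurable_funD.
- by move=> z; rewrite adde_ge0// lee_fin.
rewrite ge0_integralDT//.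
apply: (@le_trans _ _ ((2 * (2 * L)^-1)%:E * (((2 * L) ^+ 2)%:E * (e%:E + e%:E)))%E).
  apply: lee_wpmul2l; first by rewrite lee_fin.
  by apply: lee_wpmul2l; [rewrite lee_fin sqr_ge0|exact: leeD].
rewrite -EFinD -!EFinM lee_fin le_eqVlt; apply/orP; left; apply/eqP; field.
by rewrite gt_eqF.
Qed.

End TorusDistributions.

(** * Summation of the variances over the modes *)

Section VarianceBounds.
Context {R : realType}.
Variables (L T s theta : R).
Hypotheses (L0 : 0 < L) (T0 : 0 < T) (s0 : 0 <= s) (th0 : 0 < theta)
  (sth : theta < 4^-1 - s).

Definition bessel (s : R) (k l : int) : R[i] := Complex (symbol L k l `^ (s / 2)) 0.

Lemma cmodM (z z' : R[i]) : cmod (z * z') = cmod z * cmod z'.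
Proof. exact: ComplexField.Normc.normcM. Qed.

Lemma cmod_bessel_sqr k l : cmod (bessel s k l) ^+ 2 = symbol L k l `^ s.
Proof.
rewrite cmod_sqr /= expr0n addr0 -powR_mulrn ?powR_ge0// -powRrM.
by congr (_ `^ _); field.
Qed.

Definition box (N : nat) : seq (int * int) := [seq (k, l) | k <- int_box N, l <- int_box N].

Lemma sum_box (V : nmodType) N (F : int -> int -> V) :
  \sum_(i <- box N) F i.1 i.2 = \sum_(k <- int_box N) \sum_(l <- int_box N) F k l.
Proof. by rewrite big_allpairs. Qed.

Lemma box_uniq N : uniq (box N).
Proof. by apply: allpairs_uniq; rewrite ?int_box_uniq// => -[a b] [c d] _ _ [-> ->]. Qed.

Lemma mem_box N i : (i \in box N) = (`|i.1| <= N)%N && (`|i.2| <= N)%N.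
Proof.
case: i => k l; apply/allpairsP/andP => [[[a b] /= [ha hb [-> ->]]]|[/= ha hb]].
  by rewrite -!mem_int_box.
by exists (k, l); rewrite /= !mem_int_box.
Qed.

Lemma symbol_gt0 k l : 0 < symbol L k l.
Proof. by apply: lt_le_trans (symbol_ge1 L k l). Qed.

(** Collecting the powers of the symbol leaves the exponent [-(1 - theta - s)], and
    [theta < 1/4 - s] says that [1 - theta - s] exceeds 3/4. *)
Lemma time_variance : exists2 C : R, 0 <= C & forall N t r,
  0 <= r -> r <= t -> t <= T ->
  \sum_(i <- box N) (symbol L i.1 i.2 `^ s * (2 * L)^-1 ^+ 2) *
    (2 * expR (6 * T) * ((t - r) * symbol L i.1 i.2) `^ theta / symbol L i.1 i.2)
  <= C * (t - r) `^ theta.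
Proof.
have q34 : 3 / 4 < 1 - theta - s by move: sth; lra.
have [C HC] := sum_symbol_le L0 q34.
have K0 : 0 <= (2 * L)^-1 ^+ 2 * (2 * expR (6 * T)).
  by rewrite mulr_ge0 ?sqr_ge0// mulr_ge0// expR_ge0.
have C0 : 0 <= C.
  apply: le_trans (HC 0%N); apply: sumr_ge0 => k _; apply: sumr_ge0 => l _; exact: powR_ge0.
exists ((2 * L)^-1 ^+ 2 * (2 * expR (6 * T)) * C) => [|N t r r0 rt tT]; first exact: mulr_ge0.
have tr : 0 <= t - r by rewrite subr_ge0.
rewrite (eq_bigr (fun i => ((2 * L)^-1 ^+ 2 * (2 * expR (6 * T)) * (t - r) `^ theta) *
   symbol L i.1 i.2 `^ (- (1 - theta - s)))); last first.
  move=> i _; have v0 := symbol_gt0 i.1 i.2.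
  rewrite powRM ?(ltW v0)// -[X in _ / X](powRr1 (ltW v0)) -powRN.
  have -> : - (1 - theta - s) = s + theta + -1 by ring.
  rewrite powRD ?(gt_eqF v0) ?implybT// powRD ?(gt_eqF v0) ?implybT//.
  ring.
rewrite -mulr_sumr.
rewrite (sum_box N (fun k l => symbol L k l `^ (- (1 - theta - s)))).
rewrite mulrAC; apply: ler_wpM2r; first exact: powR_ge0.
by apply: ler_wpM2l.
Qed.

(** Outside the smaller box the symbol is at least [c0 * 2 ^+ n], so a factor [symbol] to the power
    [- theta] is worth [2 ^+ n] to that power, up to a constant; the rest is summable as for the
    time increments. *)
Lemma level_variance : exists2 C : R, 0 <= C & forall n,
  \sum_(i <- [seq i <- box (2 ^ n.+1) | i \notin box (2 ^ n)])
     (symbol L i.1 i.2 `^ s * (2 * L)^-1 ^+ 2) * (expR (4 * T) / symbol L i.1 i.2)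
  <= C * (2^-1 ^+ n) `^ theta.
Proof.
have q34 : 3 / 4 < 1 - theta - s by move: sth; lra.
have [C HC] := sum_symbol_le L0 q34.
have [c0 c00 Hc0] := symbol_lower L0.
have K0 : 0 <= (2 * L)^-1 ^+ 2 * expR (4 * T) by rewrite mulr_ge0 ?sqr_ge0// expR_ge0.
have C0 : 0 <= C.
  apply: le_trans (HC 0%N); apply: sumr_ge0 => k _; apply: sumr_ge0 => l _; exact: powR_ge0.
have A0 : 0 <= (2 * L)^-1 ^+ 2 * expR (4 * T) * c0 `^ (- theta).
  by rewrite mulr_ge0// powR_ge0.
exists ((2 * L)^-1 ^+ 2 * expR (4 * T) * c0 `^ (- theta) * C) => [|n]; first exact: mulr_ge0.
have p2 : 1 <= 2 ^+ n :> R by rewrite exprn_ege1// ler1n.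
have big i : i \notin box (2 ^ n) -> c0 * 2 ^+ n <= symbol L i.1 i.2.
  have h (j : nat) : (2 ^ n < j)%N -> 2 ^+ n <= (1 + j%:R) ^+ 2 :> R.
    move=> nj; have hj : 2 ^+ n <= j%:R :> R by rewrite -natrX ler_nat ltnW.
    by rewrite expr2; nra.
  have h4 (j : nat) : (2 ^ n < j)%N -> 2 ^+ n <= (1 + j%:R) ^+ 4 :> R.
    move=> /h /le_trans; apply; apply: ler_weXn2l => //; by rewrite lerDl.
  rewrite mem_box negb_and -!ltnNge => /orP[kn|ln].
    by apply: le_trans (Hc0 i.1 i.2).1; rewrite ler_pM2l// h4.
  by apply: le_trans (Hc0 i.1 i.2).2; rewrite ler_pM2l// h.
rewrite big_filter.
apply: (@le_trans _ _ (\sum_(i <- box (2 ^ n.+1)) ((2 * L)^-1 ^+ 2 * expR (4 * T) * c0 `^ (- theta) * (2^-1 ^+ n) `^ theta) *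
   symbol L i.1 i.2 `^ (- (1 - theta - s)))).
  rewrite big_mkcond /=; apply: ler_sum => i _; case: ifPn => [/big hi|_]; last first.
    by rewrite mulr_ge0 ?powR_ge0// mulr_ge0 ?powR_ge0.
  have v0 := symbol_gt0 i.1 i.2.
  have hth : symbol L i.1 i.2 `^ (- theta) <= c0 `^ (- theta) * (2^-1 ^+ n) `^ theta.
    have p0 : 0 < c0 * 2 ^+ n by rewrite mulr_gt0// exprn_gt0.
    rewrite exprVn -[X in c0 `^ X](mul1r (- theta)) mul1r -(powR_inv1 (exprn_ge0 n _))// -powRrM mulN1r.
    rewrite -powRM ?(ltW c00) ?exprn_ge0// !powRN lef_pV2 ?posrE ?powR_gt0//.
    by apply: ge0_ler_powR; rewrite ?nnegrE ?(ltW th0) ?(ltW p0) ?(ltW v0).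
  rewrite -[X in _ / X](powRr1 (ltW v0)) -powRN.
  have -> : (symbol L i.1 i.2 `^ s * (2 * L)^-1 ^+ 2 * (expR (4 * T) * symbol L i.1 i.2 `^ (- 1))) =
     (2 * L)^-1 ^+ 2 * expR (4 * T) * (symbol L i.1 i.2 `^ (- (1 - theta - s)) * symbol L i.1 i.2 `^ (- theta)).
    rewrite -powRD ?(gt_eqF v0) ?implybT//.
    have -> : - (1 - theta - s) + - theta = s + -1 by ring.
    by rewrite powRD ?(gt_eqF v0) ?implybT//; ring.
  rewrite -!(mulrA ((2 * L)^-1 ^+ 2 * expR (4 * T))); apply: ler_wpM2l => //.
  by rewrite [leRHS]mulrC; apply: ler_wpM2l => //; exact: powR_ge0.
rewrite -mulr_sumr (sum_box (2 ^ n.+1) (fun k l => symbol L k l `^ (- (1 - theta - s)))).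
rewrite mulrAC; apply: ler_wpM2r; first exact: powR_ge0.
by apply: ler_wpM2l.
Qed.

Lemma static_variance : exists2 C : R, 0 <= C & forall N,
  \sum_(i <- box N) (symbol L i.1 i.2 `^ s * (2 * L)^-1 ^+ 2) * (expR (4 * T) / symbol L i.1 i.2) <= C.
Proof.
have q34 : 3 / 4 < 1 - s by move: sth th0; lra.
have [C HC] := sum_symbol_le L0 q34.
have K0 : 0 <= (2 * L)^-1 ^+ 2 * expR (4 * T) by rewrite mulr_ge0 ?sqr_ge0// expR_ge0.
have C0 : 0 <= C.
  apply: le_trans (HC 0%N); apply: sumr_ge0 => k _; apply: sumr_ge0 => l _; exact: powR_ge0.
exists ((2 * L)^-1 ^+ 2 * expR (4 * T) * C) => [|N]; first exact: mulr_ge0.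
rewrite (eq_bigr (fun i => ((2 * L)^-1 ^+ 2 * expR (4 * T)) * symbol L i.1 i.2 `^ (- (1 - s)))); last first.
  move=> i _; have v0 := symbol_gt0 i.1 i.2.
  rewrite -[X in _ / X](powRr1 (ltW v0)) -powRN.
  have -> : - (1 - s) = s + -1 by ring.
  by rewrite powRD ?(gt_eqF v0) ?implybT//; ring.
rewrite -mulr_sumr (sum_box N (fun k l => symbol L k l `^ (- (1 - s)))).
by apply: ler_wpM2l.
Qed.

End VarianceBounds.

Section ComplexMeasurable.
Context {d d' : measure_display} {R : realType} {X : measurableType d} {X' : measurableType d'}.
Implicit Types f g : X -> R[i].

Lemma measurable_component b f : cmeasurable f -> measurable_fun setT (fun x => component b (f x)).
Proof. by case: b => -[]. Qed.

Lemma cmeasurable_cst (c : R[i]) : cmeasurable (fun _ : X => c).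
Proof. by split. Qed.

Lemma cmeasurableD f g : cmeasurable f -> cmeasurable g -> cmeasurable (fun x => f x + g x).
Proof.
move=> [f1 f2] [g1 g2]; split.
  by under eq_fun do rewrite ReD; exact: measurable_funD.
by under eq_fun do rewrite ImD; exact: measurable_funD.
Qed.

Lemma cmeasurableM f g : cmeasurable f -> cmeasurable g -> cmeasurable (fun x => f x * g x).
Proof.
move=> [f1 f2] [g1 g2]; split.
  by under eq_fun do rewrite ReM; apply: measurable_funB; exact: measurable_funM.
by under eq_fun do rewrite ImM; apply: measurable_funD; exact: measurable_funM.
Qed.

Lemma cmeasurable_sum (I : Type) (s : seq I) (F : I -> X -> R[i]) :
  (forall i, cmeasurable (F i)) -> cmeasurable (fun x => \sum_(i <- s) F i x).
Proof.
move=> mF; elim: s => [|i s IH].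
  by under eq_fun do rewrite big_nil; exact: cmeasurable_cst.
by under eq_fun do rewrite big_cons; exact: cmeasurableD.
Qed.

Lemma cmeasurable_comp f (phi : X' -> X) : cmeasurable f -> measurable_fun setT phi ->
  cmeasurable (fun x => f (phi x)).
Proof. by move=> [f1 f2] mphi; split; [exact: (measurableT_comp f1)|exact: (measurableT_comp f2)]. Qed.

End ComplexMeasurable.

(** * The grid of times *)

Section Grid.
Context {R : realType}.
Variable T : R.
Hypothesis T0 : 0 < T.

(** The cap at [T] keeps all indices inside [[0, T]], where the coefficients are Wiener
    integrals. *)
Definition grid (n i : nat) : R := Num.min T (i%:R * T / 2 ^+ n).

Lemma grid_itv n i : 0 <= grid n i /\ grid n i <= T.
Proof.
by rewrite /grid le_min ge_min lexx (ltW T0) !mulr_ge0 ?invr_ge0 ?exprn_ge0// ltW.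
Qed.

Lemma gridS n i : grid n i <= grid n i.+1 /\ grid n i.+1 - grid n i <= T / 2 ^+ n.
Proof.
have p0 : 0 <= T / 2 ^+ n by rewrite divr_ge0 ?exprn_ge0// ltW.
have -> : grid n i.+1 = Num.min T (i%:R * T / 2 ^+ n + T / 2 ^+ n).
  by rewrite /grid; congr Num.min; rewrite -[i.+1%:R]natr1; ring.
rewrite /grid.
move: (i%:R * T / 2 ^+ n) (T / 2 ^+ n) p0 => x y y0; rewrite !minEle.
by split; case: (leP T x) => ?; case: (leP T (x + y)) => ?; lra.
Qed.

Lemma grid_double n i : grid n.+1 (2 * i) = grid n i.
Proof.
rewrite /grid; congr Num.min; rewrite natrM exprS; field.
by rewrite expf_neq0.
Qed.

Lemma grid_dyadic n t : 0 <= t -> t <= T ->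
  grid n (dyadic_index T n t) <= t /\ t - grid n (dyadic_index T n t) <= T / 2 ^+ n.
Proof.
move=> t0 tT; have /andP[a1 a2] := dyadic_index_itv T0 n t0.
have p0 : 0 < T / 2 ^+ n by rewrite divr_gt0 ?exprn_gt0.
have tE : t = t / T * 2 ^+ n * (T / 2 ^+ n) by field; rewrite expf_neq0// gt_eqF.
have h1 : (dyadic_index T n t)%:R * T / 2 ^+ n <= t.
  by rewrite [leRHS]tE -mulrA ler_pM2r.
have h2 : t <= (dyadic_index T n t)%:R * T / 2 ^+ n + T / 2 ^+ n.
  have -> : (dyadic_index T n t)%:R * T / 2 ^+ n + T / 2 ^+ n = (dyadic_index T n t).+1%:R * (T / 2 ^+ n).
    by rewrite -[(_).+1%:R]natr1; ring.
  by rewrite [leLHS]tE ler_pM2r// ltW.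
by rewrite /grid (min_idPr (le_trans h1 tT)); split; lra.
Qed.

End Grid.

(** * A path built from given Fourier coefficients *)

Section Path.
Context {R : realType}.
Variables (L T rho : R) (q : nat).
Hypotheses (L0 : 0 < L) (T0 : 0 < T) (q0 : (0 < q)%N) (r0 : 0 < rho) (r1 : rho < 1).
Variable j : int -> int -> R -> R[i].

Definition wave s N t : R * R -> R[i] := trig L N (fun k l => bessel L s k l * j k l t).

Definition level s b (n i : nat) : plane R -> R :=
  fun z => component b (wave s (2 ^ n) (grid T n i) z).

Definition path s t : R * R -> R[i] := fun z =>
  Complex (chain_limit T (level s true) t z) (chain_limit T (level s false) t z).

(** The two norms at level 0 are added so that this quantity controls the size of the path as well
    as its increments. *)
Definition path_energy s b : \bar R :=
  (chain_energy (nu2 L) rho q (level s b) +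
    (Lq (nu2 L) q (level s b 0 0) + Lq (nu2 L) q (level s b 0 1)))%E.

Definition approx s n t : R * R -> R[i] := wave s (2 ^ n) (grid T n (dyadic_index T n t)).

Lemma path_energy_ge0 s b : (0 <= path_energy s b)%E.
Proof.
apply: adde_ge0; first exact: chain_energy_ge0.
by apply: adde_ge0; exact: Lq_ge0.
Qed.

Lemma component_path s t b z : component b (path s t z) = chain_limit T (level s b) t z.
Proof. by case: b. Qed.

Lemma cmeasurable_wave s N t : cmeasurable (wave s N t : plane R -> R[i]).
Proof.
apply: cmeasurable_sum => k; apply: cmeasurable_sum => l.
by apply: cmeasurableM; [exact: cmeasurable_cst|exact: measurable_ebasis].
Qed.

Lemma measurable_level s b n i : measurable_fun setT (level s b n i).
Proof. by apply: measurable_component; exact: cmeasurable_wave. Qed.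

Lemma cmeasurable_path s t : cmeasurable (path s t : plane R -> R[i]).
Proof. by split; apply: measurable_chain_limit; exact: measurable_level. Qed.

Lemma periodic_path s t : Defs.periodic L (path s t).
Proof.
(* The limit depends on the point only through the values of all waves there, so periodicity holds
   at every point, also where the chain diverges. *)
have per z z' : (forall N u, wave s N u z = wave s N u z') -> path s t z = path s t z'.
  move=> E; rewrite /path /chain_limit /chain /level.
  by congr Complex; congr (fine (limn_esup _)); apply/funext => n; rewrite E.
by move=> x y; split; apply: per => N u; have [h1 h2] := periodic_trig L0 N (fun k l => bessel L s k l * j k l u) x y.
Qed.

Lemma cintegrable_wave s N t : cintegrable (dxdy L) (wave s N t).
Proof.
apply: cintegrable_sum => k; apply: cintegrable_sum => l.
by apply: cintegrableZ; exact: cintegrable_ebasis.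
Qed.

Lemma LqC (f g : plane R -> R) : Lq (nu2 L) q (f \- g)%R = Lq (nu2 L) q (g \- f)%R.
Proof. by apply: eq_integral => z _ /=; rewrite distrC. Qed.

Section Energy.
Variables (s e : R).
Hypothesis fin_e : forall b, (path_energy s b <= e%:E)%E.

Lemma chain_energy_le b : (chain_energy (nu2 L) rho q (level s b) <= e%:E)%E.
Proof. by apply: le_trans (fin_e b); rewrite leeDl// adde_ge0// Lq_ge0. Qed.

Lemma energy_ge0 : 0 <= e.
Proof.
by rewrite -lee_fin; apply: le_trans (chain_energy_le true); exact: chain_energy_ge0.
Qed.

Lemma chain_energy_fin b : (chain_energy (nu2 L) rho q (level s b) < +oo)%E.
Proof. by apply: le_lt_trans (chain_energy_le b) _; rewrite ltry. Qed.

Lemma Lq_path_le t b : 0 <= t -> t <= T ->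
  (Lq (nu2 L) q (chain_limit T (level s b) t) <= (1 ^+ q * (2 ^+ q * ((chain_cst rho q + 1) * e)))%:E)%E.
Proof.
move=> t0 tT.
apply: le_trans (chain_limit_bound T0 q0 r0 r1 (measurable_level s b) (chain_energy_fin b) t0 tT) _.
rewrite expr1n mul1r (EFinM (2 ^+ q)); apply: lee_wpmul2l; first by rewrite lee_fin exprn_ge0.
rewrite mulrDl mul1r EFinD (EFinM (chain_cst rho q)).
have c0 : 0 <= chain_cst rho q by exact: chain_cst_ge0.
apply: leeD.
  by apply: lee_wpmul2l; [rewrite lee_fin|exact: chain_energy_le].
by apply: le_trans (fin_e b); rewrite leeDr// chain_energy_ge0.
Qed.

Lemma path_norm_le p t : 1 <= p -> p <= q%:R -> 0 <= t -> t <= T ->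
  (Lp_norm L p (path s t) <= (2 * 1 * (1 + 2 * (2 ^+ q * ((chain_cst rho q + 1) * e))))%:E)%E.
Proof.
move=> p1 pq t0 tT.
have c0 : 0 <= chain_cst rho q by exact: chain_cst_ge0.
apply: (Lp_norm_le L0 ltr01 _ p1 pq (cmeasurable_path s t)).
- by rewrite mulr_ge0 ?exprn_ge0// mulr_ge0 ?addr_ge0// energy_ge0.
- exact: Lq_path_le.
- exact: Lq_path_le.
Qed.

Lemma path_Lp p t : 1 <= p -> p <= q%:R -> 0 <= t -> t <= T -> Lp_fun L p (path s t).
Proof.
move=> p1 pq t0 tT; split; [exact: periodic_path|exact: cmeasurable_path|].
by apply: le_lt_trans (path_norm_le p1 pq t0 tT) _; rewrite ltry.
Qed.

Lemma Lq_path_close n t r b : 0 <= t -> t <= T -> 0 <= r -> r <= T -> `|t - r| <= T / 2 ^+ n ->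
  (Lq (nu2 L) q (chain_limit T (level s b) t \- chain_limit T (level s b) r)%R <=
    ((rho ^+ n) ^+ q * (holder_cst rho q * e))%:E)%E.
Proof.
wlog rt : t r / r <= t => [W|] t0 tT r0' rT.
  case: (leP r t) => [rt|/ltW tr] tr'; first exact: W.
  by rewrite LqC; apply: W => //; rewrite distrC.
rewrite ger0_norm ?subr_ge0// => tr.
apply: le_trans (chain_limit_holder T0 q0 r0 r1 (measurable_level s b) (chain_energy_fin b) r0' rt tT tr) _.
have h0 : 0 <= holder_cst rho q by exact: holder_cst_ge0.
rewrite mulrA (EFinM _ e); apply: lee_wpmul2l; last exact: chain_energy_le.
by rewrite lee_fin mulr_ge0// !exprn_ge0// ltW.
Qed.

Lemma path_close p n t r : 1 <= p -> p <= q%:R ->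
  0 <= t -> t <= T -> 0 <= r -> r <= T -> `|t - r| <= T / 2 ^+ n ->
  (Lp_norm L p (fun z => path s t z - path s r z)%R <=
    (2 * rho ^+ n * (1 + 2 * (holder_cst rho q * e)))%:E)%E.
Proof.
move=> p1 pq t0 tT r0' rT tr.
apply: (Lp_norm_le L0 _ _ p1 pq).
- by rewrite exprn_gt0.
- by rewrite mulr_ge0 ?energy_ge0// holder_cst_ge0.
- by apply: cmeasurableB; exact: cmeasurable_path.
- under [X in Lq _ _ X]eq_fun do rewrite ReB; exact: (Lq_path_close true t0 tT r0' rT tr).
- under [X in Lq _ _ X]eq_fun do rewrite ImB; exact: (Lq_path_close false t0 tT r0' rT tr).
Qed.

Lemma cintegrable_path t : 0 <= t -> t <= T -> cintegrable (dxdy L) (path s t).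
Proof.
move=> t0 tT; have [m1 m2] := cmeasurable_path s t.
have c0 : 0 <= chain_cst rho q by exact: chain_cst_ge0.
have K0 : 0 <= 2 ^+ q * ((chain_cst rho q + 1) * e).
  by rewrite mulr_ge0 ?exprn_ge0// mulr_ge0 ?addr_ge0// energy_ge0.
split.
  exact: (integrable_dxdy_of_L1 L0 m1 (L1_le L0 ltr01 K0 q0 m1 (Lq_path_le true t0 tT))).
exact: (integrable_dxdy_of_L1 L0 m2 (L1_le L0 ltr01 K0 q0 m2 (Lq_path_le false t0 tT))).
Qed.

Lemma path_rate b n t : 0 <= t -> t <= T ->
  (\int[nu2 L]_z `|component b (path s t z) - component b (approx s n t z)|%:E <=
    (rho ^+ n * (1 + chain_cst rho q * e))%:E)%E.
Proof.
move=> t0 tT.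
have c0 : 0 <= chain_cst rho q by exact: chain_cst_ge0.
have m1 : measurable_fun setT (chain_limit T (level s b) t \- chain T (level s b) t n).
  apply: measurable_funB; last exact: measurable_level.
  by apply: measurable_chain_limit; exact: measurable_level.
under eq_integral do rewrite component_path.
apply: (L1_le L0 _ _ q0 m1); first by rewrite exprn_gt0.
  by rewrite mulr_ge0// energy_ge0.
apply: le_trans (chain_limit_rate T0 q0 r0 r1 (measurable_level s b) (chain_energy_fin b) n t0 tT) _.
rewrite mulrA (EFinM _ e); apply: lee_wpmul2l; last exact: chain_energy_le.
by rewrite lee_fin mulr_ge0// !exprn_ge0// ltW.
Qed.

Lemma fcoef_path_approx k l n t : 0 <= t -> t <= T ->
  cmod (fcoef L (distr_of L (path s t)) k l - fcoef L (distr_of L (approx s n t)) k l) <=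
  rho ^+ n * (8 * L * (1 + chain_cst rho q * e)).
Proof.
move=> t0 tT.
rewrite mulrCA; apply: fcoef_dist => //.
- exact: cintegrable_path.
- exact: cintegrable_wave.
- exact: (path_rate true).
- exact: (path_rate false).
Qed.

End Energy.

Lemma fcoef_approx s k l n t : (`|k| <= 2 ^ n)%N -> (`|l| <= 2 ^ n)%N ->
  fcoef L (distr_of L (approx s n t)) k l = bessel L s k l * fcoef L (distr_of L (approx 0 n t)) k l.
Proof.
move=> kn ln.
have E s' : fcoef L (distr_of L (approx s' n t)) k l =
    bessel L s' k l * j k l (grid T n (dyadic_index T n t)) * ebasis_mass L k l.
  exact: (fcoef_trig L0 (fun k l => bessel L s' k l * j k l (grid T n (dyadic_index T n t))) kn ln).
have E0 : fcoef L (distr_of L (approx 0 n t)) k l =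
    j k l (grid T n (dyadic_index T n t)) * ebasis_mass L k l.
  apply: (etrans (E 0)).
  have -> : bessel L 0 k l = 1 by rewrite /bessel mul0r powRr0.
  by rewrite mul1r.
exact: (etrans (E s) (etrans (esym (mulrA _ _ _)) (congr1 _ (esym E0)))).
Qed.

Lemma eq_of_geometric_approx (x y c : R[i]) (u v : nat -> R[i]) (K K' : R) N :
  (forall n, (N <= n)%N -> u n = c * v n) ->
  (forall n, cmod (x - u n) <= rho ^+ n * K) ->
  (forall n, cmod (y - v n) <= rho ^+ n * K') -> x = c * y.
Proof.
move=> uv xu yv.
have cmodD (a b : R[i]) : cmod (a + b) <= cmod a + cmod b by exact: le_normcD.
apply/eqP; rewrite -subr_eq0; apply/eqP; apply: ComplexField.Normc.eq0_normc.
have bnd n : (N <= n)%N -> cmod (x - c * y) <= (K + cmod c * K') * rho ^+ n.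
  move=> /uv E.
  have -> : x - c * y = (x - u n) + (- c * (y - v n)) by rewrite E; ring.
  apply: le_trans (cmodD _ _) _; rewrite cmodM.
  have -> : cmod (- c) = cmod c by exact: normcN.
  rewrite mulrDl; apply: lerD; first by rewrite mulrC.
  by rewrite -mulrA; apply: ler_wpM2l; [exact: cmod_ge0|rewrite mulrC].
apply/eqP; rewrite eq_le; apply/andP; split; last exact: cmod_ge0.
have cK : (K + cmod c * K') * rho ^+ n @[n --> \oo] --> (0 : R).
  rewrite -[X in _ --> X](mulr0 (K + cmod c * K')); apply: cvgM; first exact: cvg_cst.
  by apply: cvg_expr; rewrite gtr0_norm.
rewrite -(cvg_lim _ cK)//; apply: limr_ge; first exact: cvgP cK.
near=> n; apply: bnd; near: n; exact: nbhs_infty_ge.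
Unshelve. all: by end_near.
Qed.

Lemma path_represents s e e' t : (forall b, (path_energy s b <= e%:E)%E) ->
  (forall b, (path_energy 0 b <= e'%:E)%E) -> 0 <= t -> t <= T ->
  represents_bessel L s (distr_of L (path 0 t)) (path s t).
Proof.
move=> fe fe' t0 tT k l.
(* From this level on the mode lies in the box, and the relation between the two truncated fields is
   exact. *)
have dom n : (`|k| + `|l| <= n)%N -> (`|k| <= 2 ^ n)%N /\ (`|l| <= 2 ^ n)%N.
  by have := ltn_expl n (isT : (1 < 2)%N); lia.
apply: (@eq_of_geometric_approx _ _ _ _ _ _ _ (`|k| + `|l|)%N _
  (fun n => fcoef_path_approx fe k l n t0 tT) (fun n => fcoef_path_approx fe' k l n t0 tT)).
by move=> n /dom[kn ln]; exact: fcoef_approx.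
Qed.

Lemma W_norm_le s p u (g : R * R -> R[i]) K : Lp_fun L p g -> represents_bessel L s u g ->
  (Lp_norm L p g <= K)%E -> (W_norm L s p u <= K)%E.
Proof.
by move=> gp gs gK; apply: le_trans gK; apply: ereal_inf_lbound; exists g.
Qed.

(** The upper bound on [x] lets the chain at level [n] compare the two times; the lower bound
    converts the rate [rho ^+ n] back into a power of their distance. *)
Lemma dyadic_scale x : 0 < x -> x <= T -> exists n : nat, T / 2 ^+ n.+1 < x /\ x <= T / 2 ^+ n.
Proof.
move=> x0 xT.
have ex : exists n, T / 2 ^+ n.+1 < x.
  have := near_infty_natSinv_expn_lt (PosNum (divr_gt0 x0 T0)).
  move=> [N _ /(_ N (leqnn N))] /= h; exists N.
  rewrite ltr_pdivrMr ?exprn_gt0//.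
  move: h; rewrite ltr_pdivlMr// mulrC div1r ltr_pdivrMr ?exprn_gt0// => /lt_trans; apply.
  by rewrite ltr_pM2l// ltr_eXn2l ?ltr1n.
have := ex_minnP ex => -[n nx nmin]; exists n; split => //.
case: n nx nmin => [|n] nx nmin; first by rewrite expr0 divr1.
by rewrite leNgt; apply/negP => /nmin; rewrite ltnn.
Qed.

Lemma path_holder_W s alpha p : 1 <= p -> p <= q%:R -> 0 < alpha -> rho = 2 `^ (- alpha) ->
  (forall b, (path_energy s b < +oo)%E) -> (forall b, (path_energy 0 b < +oo)%E) ->
  holder_W L T alpha s p (fun t => distr_of L (path 0 t)).
Proof.
move=> p1 pq a0 rhoE fs f0.
have ex s' : (forall b, (path_energy s' b < +oo)%E) -> exists e, forall b, (path_energy s' b <= e%:E)%E.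
  move=> f; have E0 := path_energy_ge0 s'.
  exists (fine (path_energy s' true) + fine (path_energy s' false)).
  have fi b : path_energy s' b = (fine (path_energy s' b))%:E by rewrite fineK// ge0_fin_numE.
  have g0 b : 0 <= fine (path_energy s' b) by rewrite fine_ge0.
  by case; rewrite fi lee_fin ?lerDl ?lerDr.
have [e fe] := ex _ fs; have [e' fe'] := ex _ f0.
split.
  move=> t /andP[t0 tT]; split.
    by apply: distr_of_periodic; apply: (cintegrable_path fe').
  apply: (@le_lt_trans _ _ (Lp_norm L p (path s t))).
    by apply: (@W_norm_le _ _ _ (path s t)) => //; [exact: (path_Lp fe)|exact: (path_represents fe fe')].
  by have [_ _] := path_Lp fe p1 pq t0 tT.
(* The factor with base [2 / T] comes from [T / 2 ^+ n.+1 < |t - r|], that is, [2 ^- n] is below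
   [2 / T * |t - r|], while [rho ^+ n] is [2 ^- n] to the power [alpha]. *)
exists (2 * (2 / T) `^ alpha * (1 + 2 * (holder_cst rho q * e))) => t r /andP[t0 tT] /andP[r0' rT] tr.
have tr0 : 0 < `|t - r| by rewrite normr_gt0 subr_eq0.
have trT : `|t - r| <= T by rewrite ler_norml; apply/andP; split; lra.
have [n [n1 n2]] := dyadic_scale tr0 trT.
have Kn := path_close fe p1 pq t0 tT r0' rT n2.
have e0 := energy_ge0 fe; have h0 : 0 <= holder_cst rho q by exact: holder_cst_ge0.
apply: (@W_norm_le _ _ _ (fun z => path s t z - path s r z)).
- split; last by apply: le_lt_trans Kn _; rewrite ltry.
    move=> x y; have [h1 h2] := periodic_path s t x y; have [h3 h4] := periodic_path s r x y.
    by split; rewrite ?h1 ?h2 ?h3 ?h4.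
  by apply: cmeasurableB; exact: cmeasurable_path.
- move=> k l.
  have it := cintegrable_path fe t0 tT; have ir := cintegrable_path fe r0' rT.
  apply: (etrans (fcoef_distrB L0 k l it ir)).
  have h1 := path_represents fe fe' t0 tT k l; have h2 := path_represents fe fe' r0' rT k l.
  exact: (etrans (congr2 (fun x y => x - y) h1 h2) (esym (mulrBr _ _ _))).
- apply: le_trans Kn _; rewrite lee_fin.
  have K0 : 0 <= 1 + 2 * (holder_cst rho q * e) by rewrite addr_ge0// mulr_ge0// mulr_ge0.
  rewrite [leRHS]mulrAC; apply: ler_wpM2r; first exact: K0.
  rewrite -mulrA ler_pM2l// -powRM ?divr_ge0 ?(ltW T0)//.
  have -> : rho ^+ n = (2 ^- n) `^ alpha.
    rewrite rhoE -powR_mulrn ?powR_ge0// -powRrM -[2 ^- n]powR_inv1 ?exprn_ge0//.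
    rewrite -[2 ^+ n]powR_mulrn// -!powRrM; congr (_ `^ _); ring.
  apply: ge0_ler_powR; rewrite ?nnegrE ?(ltW a0) ?invr_ge0 ?exprn_ge0//.
    by rewrite mulr_ge0// divr_ge0// ltW.
  move: n1; rewrite exprS ltr_pdivrMr ?mulr_gt0 ?exprn_gt0// => n1.
  rewrite -[leLHS]mul1r ler_pdivrMr ?exprn_gt0//.
  rewrite -(ler_pM2l T0) mulr1; apply: le_trans (ltW n1) _.
  rewrite le_eqVlt; apply/orP; left; apply/eqP; field; by rewrite gt_eqF.
Qed.

End Path.

(** * Moments of the truncated random field *)

Section RandomPath.
Context {d : measure_display} {R : realType} {Omega : measurableType d}.
Variable P : probability Omega R.
Variable beta : int -> int -> R -> Omega -> R[i].
Hypothesis Wbeta : cylindrical_wiener P beta.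
Variables (L T : R).
Hypotheses (L0 : 0 < L) (T0 : 0 < T).
Variable J : int -> int -> R -> Omega -> R[i].
Hypothesis HJ : forall k l t, 0 <= t -> t <= T ->
  wiener_image P beta (k, l) (heat L t k l) (J k l t).

(** Multiplication by [-i] turns the imaginary part into a real part, to which the moment bound
    applies. *)
Definition unit_part (b : bool) : R[i] := if b then 1 else Complex 0 (- 1).

Lemma componentE b (x : R[i]) : component b x = complex.Re (unit_part b * x).
Proof.
by case: b; rewrite ReM /=; case: x => x y /=; rewrite ?mul1r ?mul0r ?subr0 ?mulN1r ?sub0r ?opprK.
Qed.

Definition mode (s : R) (b : bool) (z : R * R) (i : int * int) : R[i] :=
  unit_part b * (bessel L s i.1 i.2 * ebasis L i.1 i.2 z).

Lemma cmod_mode_sqr s b z i :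
  cmod (mode s b z i) ^+ 2 = symbol L i.1 i.2 `^ s * (2 * L)^-1 ^+ 2.
Proof.
rewrite /mode !cmodM !exprMn cmod_bessel_sqr cmod_ebasis_sqr//.
have -> : cmod (unit_part b) ^+ 2 = 1.
  by rewrite cmod_sqr; case: b => /=; rewrite ?sqrrN ?expr1n ?expr0n ?addr0 ?add0r.
by rewrite mul1r.
Qed.

Lemma component_wave (j : int -> int -> R -> R[i]) s b N t z :
  component b (wave L j s N t z) =
  complex.Re (\sum_(i <- box N) mode s b z i * j i.1 i.2 t).
Proof.
rewrite componentE /wave /trig -(sum_box N (fun k l => bessel L s k l * j k l t * ebasis L k l z)).
congr complex.Re; rewrite mulr_sumr; apply: eq_bigr => i _.
by rewrite /mode -!mulrA; congr (_ * (_ * _)); rewrite mulrC.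
Qed.

Lemma component_wave_increment (j : int -> int -> R -> R[i]) s b N t r z :
  component b (wave L j s N t z) - component b (wave L j s N r z) =
  complex.Re (\sum_(i <- box N) mode s b z i * (j i.1 i.2 t - j i.1 i.2 r)).
Proof.
rewrite !component_wave -ReB -sumrB; congr complex.Re; apply: eq_bigr => i _.
by rewrite mulrBr.
Qed.

Lemma component_wave_level (j : int -> int -> R -> R[i]) s b N N' t z : (N <= N')%N ->
  component b (wave L j s N' t z) - component b (wave L j s N t z) =
  complex.Re (\sum_(i <- [seq i <- box N' | i \notin box N]) mode s b z i * j i.1 i.2 t).
Proof.
move=> NN'; rewrite !component_wave -ReB; congr complex.Re.
rewrite big_filter (bigID (mem (box N)) predT)/=.
suff -> : \sum_(i <- box N' | i \in box N) mode s b z i * j i.1 i.2 t =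
    \sum_(i <- box N) mode s b z i * j i.1 i.2 t by ring.
rewrite -[LHS]big_filter; apply: perm_big; apply: uniq_perm.
- by rewrite filter_uniq// box_uniq.
- exact: box_uniq.
- move=> i; rewrite mem_filter andb_idr// !mem_box => /andP[h1 h2].
  by rewrite !(leq_trans _ NN').
Qed.

Lemma mode_moment m s b z (F : seq (int * int)) f v (I : int * int -> Omega -> R[i]) V :
  uniq F -> (forall i, wiener_image P beta i (f i) (I i)) ->
  (forall i, measurable_fun setT (f i)) ->
  (forall i, (\int[lebesgue_measure]_r (f i r ^+ 2)%:E <= (v i)%:E)%E) ->
  2 * \sum_(i <- F) (symbol L i.1 i.2 `^ s * (2 * L)^-1 ^+ 2) * v i < V ->
  (\int[P]_w ((complex.Re (\sum_(i <- F) mode s b z i * I i w)) ^+ (2 * m))%:E <=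
    (moment_cst m * V ^+ m)%:E)%E.
Proof.
move=> uF If mf vf V2.
apply: (@wiener_image_moment _ _ _ P beta Wbeta m F (mode s b z) f v I V) => //.
by under eq_bigr do rewrite cmod_mode_sqr.
Qed.

Lemma wave_moment m s b z N t V : 0 <= t -> t <= T ->
  2 * \sum_(i <- box N) (symbol L i.1 i.2 `^ s * (2 * L)^-1 ^+ 2) * (expR (4 * T) / symbol L i.1 i.2) < V ->
  (\int[P]_w ((component b (wave L (fun k l u => J k l u w) s N t z)) ^+ (2 * m))%:E <=
    (moment_cst m * V ^+ m)%:E)%E.
Proof.
move=> t0 tT V2; under eq_integral do rewrite component_wave.
apply: (mode_moment m b z (I := fun i => J i.1 i.2 t) (f := fun i => heat L t i.1 i.2)
  (v := fun i => expR (4 * T) / symbol L i.1 i.2)) => //.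
- exact: box_uniq.
- by move=> [k l]; exact: HJ.
- by move=> i; exact: measurable_heat.
- by move=> i; exact: heat_energy_le.
Qed.

Lemma wave_level_moment m s b z N N' t V : 0 <= t -> t <= T -> (N <= N')%N ->
  2 * \sum_(i <- [seq i <- box N' | i \notin box N])
     (symbol L i.1 i.2 `^ s * (2 * L)^-1 ^+ 2) * (expR (4 * T) / symbol L i.1 i.2) < V ->
  (\int[P]_w ((component b (wave L (fun k l u => J k l u w) s N' t z) -
      component b (wave L (fun k l u => J k l u w) s N t z)) ^+ (2 * m))%:E <=
    (moment_cst m * V ^+ m)%:E)%E.
Proof.
move=> t0 tT NN' V2; under eq_integral do rewrite component_wave_level//.
apply: (mode_moment m b z (I := fun i => J i.1 i.2 t) (f := fun i => heat L t i.1 i.2)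
  (v := fun i => expR (4 * T) / symbol L i.1 i.2)) => //.
- by rewrite filter_uniq// box_uniq.
- by move=> [k l]; exact: HJ.
- by move=> i; exact: measurable_heat.
- by move=> i; exact: heat_energy_le.
Qed.

Lemma wave_increment_moment m s theta b z N t r V : 0 < theta -> theta <= 1 ->
  0 <= r -> r <= t -> t <= T ->
  2 * \sum_(i <- box N) (symbol L i.1 i.2 `^ s * (2 * L)^-1 ^+ 2) *
    (2 * expR (6 * T) * ((t - r) * symbol L i.1 i.2) `^ theta / symbol L i.1 i.2) < V ->
  (\int[P]_w ((component b (wave L (fun k l u => J k l u w) s N t z) -
      component b (wave L (fun k l u => J k l u w) s N r z)) ^+ (2 * m))%:E <=
    (moment_cst m * V ^+ m)%:E)%E.
Proof.
move=> th0 th1 r0 rt tT V2; under eq_integral do rewrite component_wave_increment.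
have t0 := le_trans r0 rt; have rT := le_trans rt tT.
apply: (mode_moment m b z (I := fun i w => J i.1 i.2 t w - J i.1 i.2 r w)
  (f := fun i u => heat L t i.1 i.2 u - heat L r i.1 i.2 u)
  (v := fun i => 2 * expR (6 * T) * ((t - r) * symbol L i.1 i.2) `^ theta / symbol L i.1 i.2)) => //.
- exact: box_uniq.
- by move=> [k l]; apply: (wiener_imageB Wbeta (measurable_heat L t k l) (measurable_heat L r k l)); exact: HJ.
- by move=> i; apply: measurable_funB; exact: measurable_heat.
- by move=> i; exact: heat_increment_energy_le.
Qed.

Lemma moment_cst_ge0 m : 0 <= moment_cst m :> R.
Proof. by rewrite /moment_cst !mulr_ge0// expR_ge0. Qed.

Lemma measurable_section (g : Omega * plane R -> R) (w : Omega) : measurable_fun setT g ->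
  measurable_fun setT (fun z : plane R => g (w, z)).
Proof. by move=> mg; apply: measurableT_comp mg _; exact: pair1_measurable. Qed.

Lemma measurable_Lq_section m (g : Omega * plane R -> R) : measurable_fun setT g ->
  measurable_fun setT (fun w => Lq (nu2 L) m (fun z => g (w, z))).
Proof.
move=> mg; apply: (@measurable_integral_section _ _ _ _ _ (nu2 L) _ (fun x => (`|g x| ^+ m)%:E)).
- by rewrite nu2_setT// ltry.
- exact: measurable_Lq_integrand.
- by move=> x; rewrite lee_fin exprn_ge0.
Qed.

(** Tonelli's theorem exchanges expectation and torus integral; since [nu2] has total mass 1, a
    bound uniform in the point is not altered by integration. *)
Lemma expected_Lq_le m (g : Omega * plane R -> R) K : measurable_fun setT g -> 0 <= K ->
  (forall z, \int[P]_w (g (w, z) ^+ (2 * m))%:E <= K%:E)%E ->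
  (\int[P]_w Lq (nu2 L) (2 * m) (fun z => g (w, z)) <= K%:E)%E.
Proof.
move=> mg K0 gK.
have mf : measurable_fun setT (fun x => (`|g x| ^+ (2 * m))%:E) by exact: measurable_Lq_integrand.
have f0 x : (0 <= (`|g x| ^+ (2 * m))%:E)%E by rewrite lee_fin exprn_ge0.
have nf : (nu2 L setT < +oo)%E by rewrite nu2_setT// ltry.
rewrite /Lq (tonelli_finite P nf mf f0).
apply: (@le_trans _ _ (\int[nu2 L]_z (cst K%:E z)))%E.
  apply: ge0_le_integralT => //.
  - exact: (measurable_expectation_section P mf f0).
  - by move=> z; exact: integral_ge0.
  - move=> z; apply: le_trans (gK z); rewrite le_eqVlt; apply/orP; left; apply/eqP.
    by apply: eq_integral => w _; rewrite !exprM real_normK// num_real.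
by rewrite integral_cst// nu2_setT// mule1.
Qed.

End RandomPath.

(** * Joint measurability of the limit field *)

Section JointMeasurability.
Context {d : measure_display} {R : realType} {Omega : measurableType d}.
Variables (L T : R) (s : R).
Hypothesis T0 : 0 < T.
Variable J : int -> int -> R -> Omega -> R[i].
Hypothesis mJ : forall k l t, 0 <= t -> t <= T -> cmeasurable (J k l t).

Lemma cmeasurable_wave_joint N t : 0 <= t -> t <= T ->
  cmeasurable (fun wz : Omega * plane R => wave L (fun k l u => J k l u wz.1) s N t wz.2).
Proof.
move=> t0 tT; apply: cmeasurable_sum => k; apply: cmeasurable_sum => l.
apply: cmeasurableM; first apply: cmeasurableM; first exact: cmeasurable_cst.
  exact: (cmeasurable_comp (mJ k l t0 tT) measurable_fst).
exact: (cmeasurable_comp (measurable_ebasis L k l) measurable_snd).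
Qed.

Lemma measurable_level_joint b n i : measurable_fun setT
  (fun wz : Omega * plane R => level L T (fun k l u => J k l u wz.1) s b n i wz.2).
Proof.
have [g0 gT] := grid_itv T0 n i.
by apply: measurable_component; exact: cmeasurable_wave_joint.
Qed.

(** The chaining limit is formed on the product space itself, so its measurability there is that of
    a limit superior of jointly measurable levels. *)
Lemma cmeasurable_path_joint t :
  cmeasurable (fun wz : Omega * plane R => path L T (fun k l u => J k l u wz.1) s t wz.2).
Proof.
split.
  exact: (measurable_chain_limit T (measurable_level_joint true) t).
exact: (measurable_chain_limit T (measurable_level_joint false) t).
Qed.

Lemma measurable_path_energy rho q b : 0 < L -> 0 < rho ->
  measurable_fun setT (fun w => path_energy L T rho q (fun k l u => J k l u w) s b).
Proof.
move=> L0 r0.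
have mdiff n i n' i' : measurable_fun setT (fun w => Lq (nu2 L) q
    (level L T (fun k l u => J k l u w) s b n i \- level L T (fun k l u => J k l u w) s b n' i')%R).
  apply: (measurable_Lq_section L0 q (g := fun wz => level L T (fun k l u => J k l u wz.1) s b n i wz.2 -
    level L T (fun k l u => J k l u wz.1) s b n' i' wz.2)).
  by apply: measurable_funB; exact: measurable_level_joint.
have m1 n i : measurable_fun setT (fun w => Lq (nu2 L) q (level L T (fun k l u => J k l u w) s b n i)).
  exact: (measurable_Lq_section L0 q (measurable_level_joint b n i)).
apply: emeasurable_funD; last exact: emeasurable_funD.
apply: ge0_emeasurable_sum => [n w _ _|n _]; first exact: weighted_variation_ge0.
apply: emeasurable_funM => //; apply: emeasurable_funD; apply: emeasurable_sum => i; exact: mdiff.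
Qed.

End JointMeasurability.

(** * Finite expected energy *)

Section ExpectedEnergy.
Context {R : realType}.
Variables (L T s theta rho : R) (m : nat).
Hypotheses (L0 : 0 < L) (T0 : 0 < T) (s0 : 0 <= s) (th0 : 0 < theta)
  (sth : theta < 4^-1 - s) (r0 : 0 < rho).
(** Growth per level of the expected energy: the weight contributes [rho^-1 ^+ (2 * m)], the number
    of grid points 2, and the [m]-th power of the variance the rest. *)
Let ratio : R := rho^-1 ^+ (2 * m) * 2 * (2^-1 `^ theta) ^+ m.
Hypothesis ratio1 : ratio < 1.

Lemma powR_exprn (x : R) n : 0 <= x -> (x ^+ n) `^ theta = (x `^ theta) ^+ n.
Proof.
move=> x0; elim: n => [|n IH]; first by rewrite !expr0 powR1.
by rewrite !exprS powRM ?exprn_ge0// IH.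
Qed.

(** [B] is quantified before the probability space and the noise, so that the constant obtained from
    it depends on neither. *)
Lemma expected_path_energy : exists2 B : R, 0 <= B &
  forall (d : measure_display) (Omega : measurableType d) (P : probability Omega R)
    (beta : int -> int -> R -> Omega -> R[i]) (J : int -> int -> R -> Omega -> R[i]),
  cylindrical_wiener P beta ->
  (forall k l t, 0 <= t -> t <= T -> wiener_image P beta (k, l) (heat L t k l) (J k l t)) ->
  forall b, (\int[P]_w path_energy L T rho (2 * m) (fun k l t => J k l t w) s b <= B%:E)%E.
Proof.
have [Ct Ct0 HCt] := time_variance T L0 sth.
have [Cl Cl0 HCl] := level_variance T L0 th0 sth.
have [Cs Cs0 HCs] := static_variance T L0 th0 sth.
(* Common majorant of the three variance constants, doubled as the moment bound requires; the final
   1 makes the inequalities strict. The power of [T] accounts for the mesh [T / 2 ^+ n]. *)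
pose D := 2 * (Ct * T `^ theta + Cl + Cs) + 1.
have CT0 : 0 <= Ct * T `^ theta by rewrite mulr_ge0// powR_ge0.
have D0 : 0 < D by rewrite /D; lra.
pose g := 2^-1 `^ theta : R.
have g0 : 0 < g by rewrite powR_gt0.
pose V n := D * g ^+ n.
have V0 n : 0 <= V n by rewrite mulr_ge0 ?exprn_ge0// ltW.
have c0 : 0 <= moment_cst m :> R by exact: moment_cst_ge0.
pose K n := moment_cst m * V n ^+ m.
have K0 n : 0 <= K n by rewrite mulr_ge0// exprn_ge0.
have ratio0 : 0 < ratio by rewrite !mulr_gt0 ?exprn_gt0 ?invr_gt0.
(* The 3 bounds the [2 ^ n + (2 ^ n + 1)] variations at level [n] by [3 * 2 ^ n]; the last two terms
   are for the norms at level 0. *)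
exists (3 * K 0%N * (1 - ratio)^-1 + (K 0%N + K 0%N)).
  have i0 : 0 <= (1 - ratio)^-1 by rewrite invr_ge0 subr_ge0 ltW.
  apply: addr_ge0; last by apply: addr_ge0; exact: K0.
  by apply: mulr_ge0 => //; apply: mulr_ge0 => //; exact: K0.
move=> d Omega P beta J Wbeta HJ b.
have th1 : theta <= 1 by move: sth s0; lra.
have mJ k l t : 0 <= t -> t <= T -> cmeasurable (J k l t) by move=> t0 tT; have [] := HJ k l t t0 tT.
pose j w k l t := J k l t w.
pose lev n i (wz : Omega * plane R) : R := level L T (j wz.1) s b n i wz.2.
have mlev n i : measurable_fun setT (lev n i) by exact: measurable_level_joint.
have small n (C x : R) : 0 <= C -> 2 * C < D -> x <= C * g ^+ n -> 2 * x < V n.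
  move=> C0' CD xC; apply: (@le_lt_trans _ _ (2 * C * g ^+ n)); first by rewrite -mulrA ler_pM2l.
  by rewrite ltr_pM2r// exprn_gt0.
have tv n i : (\int[P]_w Lq (nu2 L) (2 * m) (fun z => (lev n i.+1 \- lev n i)%R (w, z)) <= (K n)%:E)%E.
  have [g1 g1T] := grid_itv T0 n i; have [g2 g2T] := grid_itv T0 n i.+1.
  have [gS gS'] := gridS T0 n i.
  apply: expected_Lq_le => //; first exact: measurable_funB.
  move=> z; apply: (wave_increment_moment Wbeta HJ m b z th0 th1 g1 gS g2T).
  apply: (small n (Ct * T `^ theta)) => //; first by rewrite /D; lra.
  apply: le_trans (HCt _ _ _ g1 gS g2T) _; rewrite -mulrA; apply: ler_wpM2l => //.
  rewrite -powR_exprn// -powRM ?exprn_ge0 ?(ltW T0)//.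
  apply: ge0_ler_powR; rewrite ?nnegrE ?subr_ge0 ?(ltW th0)//.
    by rewrite mulr_ge0 ?exprn_ge0// ltW.
  by rewrite exprVn.
have lv n i : (\int[P]_w Lq (nu2 L) (2 * m) (fun z => (lev n.+1 (2 * i)%N \- lev n i)%R (w, z)) <= (K n)%:E)%E.
  have [g1 g1T] := grid_itv T0 n i.
  apply: expected_Lq_le => //; first exact: measurable_funB.
  move=> z; rewrite /lev /level grid_double.
  apply: (wave_level_moment Wbeta HJ m b z g1 g1T); first by rewrite leq_exp2l.
  apply: (small n Cl) => //; first by rewrite /D; lra.
  by apply: le_trans (HCl n) _; rewrite powR_exprn.
have st i : (\int[P]_w Lq (nu2 L) (2 * m) (fun z => lev 0%N i (w, z)) <= (K 0%N)%:E)%E.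
  have [g1 g1T] := grid_itv T0 0 i.
  apply: expected_Lq_le => // z.
  apply: (wave_moment Wbeta HJ m b z g1 g1T).
  apply: (small 0%N Cs) => //; first by rewrite /D; lra.
  by rewrite expr0 mulr1; exact: HCs.
have mLq (f : Omega * plane R -> R) : measurable_fun setT f -> measurable_fun setT (fun w => Lq (nu2 L) (2 * m) (fun z => f (w, z))).
  by move=> mf; exact: (measurable_Lq_section L0 (2 * m) mf).
have mtv n : measurable_fun setT (fun w => time_variation (nu2 L) (2 * m) (level L T (j w) s b) n).
  apply: emeasurable_sum => i; apply: (mLq (lev n i.+1 \- lev n i)%R); exact: measurable_funB.
have mlv n : measurable_fun setT (fun w => level_variation (nu2 L) (2 * m) (level L T (j w) s b) n).
  apply: emeasurable_sum => i; apply: (mLq (lev n.+1 (2 * i)%N \- lev n i)%R); exact: measurable_funB.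
have w0 n : 0 <= (rho^-1 ^+ n) ^+ (2 * m) by rewrite !exprn_ge0// invr_ge0 ltW.
have ml0 i : measurable_fun setT (fun w => Lq (nu2 L) (2 * m) (level L T (j w) s b 0%N i)) by exact: (mLq (lev 0%N i)).
have mW n : measurable_fun setT (fun w => ((rho^-1 ^+ n) ^+ (2 * m))%:E *
    (time_variation (nu2 L) (2 * m) (level L T (j w) s b) n + level_variation (nu2 L) (2 * m) (level L T (j w) s b) n))%E.
  by apply: emeasurable_funM => //; exact: emeasurable_funD.
rewrite ge0_integralDT; first last.
- by move=> w; rewrite adde_ge0// Lq_ge0.
- by move=> w; exact: chain_energy_ge0.
- exact: emeasurable_funD.
- by apply: ge0_emeasurable_sum => // n w _ _; exact: weighted_variation_ge0.
rewrite EFinD; apply: leeD; last first.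
  rewrite ge0_integralDT//; last 2 first.
  - by move=> w; exact: Lq_ge0.
  - by move=> w; exact: Lq_ge0.
  by rewrite EFinD; apply: leeD; exact: st.
rewrite /chain_energy integral_nneseries//; last first.
  by move=> n w _; exact: weighted_variation_ge0.
apply: (@le_trans _ _ (\sum_(0 <= n <oo) ((3 * K 0%N)%:E * (ratio ^+ n)%:E))%E); last first.
  rewrite nneseriesZl; last by move=> n _; rewrite lee_fin exprn_ge0// ltW.
  rewrite (EFinM (3 * K 0%N)); apply: lee_wpmul2l; first by rewrite lee_fin mulr_ge0.
  exact: nneseries_geometric_le.
apply: lee_nneseries => [n _ _|n _].
  by apply: integral_ge0 => w _; exact: weighted_variation_ge0.
rewrite ge0_integralZT//; last 2 first.
- exact: emeasurable_funD.
- by move=> w; rewrite adde_ge0 ?time_variation_ge0 ?level_variation_ge0.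
rewrite ge0_integralDT//; last 2 first.
- by move=> w; exact: time_variation_ge0.
- by move=> w; exact: level_variation_ge0.
have sumK N (f : nat -> Omega * plane R -> R) : (forall i, measurable_fun setT (f i)) ->
    (forall i, \int[P]_w Lq (nu2 L) (2 * m) (fun z => f i (w, z)) <= (K n)%:E)%E ->
    (\int[P]_w \sum_(i < N) Lq (nu2 L) (2 * m) (fun z => f i (w, z)) <= (N%:R * K n)%:E)%E.
  move=> mf fK; rewrite ge0_integral_sum//; last 2 first.
  - by move=> i; exact: mLq.
  - by move=> i w _; exact: Lq_ge0.
  apply: (@le_trans _ _ (\sum_(i < N) (K n)%:E)%E); first by apply: lee_sum => i _; exact: fK.
  by rewrite sumEFin sumr_const card_ord mulr_natl.
apply: (@le_trans _ _ (((rho^-1 ^+ n) ^+ (2 * m))%:E * (((2 ^ n)%:R * K n)%:E + ((2 ^ n).+1%:R * K n)%:E))%E).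
  apply: lee_wpmul2l; first by rewrite lee_fin.
  apply: leeD.
    apply: (sumK _ (fun i => lev n i.+1 \- lev n i)%R) => // i; exact: measurable_funB.
  apply: (sumK _ (fun i => lev n.+1 (2 * i)%N \- lev n i)%R) => // i; exact: measurable_funB.
rewrite -EFinD -!EFinM lee_fin -mulrDl.
have p1 : 1 <= 2 ^+ n :> R by rewrite exprn_ege1// ler1n.
have -> : ratio ^+ n = (rho^-1 ^+ n) ^+ (2 * m) * 2 ^+ n * (g ^+ n) ^+ m.
  by rewrite /ratio !exprMn -!exprM [(2 * m * n)%N]mulnC [(m * n)%N]mulnC.
have -> : K n = K 0%N * (g ^+ n) ^+ m by rewrite /K /V expr0 mulr1 exprMn mulrA.
have -> : 3 * K 0%N * ((rho^-1 ^+ n) ^+ (2 * m) * 2 ^+ n * (g ^+ n) ^+ m) =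
   (rho^-1 ^+ n) ^+ (2 * m) * ((3 * 2 ^+ n) * (K 0%N * (g ^+ n) ^+ m)) by ring.
apply: ler_wpM2l; first exact: w0.
apply: ler_wpM2r; first by rewrite mulr_ge0 ?exprn_ge0// ltW.
by rewrite -[(_).+1%:R]natr1 natrX; lra.
Qed.

End ExpectedEnergy.

(** * Limits inferior of iterated integrals *)

Lemma limn_einf_ge_near (R : realType) (u : nat -> \bar R) (K : \bar R) :
  (\forall n \near \oo, (K <= u n)%E) -> (K <= limn_einf u)%E.
Proof.
case=> N _ NP; rewrite limn_einf_lim; apply: lime_ge; first exact: is_cvg_einfs.
exists N => // n /= Nn; apply: le_ereal_inf_tmp => _ [k /= nk <-].
by apply: NP; exact: leq_trans nk.
Qed.

Lemma integral_double_sum (d : measure_display) (R : realType) (X : measurableType d)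
    (mu : {measure set X -> \bar R}) (u v : X -> \bar R) :
  measurable_fun setT u -> measurable_fun setT v ->
  (forall x, 0 <= u x)%E -> (forall x, 0 <= v x)%E ->
  (\int[mu]_x (2%:E * u x + 2%:E * v x) = 2%:E * \int[mu]_x u x + 2%:E * \int[mu]_x v x)%E.
Proof.
move=> mu_ mv u0 v0; rewrite ge0_integralDT ?ge0_integralZT//.
- exact: emeasurable_funM.
- exact: emeasurable_funM.
- by move=> x; rewrite mule_ge0// lee_fin.
- by move=> x; rewrite mule_ge0// lee_fin.
Qed.

Section FatouIterated.
Context {d d' : measure_display} {R : realType} {Omega : measurableType d}
  {X : measurableType d'}.
Variables (P : probability Omega R) (mu : {measure set X -> \bar R}).
Hypothesis mu_fin : (mu setT < +oo)%E.

(** Fatou's lemma is used twice, over the space and over the probability space. A limit inferior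
    equal to 0 is enough to identify limits, without choosing a subsequence. *)
Lemma ae_limn_einf_eq0 (f : nat -> Omega * X -> \bar R) :
  (forall n, measurable_fun setT (f n)) -> (forall n x, (0 <= f n x)%E) ->
  (\int[P]_w \int[mu]_z f n (w, z) @[n --> \oo] --> 0)%E ->
  {ae P, forall w, {ae mu, forall z, limn_einf (fun n => f n (w, z)) = 0%E}}.
Proof.
move=> mf f0 f_cvg.
pose F x := limn_einf (f ^~ x).
have mF : measurable_fun setT F by exact: measurable_fun_limn_einf.
have F0 x : (0 <= F x)%E by exact: limn_einf_ge0.
have msec (g : Omega * X -> \bar R) w : measurable_fun setT g -> measurable_fun setT (fun z => g (w, z)).
  by move=> mg; apply: measurableT_comp mg _; exact: pair1_measurable.
pose I w := (\int[mu]_z F (w, z))%E.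
have mI : measurable_fun setT I by exact: measurable_integral_section.
have I0 w : (0 <= I w)%E by exact: integral_ge0.
have PI0 : (\int[P]_w I w = 0)%E.
  apply/eqP; rewrite eq_le integral_ge0// andbT.
  have mIn n : measurable_fun setT (fun w => \int[mu]_z f n (w, z))%E by exact: measurable_integral_section.
  apply: (@le_trans _ _ (\int[P]_w limn_einf (fun n => \int[mu]_z f n (w, z)))%E).
    apply: ge0_le_integralT => //.
    - exact: (measurable_fun_limn_einf mIn).
    - move=> w; apply: (fatou mu measurableT (f := fun n z => f n (w, z))) => // n; exact: msec.
  apply: le_trans (fatou P measurableT mIn _) _.
    by move=> n w _; exact: integral_ge0.
  by have [-> _] := cvg_limn_einf_sup f_cvg.
have : ae_eq P setT I (cst 0%E).
  apply/(ae_eq_integral_abs P measurableT mI).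
  by under eq_integral do rewrite gee0_abs//.
apply: filterS => w /(_ Logic.I) Iw0.
have : ae_eq mu setT (fun z => F (w, z)) (cst 0%E).
  apply/(ae_eq_integral_abs mu measurableT (msec _ w mF)).
  by under eq_integral do rewrite gee0_abs//.
by apply: filterS => z /(_ Logic.I).
Qed.

End FatouIterated.

(** * The limit field is a modification of the solution *)

Section Modification.
Context {d : measure_display} {R : realType} {Omega : measurableType d}.
Variable P : probability Omega R.
Variable beta : int -> int -> R -> Omega -> R[i].
Hypothesis Wbeta : cylindrical_wiener P beta.
Variables (L T rho s theta p : R) (q : nat).
Hypotheses (L0 : 0 < L) (T0 : 0 < T) (q0 : (0 < q)%N) (r0 : 0 < rho) (r1 : rho < 1)
  (th0 : 0 < theta) (th4 : theta < 4^-1).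
Hypotheses (p1 : 1 <= p) (pq : p <= q%:R).
Variable J : int -> int -> R -> Omega -> R[i].
Hypothesis HJ : forall k l t, 0 <= t -> t <= T ->
  wiener_image P beta (k, l) (heat L t k l) (J k l t).
Hypothesis energy_int : forall s' b, (s' == s) || (s' == 0) ->
  (\int[P]_w path_energy L T rho q (fun k l t => J k l t w) s' b < +oo)%E.

Let mJ k l t (t0 : 0 <= t) (tT : t <= T) : cmeasurable (J k l t) := (HJ k l t0 tT).1.

Let energy s' b w := path_energy L T rho q (fun k l t => J k l t w) s' b.

Let m_energy s' b : measurable_fun setT (energy s' b).
Proof. exact: measurable_path_energy. Qed.

Let energy_ge0 s' b w : (0 <= energy s' b w)%E.
Proof. exact: path_energy_ge0. Qed.

Let total w : \bar R := ((energy s true w + energy s false w) + (energy 0 true w + energy 0 false w))%E.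

Let m_total : measurable_fun setT total.
Proof. by apply: emeasurable_funD; exact: emeasurable_funD. Qed.

Definition good : set Omega := [set w | (total w < +oo)%E].

Lemma measurable_good : measurable good.
Proof.
by rewrite /good -[X in measurable X]setTI; apply: emeasurable_fun_infty_o.
Qed.

Lemma ae_good : {ae P, forall w, good w}.
Proof.
have fin a b : (a == s) || (a == 0) -> {ae P, forall w, (energy a b w < +oo)%E}.
  move=> a_; have : P.-integrable setT (energy a b).
    apply/integrableP; split; first exact: m_energy.
    under eq_integral do rewrite gee0_abs ?energy_ge0//.
    exact: energy_int.
  move=> /(integrable_ae measurableT); apply: filterS => w /(_ Logic.I).
  by rewrite ge0_fin_numE// energy_ge0.
have f3 a : (a == s) || (a == 0) -> {ae P, forall w, (energy a true w + energy a false w < +oo)%E}.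
  move=> a_; move: (fin a true a_) (fin a false a_); apply: filterS2 => w.
  exact: lte_add_pinfty.
have fs := f3 s ltac:(by rewrite eqxx); have f0 := f3 0 ltac:(by rewrite eqxx orbT).
move: fs f0; apply: filterS2 => w; exact: lte_add_pinfty.
Qed.

(* Setting the coefficients to 0 on the null set where the energy is infinite
   makes every path regular, not only almost every path. *)
Definition Jgood k l t w : R[i] := Complex (\1_good w) 0 * J k l t w.

Lemma Jgood_good w : good w -> (fun k l t => Jgood k l t w) = (fun k l t => J k l t w).
Proof.
move=> gw; apply/funext => k; apply/funext => l; apply/funext => t.
by rewrite /Jgood indicE mem_set// mul1r.
Qed.

Lemma Jgood_bad w : ~ good w -> (fun k l t => Jgood k l t w) = (fun k l t => 0).
Proof.
move=> gw; apply/funext => k; apply/funext => l; apply/funext => t.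
by rewrite /Jgood indicE memNset// mul0r.
Qed.

Lemma cmeasurable_Jgood k l t : 0 <= t -> t <= T -> cmeasurable (Jgood k l t).
Proof.
move=> t0 tT; apply: cmeasurableM; last exact: mJ.
split => //; apply: measurable_indic; exact: measurable_good.
Qed.

Lemma path_energy0 a b : path_energy L T rho q (fun _ _ _ => 0) a b = 0%E.
Proof.
have l0 n i : level L T (fun _ _ _ => 0) a b n i = cst 0.
  apply/funext => z; rewrite /level /wave /trig big1 => [|k _]; first by case: b.
  by rewrite big1// => l _; rewrite mulr0 mul0r.
have s0 : (cst 0 \- cst 0)%R = cst 0 :> (plane R -> R) by apply/funext => z /=; rewrite subrr.
rewrite /path_energy !l0 !Lq0// !adde0 /chain_energy.
apply: eseries0 => n _ _.
rewrite /time_variation /level_variation !big1 ?adde0 ?mule0// => i _; by rewrite !l0 s0 Lq0.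
Qed.

Lemma Jgood_energy w a b : (a == s) || (a == 0) ->
  (path_energy L T rho q (fun k l t => Jgood k l t w) a b < +oo)%E.
Proof.
move=> a_; have [gw|gw] := pselect (good w); last by rewrite Jgood_bad// path_energy0 ltry.
rewrite Jgood_good// -/(energy a b w).
have e0 a' b' := energy_ge0 a' b' w.
have e2 a' b' c' : (0 <= energy a' b' w + energy a' c' w)%E by apply: adde_ge0; exact: e0.
apply: le_lt_trans gw; rewrite /total.
case/orP: a_ => /eqP ->; case: b.
- apply: le_trans (leeDl _ (e2 _ _ _)); exact: leeDl.
- apply: le_trans (leeDl _ (e2 _ _ _)); exact: leeDr.
- apply: le_trans (leeDr _ (e2 _ _ _)); exact: leeDl.
- apply: le_trans (leeDr _ (e2 _ _ _)); exact: leeDr.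
Qed.

Definition path_field t w : R * R -> R[i] := path L T (fun k l u => Jgood k l u w) 0 t.

Lemma path_field_random t : random_field L (path_field t).
Proof.
split; last by move=> w; exact: periodic_path.
by apply: cmeasurable_path_joint => // k l u; exact: cmeasurable_Jgood.
Qed.

Let ex_energy w a : (a == s) || (a == 0) ->
  exists e, forall b, (path_energy L T rho q (fun k l u => Jgood k l u w) a b <= e%:E)%E.
Proof.
move=> a_.
have E0 b := path_energy_ge0 L T q r0 (fun k l u => Jgood k l u w) a b.
have fi b : path_energy L T rho q (fun k l u => Jgood k l u w) a b \is a fin_num.
  by rewrite ge0_fin_numE// Jgood_energy.
exists (fine (path_energy L T rho q (fun k l u => Jgood k l u w) a true) +
  fine (path_energy L T rho q (fun k l u => Jgood k l u w) a false)).
by case; rewrite -[leLHS](fineK (fi _)) lee_fin ?lerDl ?lerDr fine_ge0.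
Qed.

Lemma path_field_Lp t w p' : 1 <= p' -> p' <= q%:R -> 0 <= t -> t <= T -> Lp_fun L p' (path_field t w).
Proof.
move=> p1' pq' t0 tT; have [e fe] := @ex_energy w 0 ltac:(by rewrite eqxx orbT).
exact: (path_Lp L0 T0 q0 r0 r1 fe).
Qed.

Lemma path_field_holder alpha w : 0 < alpha -> rho = 2 `^ (- alpha) ->
  holder_W L T alpha s p (fun t => distr_of L (path_field t w)).
Proof.
move=> a0 rhoE; apply: (path_holder_W L0 T0 q0 r0 r1 p1 pq a0 rhoE) => b; apply: Jgood_energy.
  by rewrite eqxx.
by rewrite eqxx orbT.
Qed.

Variable Z : R -> Omega -> R * R -> R[i].

Let Jw w k l t := J k l t w.

(** The series for the solution is truncated at time [t] itself, the chain at the grid time below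
    [t]. The increment bound for [m = 1] shows that the two have the same limit in mean square. *)
Lemma wave_time_cvg t : 0 <= t -> t <= T ->
  (\int[P]_w \int[nu2 L]_z (cmod (wave L (Jw w) 0 (2 ^ n) t z - approx L T (Jw w) 0 n t z) ^+ 2)%:E
    @[n --> \oo] --> 0)%E.
Proof.
move=> t0 tT.
have th4' : theta < 4^-1 - 0 by rewrite subr0.
have [C C0 HC] := time_variance T L0 th4'.
have th1 : theta <= 1 by move: th4; lra.
pose V n := (2 * C + 1) * T `^ theta * (2^-1 `^ theta) ^+ n.
have V0 n : 0 <= V n by rewrite mulr_ge0 ?exprn_ge0 ?powR_ge0// mulr_ge0 ?powR_ge0// addr_ge0// mulr_ge0.
have c0 : 0 <= moment_cst 1 :> R by exact: moment_cst_ge0.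
pose D b n (wz : Omega * plane R) : R := component b (wave L (Jw wz.1) 0 (2 ^ n) t wz.2) -
  component b (approx L T (Jw wz.1) 0 n t wz.2).
have mD b n : measurable_fun setT (D b n).
  have [g1 g1T] := grid_itv T0 n (dyadic_index T n t).
  apply: measurable_funB; apply: measurable_component.
    exact: (cmeasurable_wave_joint L 0 mJ (2 ^ n) t0 tT).
  exact: (cmeasurable_wave_joint L 0 mJ (2 ^ n) g1 g1T).
have bnd b n : (\int[P]_w Lq (nu2 L) (2 * 1) (fun z => D b n (w, z)) <= (moment_cst 1 * V n ^+ 1)%:E)%E.
  have [g1 g1T] := grid_itv T0 n (dyadic_index T n t).
  have [gt1 gt2] := grid_dyadic T0 n t0 tT.
  apply: expected_Lq_le => //; first by rewrite mulr_ge0// exprn_ge0.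
  move=> z; apply: (wave_increment_moment Wbeta HJ 1 b z th0 th1 g1 gt1 tT).
  have x0 : 0 < T / 2 ^+ n by rewrite divr_gt0 ?exprn_gt0.
  have VE : V n = (2 * C + 1) * (T / 2 ^+ n) `^ theta.
    by rewrite powRM ?invr_ge0 ?exprn_ge0 ?(ltW T0)// -exprVn powR_exprn// mulrA.
  have xp : 0 < (T / 2 ^+ n) `^ theta by rewrite powR_gt0.
  have h : (t - grid T n (dyadic_index T n t)) `^ theta <= (T / 2 ^+ n) `^ theta.
    by apply: ge0_ler_powR; rewrite ?nnegrE ?subr_ge0 ?(ltW th0) ?(ltW x0).
  have h2 := HC (2 ^ n)%N _ _ g1 gt1 tT.
  rewrite VE; apply: (@le_lt_trans _ _ (2 * (C * (T / 2 ^+ n) `^ theta))).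
    rewrite ler_pM2l//; apply: le_trans h2 _; exact: ler_wpM2l.
  by rewrite mulrA ltr_pM2r// ltrDl.
have cVn : V n @[n --> \oo] --> (0 : R).
  rewrite -[X in _ --> X](mulr0 ((2 * C + 1) * T `^ theta)); apply: cvgM; first exact: cvg_cst.
  have h1 : 2^-1 `^ theta < 1 `^ theta :> R.
    by apply: gt0_ltr_powR; rewrite ?nnegrE// invf_lt1// ltr1n.
  by apply: cvg_expr; rewrite gtr0_norm ?powR_gt0//; move: h1; rewrite powR1.
have cV : (moment_cst 1 * V n ^+ 1)%:E @[n --> \oo] --> 0%:E.
  apply: cvg_EFin; first exact: nearW.
  rewrite -[X in _ --> X](mulr0 (moment_cst 1)); apply: cvgM; [exact: cvg_cst|exact: cVn].
have c2V : ((moment_cst 1 * V n ^+ 1)%:E + (moment_cst 1 * V n ^+ 1)%:E)%E @[n --> \oo] --> 0%E.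
  by rewrite -[X in _ --> X]adde0; apply: cvgeD => //.
apply: ge0_cvge0_le c2V.
  by move=> n; apply: integral_ge0 => w _; apply: integral_ge0 => z _; rewrite lee_fin sqr_ge0.
move=> n; apply: le_trans (leeD (bnd true n) (bnd false n)).
have mL b : measurable_fun setT (fun w => Lq (nu2 L) (2 * 1) (fun z => D b n (w, z))).
  exact: (measurable_Lq_section L0 (2 * 1) (mD b n)).
rewrite -ge0_integralDT//; try by move=> w; exact: Lq_ge0.
rewrite le_eqVlt; apply/orP; left; apply/eqP; apply: eq_integral => w _.
have mS b : measurable_fun setT (fun z => (`|D b n (w, z)| ^+ (2 * 1))%:E).
  by apply: measurable_Lq_integrand; exact: measurable_section.
rewrite /Lq -ge0_integralDT//; try by move=> z; rewrite lee_fin exprn_ge0.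
apply: eq_integral => z _; rewrite -EFinD; congr EFin.
by rewrite cmod_sqr ReB ImB muln1 !real_normK ?num_real.
Qed.

(** The chain converges to the path at almost every point, but to the solution only in mean square.
    The squared distances from [Z] to the truncated series and from there to the chain are added,
    and the limit inferior of the sum vanishes almost everywhere, which leaves a single possible
    limit. *)
Lemma path_field_modification t : 0 <= t -> t <= T -> random_field L (Z t) ->
  (\int[P]_w \int[nu2 L]_z (cmod (Z t w z - \sum_(k <- int_box N) \sum_(l <- int_box N)
     J k l t w * ebasis L k l z) ^+ 2)%:E @[N --> \oo] --> 0)%E ->
  {ae P, forall w, {ae nu2 L, forall z, path_field t w z = Z t w z}}.
Proof.
move=> t0 tT [mZ _] ZJ.
have waveE w N z : wave L (Jw w) 0 N t z = \sum_(k <- int_box N) \sum_(l <- int_box N) J k l t w * ebasis L k l z.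
  apply: eq_bigr => k _; apply: eq_bigr => l _.
  have -> : bessel L 0 k l = 1 by rewrite /bessel mul0r powRr0.
  by rewrite mul1r.
pose A n (x : Omega * plane R) := (cmod (Z t x.1 x.2 - wave L (Jw x.1) 0 (2 ^ n) t x.2) ^+ 2)%:E.
pose B n (x : Omega * plane R) := (cmod (wave L (Jw x.1) 0 (2 ^ n) t x.2 - approx L T (Jw x.1) 0 n t x.2) ^+ 2)%:E.
have mW n : cmeasurable (fun x : Omega * plane R => wave L (Jw x.1) 0 (2 ^ n) t x.2).
  exact: (cmeasurable_wave_joint L 0 mJ (2 ^ n) t0 tT).
have mAp n : cmeasurable (fun x : Omega * plane R => approx L T (Jw x.1) 0 n t x.2).
  have [g1 g1T] := grid_itv T0 n (dyadic_index T n t).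
  exact: (cmeasurable_wave_joint L 0 mJ (2 ^ n) g1 g1T).
have mA n : measurable_fun setT (A n) by apply: measurable_cmod_sqr; exact: cmeasurableB.
have mB n : measurable_fun setT (B n) by apply: measurable_cmod_sqr; exact: cmeasurableB.
have A0 n x : (0 <= A n x)%E by rewrite lee_fin sqr_ge0.
have B0 n x : (0 <= B n x)%E by rewrite lee_fin sqr_ge0.
have nf : (nu2 L setT < +oo)%E by rewrite nu2_setT// ltry.
have cA : (\int[P]_w \int[nu2 L]_z A n (w, z) @[n --> \oo] --> 0)%E.
  have c2 : (2 ^ n)%N @[n --> \oo] --> \oo.
    apply/cvgnyPge => N; near=> n; apply: (@leq_trans n); last exact/ltnW/ltn_expl.
    by near: n; exact: nbhs_infty_ge.
  have := cvg_comp _ _ c2 ZJ; apply: cvg_trans; apply: near_eq_cvg; apply: nearW => n /=.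
  by apply: eq_integral => w _; apply: eq_integral => z _; rewrite /A waveE.
have cB : (\int[P]_w \int[nu2 L]_z B n (w, z) @[n --> \oo] --> 0)%E by exact: wave_time_cvg.
pose f n x := (2%:E * A n x + 2%:E * B n x)%E.
have mf n : measurable_fun setT (f n) by apply: emeasurable_funD; exact: emeasurable_funM.
have f0 n x : (0 <= f n x)%E by rewrite adde_ge0// mule_ge0// lee_fin.
have cf : (\int[P]_w \int[nu2 L]_z f n (w, z) @[n --> \oo] --> 0)%E.
  have := cvge0_double_sum cA cB; apply: cvg_trans; apply: near_eq_cvg; apply: nearW => n /=.
  have msec (g : Omega * plane R -> \bar R) w : measurable_fun setT g -> measurable_fun setT (fun z => g (w, z)).
    by move=> mg; apply: measurableT_comp mg _; exact: pair1_measurable.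
  have sA : measurable_fun setT (fun w => \int[nu2 L]_z A n (w, z))%E by exact: measurable_integral_section.
  have sB : measurable_fun setT (fun w => \int[nu2 L]_z B n (w, z))%E by exact: measurable_integral_section.
  have iA w : (0 <= \int[nu2 L]_z A n (w, z))%E by exact: integral_ge0.
  have iB w : (0 <= \int[nu2 L]_z B n (w, z))%E by exact: integral_ge0.
  rewrite -(integral_double_sum P sA sB iA iB).
  apply: eq_integral => w _.
  exact: (esym (integral_double_sum (nu2 L) (msec _ w (mA n)) (msec _ w (mB n)) (fun z => A0 n (w, z)) (fun z => B0 n (w, z)))).
have aeF := ae_limn_einf_eq0 nf mf f0 cf.
move: aeF ae_good; apply: filterS2 => w aeF gw.
have [e fe] := @ex_energy w 0 ltac:(by rewrite eqxx orbT).
rewrite /path_field; move: fe; rewrite (Jgood_good gw) => fe.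
have cc b : {ae nu2 L, forall z, chain T (level L T (Jw w) 0 b) t n z @[n --> \oo] -->
    chain_limit T (level L T (Jw w) 0 b) t z}.
  exact: (chain_limit_cvg T0 q0 r0 r1 (measurable_level L T (Jw w) 0 b) (chain_energy_fin fe b) t0 tT).
have key b z : limn_einf (fun n => f n (w, z)) = 0%E ->
    chain T (level L T (Jw w) 0 b) t n z @[n --> \oo] --> chain_limit T (level L T (Jw w) 0 b) t z ->
    component b (path L T (Jw w) 0 t z) = component b (Z t w z).
  move=> lf cz; rewrite component_path.
  set y := chain_limit _ _ _ _ in cz *; pose a := Z t w z.
  change (y = component b a); set zz := component b a.
  apply/eqP; rewrite -subr_eq0 -sqrf_eq0; apply/eqP/le_anti; rewrite sqr_ge0 andbT.
  (* If the components differed, the squared distance of the chain to [Z] would eventually exceed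
     half its positive limit, and so would the sum with vanishing limit inferior. *)
  rewrite leNgt; apply/negP => ypos.
  have cs : (chain T (level L T (Jw w) 0 b) t n z - zz) ^+ 2 @[n --> \oo] --> (y - zz) ^+ 2.
    have := cvgB cz (cvg_cst zz) => /(_ _ _) H.
    by rewrite expr2; under eq_fun do rewrite expr2; apply: cvgM; apply: cvgB => //; exact: cvg_cst.
  have h2 : (y - zz) ^+ 2 / 2 < (y - zz) ^+ 2 by lra.
  have nr := cvgr_gt _ cs _ h2.
  have : (((y - zz) ^+ 2 / 2)%:E <= limn_einf (fun n => f n (w, z)))%E.
    apply: limn_einf_ge_near; case: nr => N _ nr; exists N => // n {}/nr /= nr.
    pose u := wave L (Jw w) 0 (2 ^ n) t z; pose v := approx L T (Jw w) 0 n t z.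
    have -> : f n (w, z) = (2 * cmod (a - u) ^+ 2 + 2 * cmod (u - v) ^+ 2)%:E by [].
    rewrite lee_fin; apply: le_trans (ltW nr) _.
    have -> : chain T (level L T (Jw w) 0 b) t n z = component b v by [].
    have h (x1 x2 x3 : R) : (x3 - x1) ^+ 2 <= 2 * (x1 - x2) ^+ 2 + 2 * (x2 - x3) ^+ 2.
      have := sqr_ge0 ((x1 - x2) - (x2 - x3)); lra.
    have hc (x : R[i]) : component b x ^+ 2 <= cmod x ^+ 2.
      by rewrite cmod_sqr; case: (b); rewrite /= ?lerDl ?lerDr sqr_ge0.
    have hB (x x' : R[i]) : component b (x - x') = component b x - component b x'.
      by case: (b); rewrite /= ?ReB ?ImB.
    apply: le_trans (h (component b a) (component b u) (component b v)) _.
    by rewrite -!hB; apply: lerD; rewrite ler_pM2l.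
  by rewrite lf lee_fin leNgt divr_gt0.
move: aeF (cc true) (cc false); apply: filterS3 => z lf c1 c2.
apply: eq_complexP; [exact: (key true)|exact: (key false)].
Unshelve. all: by end_near.
Qed.

End Modification.

(** * Choice of the exponents *)

Section Exponents.
Context {R : realType}.

Lemma ex_exponents (s alpha p : R) : 0 <= s -> 0 < alpha -> alpha < 8^-1 - s -> 1 <= p ->
  exists theta : R, exists m : nat,
    [/\ 0 < theta, theta < 4^-1 - s, (0 < m)%N, p <= (2 * m)%:R &
      (2 `^ (- alpha))^-1 ^+ (2 * m) * 2 * (2^-1 `^ theta) ^+ m < 1].
Proof.
move=> s0 a0 as_ p1.
(* Half the gap between [2 * alpha] and [1/4 - s], so that [theta = 2 * alpha + delta] lies midway
   between them. *)
pose delta := (4^-1 - s - 2 * alpha) / 2.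
have d0 : 0 < delta by rewrite /delta divr_gt0// subr_gt0; lra.
(* The term [delta^-1] gives [1 < delta * m], and the term [p] gives [p <= 2 * m]. *)
pose m := (Num.truncn (delta^-1 + p)).+1.
have x0 : 0 <= delta^-1 + p by rewrite addr_ge0 ?invr_ge0 ?(ltW d0)//; lra.
have /andP[_ mx] := truncn_itv x0; rewrite -/m in mx.
have di0 : 0 < delta^-1 by rewrite invr_gt0.
have md : 1 < delta * m%:R.
  have h : delta^-1 < m%:R by lra.
  by rewrite -(ltr_pdivrMl _ _ d0) mulr1.
exists (2 * alpha + delta), m; split => //.
- lra.
- by rewrite /delta; lra.
- by rewrite natrM; lra.
have pos : 0 < delta * m%:R - 1 by rewrite subr_gt0.
(* The exponents of 2 add up to [2 * alpha * m + 1 - (2 * alpha + delta) * m], which is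
   [1 - delta * m]. *)
have -> : (2 `^ (- alpha))^-1 ^+ (2 * m) * 2 * (2^-1 `^ (2 * alpha + delta)) ^+ m = 2 `^ (- (delta * m%:R - 1)) :> R.
  have -> : (2 `^ (- alpha))^-1 ^+ (2 * m) = 2 `^ (alpha * (2 * m)%:R) :> R.
    by rewrite powRN invrK -powR_mulrn ?powR_ge0// -powRrM.
  have -> : (2^-1 `^ (2 * alpha + delta)) ^+ m = 2 `^ (-1 * (2 * alpha + delta) * m%:R) :> R.
    by rewrite -powR_mulrn ?powR_ge0// -powRrM -[2^-1]powR_inv1// -powRrM mulrA.
  rewrite -[X in _ * X * _](@powRr1 R 2)// -!powRD ?pnatr_eq0 ?implybT//.
  by congr (_ `^ _); rewrite natrM; ring.
rewrite powRN invf_lt1 ?powR_gt0//.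
have : 1 `^ (delta * m%:R - 1) < 2 `^ (delta * m%:R - 1) :> R.
  by apply: gt0_ltr_powR; rewrite ?nnegrE// ltr1n.
by rewrite powR1.
Qed.

End Exponents.

(** * Majorants and comparison of L^p norms *)

Section Majorant.
Import HBNNSimple.

(* The integral of a nonnegative function is the supremum of the integrals of
   the simple functions below it, whether or not it is measurable. *)
Lemma ae_le_integral_majorant (d : measure_display) (X : measurableType d) (R : realType)
    (mu : {measure set X -> \bar R}) (f g : X -> \bar R) :
  (forall x, 0 <= f x)%E -> (forall x, 0 <= g x)%E -> measurable_fun setT g ->
  {ae mu, forall x, (f x <= g x)%E} -> (\int[mu]_x f x <= \int[mu]_x g x)%E.
Proof.
move=> f0 g0 mg fg; rewrite ge0_integralTE//.
apply: ge_ereal_sup => _ /= [h hf <-].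
rewrite -integralT_nnsfun; apply: ae_ge0_le_integral => //.
- by move=> x _; rewrite lee_fin; exact: fun_ge0.
- by apply/measurable_EFinP.
- by move: fg; apply: filterS => x fx _; apply: le_trans fx; exact: hf.
Qed.

End Majorant.

Section LpNorms.
Context {R : realType}.
Variables (L p : R).
Hypotheses (L0 : 0 < L) (p1 : 1 <= p).

Let p0 : 0 < p. Proof. by apply: lt_le_trans p1. Qed.

Let measurable_cmod_powR (f : plane R -> R[i]) : cmeasurable f ->
  measurable_fun setT (fun z => ((cmod (f z)) `^ p)%:E).
Proof.
move=> mf; apply/measurable_EFinP; apply: (measurableT_comp (measurable_powR p)).
exact: measurable_cmod.
Qed.

Lemma ae_eq_Lp_norm (f g : plane R -> R[i]) : cmeasurable f -> cmeasurable g ->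
  {ae nu2 L, forall z, f z = g z} -> Lp_norm L p f = Lp_norm L p g.
Proof.
move=> mf mg fg; rewrite (Lp_normE L p f) (Lp_normE L p g); apply: (congr1 (fun x => x `^ p^-1)%E).
apply: ae_eq_integral => //; try exact: measurable_cmod_powR.
by move: fg; apply: filterS => z fz _; rewrite fz.
Qed.

Lemma Lp_norm_triangle (f g : plane R -> R[i]) : cmeasurable f -> cmeasurable g ->
  (Lp_norm L p f <= Lp_norm L p g + Lp_norm L p (fun z => g z - f z)%R)%E.
Proof.
move=> mf mg.
have mgf : cmeasurable (fun z => g z - f z) by exact: cmeasurableB.
have := @eminkowski _ _ _ (nu2 L) (fun z => cmod (g z)) (fun z => cmod (g z - f z)) p%:E
  (measurable_cmod mg) (measurable_cmod mgf).
rewrite lee_fin => /(_ p1); apply: le_trans.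
rewrite Lp_normE unlock /=.
have pi0 : 0 <= p^-1 by rewrite invr_ge0 ltW.
apply: (gt0_ler_poweR pi0).
- by rewrite in_itv /= leey andbT; apply: integral_ge0 => z _; rewrite lee_fin powR_ge0.
- by rewrite in_itv /= leey andbT; apply: integral_ge0 => z _; rewrite lee_fin powR_ge0.
have tri (x y : R[i]) : cmod x <= cmod y + cmod (y - x).
  have -> : cmod (y - x) = cmod (x - y) by rewrite /cmod -normcN opprB.
  by rewrite -{1}(subrK y x) addrC; exact: le_normcD.
apply: ge0_le_integralT.
- exact: measurable_cmod_powR.
- apply/measurable_EFinP; apply: (measurableT_comp (measurable_powR p)).
  apply: measurableT_comp => //.
  by apply: measurable_funD; exact: measurable_cmod.
- by move=> z; rewrite lee_fin powR_ge0.
- move=> z; rewrite lee_fin ger0_norm ?addr_ge0 ?cmod_ge0//.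
  by apply: ge0_ler_powR; rewrite ?nnegrE ?addr_ge0 ?cmod_ge0 ?(ltW p0).
Qed.

End LpNorms.

Lemma mild_solution_wiener_image (d : measure_display) (R : realType)
    (Omega : measurableType d) (P : probability Omega R) beta (L T : R) J :
  cylindrical_wiener P beta ->
  (forall k l t, 0 <= t <= T ->
    wiener_integral P t (fun r => expR ((t - r) * lambda L 1 k l)) (beta k l) (J k l t)) ->
  forall k l t, 0 <= t -> t <= T -> wiener_image P beta (k, l) (heat L t k l) (J k l t).
Proof.
move=> Wbeta HJ k l t t0 tT.
have tt : 0 <= t <= T by rewrite t0.
exact: (wiener_integral_image (i := (k, l)) (HJ k l t tt)).
Qed.

Lemma holder_modification (R : realType) (L T p s alpha : R) (d : measure_display)
    (Omega : measurableType d) (P : probability Omega R) beta Z :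
  0 < L -> 0 < T -> 1 <= p -> 0 <= s -> 0 < alpha -> alpha < 8^-1 - s ->
  cylindrical_wiener P beta -> mild_solution P L T beta Z ->
  exists2 Z' : R -> Omega -> R * R -> R[i],
    modification P L T Z Z' & forall w, holder_W L T alpha s p (fun t => distr_of L (Z' t w)).
Proof.
move=> L0 T0 p1 s0 a0 as_ Wbeta [J [HJ HZ]].
have HI := mild_solution_wiener_image Wbeta HJ.
have [theta [m [th0 sth m0 pm rat]]] := ex_exponents s0 a0 as_ p1.
pose rho : R := 2 `^ (- alpha).
have r0 : 0 < rho by exact: powR_gt0.
have r1 : rho < 1.
  rewrite /rho powRN invf_lt1 ?powR_gt0//.
  have : 1 `^ alpha < 2 `^ alpha :> R by apply: gt0_ltr_powR; rewrite ?nnegrE// ltr1n.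
  by rewrite powR1.
(* The exponent chosen for [s] also serves for 0, so both constructions run with the same [rho] and
   the same [m] on the same coefficients. *)
have th4 : theta < 4^-1 by lra.
have th40 : theta < 4^-1 - 0 by rewrite subr0.
have q0 : (0 < 2 * m)%N by rewrite muln_gt0.
have [B B0 HB] := expected_path_energy L0 T0 s0 th0 sth r0 rat.
have [B' B'0 HB'] := expected_path_energy L0 T0 (lexx 0) th0 th40 r0 rat.
have en a b : (a == s) || (a == 0) ->
    (\int[P]_w path_energy L T rho (2 * m) (fun k l t => J k l t w) a b < +oo)%E.
  case/orP => /eqP ->.
    by apply: le_lt_trans (HB _ _ _ _ _ Wbeta HI b) _; rewrite ltry.
  by apply: le_lt_trans (HB' _ _ _ _ _ Wbeta HI b) _; rewrite ltry.
exists (path_field L T rho s (2 * m) J).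
  move=> t /andP[t0 tT]; have tt : 0 <= t <= T by rewrite t0.
  have [Zr Zc] := HZ _ tt.
  split.
  - exact: (path_field_random s (2 * m) L0 T0 r0 HI).
  - move=> w; apply: (path_field_Lp s L0 T0 q0 r0 r1) => //.
    by rewrite ler1n.
  - exact: (path_field_modification Wbeta L0 T0 q0 r0 r1 th0 th4 HI en t0 tT Zr Zc).
move=> w; exact: (path_field_holder s L0 T0 q0 r0 r1 p1 pm).
Qed.

(** * Expectation of the supremum *)

Section Supremum.
Context {d : measure_display} {R : realType} {Omega : measurableType d}.
Variable P : probability Omega R.
Variable beta : int -> int -> R -> Omega -> R[i].
Hypothesis Wbeta : cylindrical_wiener P beta.
Variables (L T rho theta p B : R) (q : nat).
Hypotheses (L0 : 0 < L) (T0 : 0 < T) (q0 : (0 < q)%N) (r0 : 0 < rho) (r1 : rho < 1)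
  (th0 : 0 < theta) (th4 : theta < 4^-1).
Hypotheses (p1 : 1 <= p) (pq : p <= q%:R).
Variable J : int -> int -> R -> Omega -> R[i].
Hypothesis HJ : forall k l t, 0 <= t -> t <= T ->
  wiener_image P beta (k, l) (heat L t k l) (J k l t).
Hypothesis energy_le : forall b,
  (\int[P]_w path_energy L T rho q (fun k l t => J k l t w) 0 b <= B%:E)%E.
Variables Z Z' : R -> Omega -> R * R -> R[i].
Hypothesis HZ : forall t, 0 <= t <= T -> random_field L (Z t) /\
  (\int[P]_w \int[nu2 L]_z (cmod (Z t w z - \sum_(k <- int_box N) \sum_(l <- int_box N)
     J k l t w * ebasis L k l z) ^+ 2)%:E @[N --> \oo] --> 0)%E.
Hypothesis ZZ' : modification P L T Z Z'.
Hypothesis cZ' : forall w, continuous_Lp L T p (fun t => Z' t w).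

Let en b w := path_energy L T rho q (fun k l t => J k l t w) 0 b.
Let K : R := 2 * (2 ^+ q * (chain_cst rho q + 1)).

Lemma sup_cst_ge0 : 0 <= K.
Proof. by rewrite /K !mulr_ge0 ?exprn_ge0// addr_ge0// chain_cst_ge0. Qed.

(* The supremum over [0,T] need not be measurable in w, but this majorant is. *)
Definition sup_majorant w : \bar R := (2%:E * (1%:E + K%:E * (en true w + en false w)))%E.

Let en_ge0 b w : (0 <= en b w)%E. Proof. exact: path_energy_ge0. Qed.

Let m_en b : measurable_fun setT (en b).
Proof. by apply: measurable_path_energy => // k l t t0 tT; have [] := HJ k l t0 tT. Qed.

Let en_sum_ge0 w : (0 <= en true w + en false w)%E.
Proof. by apply: adde_ge0; exact: en_ge0. Qed.

Let K_en_ge0 w : (0 <= K%:E * (en true w + en false w))%E.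
Proof. by apply: mule_ge0; [rewrite lee_fin; exact: sup_cst_ge0|exact: en_sum_ge0]. Qed.

Lemma sup_majorant_ge0 w : (0 <= sup_majorant w)%E.
Proof.
apply: mule_ge0; first by rewrite lee_fin.
by apply: adde_ge0; [rewrite lee_fin|exact: K_en_ge0].
Qed.

Let m_en_sum : measurable_fun setT (fun w => en true w + en false w)%E.
Proof. by apply: emeasurable_funD; exact: m_en. Qed.

Let m_K_en : measurable_fun setT (fun w => K%:E * (en true w + en false w))%E.
Proof. by apply: emeasurable_funM => //; exact: m_en_sum. Qed.

Lemma measurable_sup_majorant : measurable_fun setT sup_majorant.
Proof. by apply: emeasurable_funM => //; apply: emeasurable_funD => //; exact: m_K_en. Qed.

Lemma integral_sup_majorant_le : (\int[P]_w sup_majorant w <= (2 * (1 + K * (B + B)))%:E)%E.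
Proof.
have m1 : measurable_fun setT (fun w => 1%:E + K%:E * (en true w + en false w))%E.
  by apply: emeasurable_funD => //; exact: m_K_en.
have p1' w : (0 <= 1%:E + K%:E * (en true w + en false w))%E.
  by apply: adde_ge0; [rewrite lee_fin|exact: K_en_ge0].
rewrite (ge0_integralZT P _ m1 p1')// (EFinM 2 (1 + K * (B + B))).
apply: lee_wpmul2l; first by rewrite lee_fin.
have E1 : (\int[P]_w (1%:E + K%:E * (en true w + en false w)) =
    \int[P]_w 1%:E + \int[P]_w (K%:E * (en true w + en false w)))%E.
  exact: (ge0_integralDT P (measurable_cst 1%:E) m_K_en (fun=> lee01) K_en_ge0).
rewrite E1 EFinD; apply: leeD.
  by rewrite integral_cst// mul1e; exact: probability_le1.
rewrite (ge0_integralZT P sup_cst_ge0 m_en_sum en_sum_ge0) (EFinM K).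
apply: lee_wpmul2l; first by rewrite lee_fin; exact: sup_cst_ge0.
rewrite (ge0_integralDT P (m_en true) (m_en false) (en_ge0 true) (en_ge0 false)) EFinD.
by apply: leeD; exact: energy_le.
Qed.

(** The form that the results on the modification take when [s = 0], where the two admissible
    exponents coincide. *)
Let energy_int a b : (a == 0) || (a == 0) ->
  (\int[P]_w path_energy L T rho q (fun k l t => J k l t w) a b < +oo)%E.
Proof. by rewrite orbb => /eqP ->; apply: le_lt_trans (energy_le b) _; rewrite ltry. Qed.

Lemma path_field_norm_le w t : 0 <= t -> t <= T -> good L T rho 0 q J w ->
  (Lp_norm L p (path_field L T rho 0 q J t w) <= sup_majorant w)%E.
Proof.
move=> t0 tT gw; rewrite /path_field (Jgood_good gw).
have fin b : en b w \is a fin_num.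
  rewrite ge0_fin_numE ?en_ge0//; apply: le_lt_trans gw.
  apply: le_trans (leeDl (en true w + en false w)%E (en_sum_ge0 w)).
  by case: b; [exact: (leeDl _ (en_ge0 false w))|exact: (leeDr _ (en_ge0 true w))].
pose e := fine (en true w) + fine (en false w).
have fe b : (path_energy L T rho q (fun k l t => J k l t w) 0 b <= e%:E)%E.
  have f0 b' : 0 <= fine (en b' w) by rewrite fine_ge0 ?en_ge0.
  by rewrite -[leLHS](fineK (fin b)) lee_fin /e; case: b; rewrite ?lerDl ?lerDr f0.
apply: le_trans (path_norm_le L0 T0 q0 r0 r1 fe p1 pq t0 tT) _.
have -> : sup_majorant w = (2 * (1 + K * e))%:E.
  by rewrite /sup_majorant -(fineK (fin true)) -(fineK (fin false)).
rewrite lee_fin /K le_eqVlt; apply/orP; left; apply/eqP; ring.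
Qed.

(** The exceptional sets of the countably many grid points are discarded before a time is fixed. As
    the majorant is the same for all times, continuity in L^p carries it from grid points below [t]
    to [t]. *)
Lemma ae_Lp_norm_le : {ae P, forall w, forall t, 0 <= t -> t <= T ->
  (Lp_norm L p (Z' t w) <= sup_majorant w)%E}.
Proof.
have itv n i : 0 <= grid T n i <= T by have [-> ->] := grid_itv T0 n i.
have eqg n i : {ae P, forall w, {ae nu2 L, forall z,
    Z' (grid T n i) w z = path_field L T rho 0 q J (grid T n i) w z}}.
  have [g0 gT] := grid_itv T0 n i.
  have [Zr Zc] := HZ (itv n i); have [_ _ H1] := ZZ' (itv n i).
  have H2 := path_field_modification Wbeta L0 T0 q0 r0 r1 th0 th4 HJ energy_int g0 gT Zr Zc.
  move: H1 H2; apply: filterS2 => w h1 h2; move: h1 h2.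
  apply: (@filterS2 _ (almost_everywhere (nu2 L)) _) => z h1 h2.
  exact: (etrans h1 (esym h2)).
have all_eq : {ae P, forall w, forall n, forall i, {ae nu2 L, forall z,
    Z' (grid T n i) w z = path_field L T rho 0 q J (grid T n i) w z}}.
  by apply: ae_foralln => n; apply: ae_foralln => i; exact: eqg.
have ag : {ae P, forall w, good L T rho 0 q J w} := ae_good L0 T0 r0 HJ energy_int.
move: all_eq ag; apply: filterS2 => w eqw gw t t0 tT.
have [Zfun Zcont] := cZ' w.
have mZ u : 0 <= u <= T -> cmeasurable (Z' u w : plane R -> R[i]) by move=> /Zfun[].
have tt : 0 <= t <= T by rewrite t0.
apply/lee_addgt0Pr => e e0.
have [delta d0 Hd] := Zcont t tt e e0.
have [n n1] : exists n : nat, T / 2 ^+ n < delta.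
  have := near_infty_natSinv_expn_lt (PosNum (divr_gt0 d0 T0)).
  move=> [N _ /(_ N (leqnn N))] /= h; exists N.
  by move: h; rewrite ltr_pdivlMr// mulrC div1r.
have [g1 g2] := grid_dyadic T0 n t0 tT.
set i := dyadic_index T n t in g1 g2.
have [g0 gT] := grid_itv T0 n i.
have close : `|grid T n i - t| < delta.
  by rewrite distrC ger0_norm ?subr_ge0//; apply: le_lt_trans n1.
have tri := Lp_norm_triangle L p1 (mZ _ tt) (mZ _ (itv n i)).
apply: (le_trans tri).
apply: leeD; last by apply: ltW; exact: Hd.
have [_ mpf _] := path_field_Lp 0 L0 T0 q0 r0 r1 J w p1 pq g0 gT.
rewrite (ae_eq_Lp_norm p (mZ _ (itv n i)) mpf (eqw n i)).
exact: path_field_norm_le.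
Qed.

Lemma expected_sup_le :
  (\int[P]_w ereal_sup [set Lp_norm L p (Z' t w) | t in `[0%R, T]%classic]
    <= (2 * (1 + K * (B + B)))%:E)%E.
Proof.
apply: le_trans integral_sup_majorant_le.
apply: ae_le_integral_majorant.
- move=> w; apply: (@le_trans _ _ (Lp_norm L p (Z' 0 w))); first exact: Lnorm_ge0.
  by apply: ereal_sup_ubound; exists 0 => //=; rewrite in_itv /= lexx ltW.
- exact: sup_majorant_ge0.
- exact: measurable_sup_majorant.
- move: ae_Lp_norm_le; apply: filterS => w H; apply: ge_ereal_sup => _ [t /= tt <-].
  by move: tt; rewrite in_itv /= => /andP[t0 tT]; exact: H.
Qed.

End Supremum.

Theorem theorem1 (R : realType) (L T p : R) (hL : 0 < L) (hT : 0 < T)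
    (hp : 1 <= p) :
  exists2 M : R, 0 < M &
  forall (d : measure_display) (Omega : measurableType d)
    (P : probability Omega R)
    (beta : int -> int -> R -> Omega -> R[i])
    (Z : R -> Omega -> R * R -> R[i]),
  cylindrical_wiener P beta ->
  mild_solution P L T beta Z ->
  (forall s alpha : R, 0 <= s -> s < 8^-1 ->
     0 < alpha -> alpha < 8^-1 - s ->
     exists2 Z' : R -> Omega -> R * R -> R[i],
       modification P L T Z Z' &
       forall w, holder_W L T alpha s p (fun t => distr_of L (Z' t w))) /\
  (forall Z' : R -> Omega -> R * R -> R[i],
     modification P L T Z Z' ->
     (forall w, continuous_Lp L T p (fun t => Z' t w)) ->
     (\int[P]_w ereal_sup [set Lp_norm L p (Z' t w) | t in `[0%R, T]%classic]
        <= M%:E)%E).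
Proof.
(* The supremum estimate needs the chaining only for [s = 0] and one Hölder exponent in [(0, 1/8)];
   1/16 is such an exponent, fixed independently of the [s] and [alpha] of the first claim. *)
have a0 : 0 < 16^-1 :> R by rewrite invr_gt0.
have as_ : 16^-1 < 8^-1 - 0 :> R by lra.
have [theta [m [th0 sth m0 pm rat]]] := ex_exponents (lexx 0) a0 as_ hp.
pose rho : R := 2 `^ (- 16^-1).
have r0 : 0 < rho by exact: powR_gt0.
have r1 : rho < 1.
  rewrite /rho powRN invf_lt1 ?powR_gt0//.
  have : 1 `^ (16^-1) < 2 `^ (16^-1) :> R by apply: gt0_ltr_powR; rewrite ?nnegrE// ltr1n.
  by rewrite powR1.
have th4 : theta < 4^-1 by rewrite subr0 in sth.
have q0 : (0 < 2 * m)%N by rewrite muln_gt0.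
have [B B0 HB] := expected_path_energy hL hT (lexx 0) th0 sth r0 rat.
exists (2 * (1 + 2 * (2 ^+ (2 * m) * (chain_cst rho (2 * m) + 1)) * (B + B))).
  have K0 := @sup_cst_ge0 R rho (2 * m) r1.
  by rewrite mulr_gt0// ltr_pwDl// mulr_ge0// addr_ge0.
move=> d Omega P beta Z Wbeta mild; split.
  move=> s alpha s0 _ al0 als; exact: (holder_modification hL hT hp s0 al0 als Wbeta mild).
move=> Z' ZZ' cZ'; have [J [HJ HZ]] := mild.
have HI := mild_solution_wiener_image Wbeta HJ.
exact: (expected_sup_le Wbeta hL hT q0 r0 r1 th0 th4 hp pm HI (HB _ _ _ _ _ Wbeta HI) HZ ZZ' cZ').
Qed.
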